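(* Let $d$ be a constant, $r$ a positive integer, and $\beta>0$ a fixed constant. Let $\mathcal{P}$ be a set of $n$ stochastic points in $\mathbb{R}^d$ in the existential uncertainty model with $p_v\ge\beta$ for all $v$. For $\varepsilon>0$, an $(\varepsilon,r)$-fpow-kernel of $\mathcal{P}$ of size $\widetilde{O}(1/\varepsilon^{rd-r+2})$ can be constructed in $\widetilde{O}(n/\varepsilon^{(rd-r+4)/2})$ time. In particular, the $(\varepsilon,r)$-fpow-kernel consists of $N=\widetilde{O}(\varepsilon^{-(rd-r+4)/2})$ point sets, each occurring with probability $1/N$ and containing $O(\varepsilon^{-r(d-1)/2})$ deterministic points.
   Context: Existential model: each $v\in\mathcal{P}$ is present in a random realization $P\sim\mathcal{P}$ independently with probability $p_v$. The polar set of $\mathcal{P}$ is $\mathcal{P}^\star=\{u\in\mathbb{R}^d:\langle u,v\rangle\ge 0\ \forall v\in\mathcal{P}\}$. For a finite point set $P$ and $u\in\mathcal{P}^\star$, $T_r(P,u)=\max_{v\in P}\langle u,v\rangle^{1/r}-\min_{v\in P}\langle u,v\rangle^{1/r}$ (taken to be $0$ for empty $P$). A set $\mathcal{S}$ of stochastic points (possibly correlated, with a specified distribution) is an $(\varepsilon,r)$-fpow-kernel of $\mathcal{P}$ if for all $u\in\mathcal{P}^\star$: $(1-\varepsilon)\mathbb{E}_{P\sim\mathcal{P}}[T_r(P,u)]\le\mathbb{E}_{P\sim\mathcal{S}}[T_r(P,u)]\le(1+\varepsilon)\mathbb{E}_{P\sim\mathcal{P}}[T_r(P,u)]$. The notation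 $\widetilde{O}$ suppresses polylogarithmic factors in $1/\varepsilon$. *)

(* Defs.v *)
From HB Require Import structures.
From mathcomp Require Import all_boot all_order all_algebra.
From mathcomp Require Import finmap.
From mathcomp Require Import boolp reals exp.

Set Implicit Arguments.
Unset Strict Implicit.
Unset Printing Implicit Defensive.

Import Order.TTheory GRing.Theory Num.Theory.

Local Open Scope fset_scope.
Local Open Scope ring_scope.

Section Kernels.
Variables (R : realType) (d : nat).

Definition point := 'rV[R]_d.

Definition dot (u v : point) : R := \sum_(j < d) u 0 j * v 0 j.

(* A finite random point set: [sp_real w] is the realization in the scenario
   [w].  Arbitrary correlations between the points are allowed. *)
Record stochastic_set := StochasticSet {
  sp_sample : finType;
  sp_prob : sp_sample -> R;
  sp_real : sp_sample -> {fset point};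
  sp_prob_ge0 : forall w, 0 <= sp_prob w;
  sp_prob_sum1 : \sum_w sp_prob w = 1
}.

Definition expectation (S : stochastic_set) (f : {fset point} -> R) : R :=
  \sum_w sp_prob w * f (sp_real (s := S) w).

Definition ground_set (S : stochastic_set) : {fset point} :=
  \big[fsetU/fset0]_(w : sp_sample S) sp_real w.

Record existential_model (n : nat) := ExistentialModel {
  em_point : 'I_n -> point;
  em_prob : 'I_n -> R;
  em_point_inj : injective em_point;
  em_prob_ge0 : forall i, 0 <= em_prob i;
  em_prob_le1 : forall i, em_prob i <= 1
}.

Section Existential.
Variables (n : nat) (P : existential_model n).

Definition em_law (A : {set 'I_n}) : R :=
  \prod_i (if i \in A then em_prob P i else 1 - em_prob P i).

Definition em_real (A : {set 'I_n}) : {fset point} :=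
  [fset em_point P i | i in A]%fset.

Lemma em_law_ge0 A : 0 <= em_law A.
Proof.
apply: prodr_ge0 => i _; case: ifP => _; first exact: em_prob_ge0.
by rewrite subr_ge0 em_prob_le1.
Qed.

Lemma em_law_sum1 : \sum_A em_law A = 1.
Proof. by rewrite -bigA_distr big1 // => i _ /=; rewrite subrKC. Qed.

Definition em_stochastic : stochastic_set :=
  StochasticSet em_real em_law_ge0 em_law_sum1.

End Existential.

Section Uniform.
Variables (N : nat) (N_gt0 : (0 < N)%N) (F : 'I_N -> {fset point}).

Lemma uniform_ge0 (j : 'I_N) : 0 <= N%:R^-1 :> R.
Proof. by rewrite invr_ge0 ler0n. Qed.

Lemma uniform_sum1 : \sum_(j < N) N%:R^-1 = 1 :> R.
Proof.
by rewrite sumr_const card_ord -[LHS]mulr_natl divff // pnatr_eq0 -lt0n.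
Qed.

Definition uniform_family : stochastic_set :=
  StochasticSet F uniform_ge0 uniform_sum1.

End Uniform.

Definition in_polar n (P : existential_model n) (u : point) : Prop :=
  forall i, 0 <= dot u (em_point P i).

(* The roots are nonnegative, so the iterated maximum started at 0 is the
   maximum over a nonempty [A].  Starting the minimum at that maximum makes it
   the minimum over a nonempty [A], and gives [Tr A u = 0] for an empty [A]. *)
Definition Tr (r : nat) (A : {fset point}) (u : point) : R :=
  let M := \big[Num.max/0]_(v <- A) (dot u v `^ r%:R^-1) in
  M - \big[Num.min/M]_(v <- A) (dot u v `^ r%:R^-1).

(* [Tr] is only meaningful when the inner products are nonnegative ([powR] of a
   negative number is a junk value), hence the requirement on the points of
   [S]. *)
Definition fpow_kernel (eps : R) (r n : nat) (P : existential_model n)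
    (S : stochastic_set) : Prop :=
  forall u, in_polar P u ->
    [/\ forall v, v \in ground_set S -> 0 <= dot u v,
        (1 - eps) * expectation (em_stochastic P) (fun A => Tr r A u)
          <= expectation S (fun A => Tr r A u) &
        expectation S (fun A => Tr r A u)
          <= (1 + eps) * expectation (em_stochastic P) (fun A => Tr r A u)].

End Kernels.

(* C (1/eps)^a (1 + log (1/eps))^k, with 1/eps replaced by 1 when eps > 1.
   For k = 0 this is the shape of a plain O((1/eps)^a) bound. *)
Definition polylog_bound (R : realType) (C : R) (k : nat) (a eps : R) : R :=
  let x := Num.max 1 eps^-1 in C * x `^ a * (1 + ln x) ^+ k.

(* A randomized real RAM, as a structured language in which every executed
   statement and every evaluated test costs one unit of time.  A machine has
   integer and real registers, addressed by constants, and an integer and a real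
   memory, addressed indirectly through integer registers.  Program texts
   contain no real constants, and no roots or roundings can be computed. *)
Inductive instr :=
  | IConst of nat & nat
  | IAdd of nat & nat & nat
  | ISub of nat & nat & nat         (* truncated *)
  | ILoad of nat & nat
  | IStore of nat & nat
  | ROfNat of nat & nat
  | RAdd of nat & nat & nat
  | RSub of nat & nat & nat
  | RMul of nat & nat & nat
  | RDiv of nat & nat & nat
  | RLoad of nat & nat
  | RStore of nat & nat.

Inductive test :=
  | ILt of nat & nat
  | RLt of nat & nat
  | Coin of nat.

Inductive stmt :=
  | Do of instr
  | If of test & seq stmt & seq stmt
  | While of test & seq stmt.

Section Machine.
Variable R : realType.

Record store := Store {
  ireg : nat -> nat;
  rreg : nat -> R;
  imem : nat -> nat;
  rmem : nat -> R
}.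

Definition upd (T : Type) (f : nat -> T) (a : nat) (x : T) : nat -> T :=
  fun b => if b == a then x else f b.

Definition set_ireg s a x := Store (upd (ireg s) a x) (rreg s) (imem s) (rmem s).
Definition set_rreg s a x := Store (ireg s) (upd (rreg s) a x) (imem s) (rmem s).
Definition set_imem s a x := Store (ireg s) (rreg s) (upd (imem s) a x) (rmem s).
Definition set_rmem s a x := Store (ireg s) (rreg s) (imem s) (upd (rmem s) a x).

Definition exec (i : instr) (s : store) : store :=
  match i with
  | IConst a c => set_ireg s a c
  | IAdd a b c => set_ireg s a (ireg s b + ireg s c)
  | ISub a b c => set_ireg s a (ireg s b - ireg s c)
  | ILoad a b => set_ireg s a (imem s (ireg s b))
  | IStore a b => set_imem s (ireg s a) (ireg s b)
  | ROfNat a b => set_rreg s a (ireg s b)%:R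
  | RAdd a b c => set_rreg s a (rreg s b + rreg s c)
  | RSub a b c => set_rreg s a (rreg s b - rreg s c)
  | RMul a b c => set_rreg s a (rreg s b * rreg s c)
  | RDiv a b c => set_rreg s a (rreg s b / rreg s c)
  | RLoad a b => set_rreg s a (rmem s (ireg s b))
  | RStore a b => set_rmem s (ireg s a) (rreg s b)
  end.

(* The probability that a test succeeds.  [Coin a] is a fresh independent coin
   whose bias is the content of the real register [a], truncated to [0, 1]. *)
Definition test_prob (b : test) (s : store) : R :=
  match b with
  | ILt a c => (ireg s a < ireg s c)%N%:R
  | RLt a c => (rreg s a < rreg s c)%R%:R
  | Coin a => Num.max 0 (Num.min 1 (rreg s a))
  end.

(* The probability that the list of statements [k], started in the store [s],
   terminates within [t] time units in a store satisfying [Q]. *)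
Fixpoint run_prob (Q : store -> Prop) (t : nat) (k : seq stmt) (s : store)
    {struct t} : R :=
  match k with
  | [::] => `[< Q s >]%:R
  | c :: k' =>
    match t with
    | 0%N => 0
    | t'.+1 =>
      match c with
      | Do i => run_prob Q t' k' (exec i s)
      | If b c1 c2 =>
          test_prob b s * run_prob Q t' (c1 ++ k') s
          + (1 - test_prob b s) * run_prob Q t' (c2 ++ k') s
      | While b c1 =>
          test_prob b s * run_prob Q t' (c1 ++ c :: k') s
          + (1 - test_prob b s) * run_prob Q t' k' s
      end
    end
  end.

(* Real memory holds one block of d + 1 cells per point: its d coordinates,
   followed by its existence probability. *)
Definition input_rmem d n (P : existential_model R d n) (a : nat) : R :=
  if insub (a %/ d.+1)%N is Some i then
    if insub (a %% d.+1)%N is Some j then em_point P i 0 j else em_prob P i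
  else 0.

Definition input_store d n (P : existential_model R d n) (eps : R) : store :=
  Store (upd (fun=> 0%N) 0 n) (upd (fun=> 0) 0 eps) (fun=> 0%N) (input_rmem P).

(* Output convention: integer register 0 holds the number N of point sets; for
   j < N, the integer cells 2j and 2j + 1 hold the start address in real memory
   and the length of the list of points that enumerates the j-th set. *)
Definition read_point d (s : store) (a : nat) : point R d :=
  \row_(j < d) rmem s (a + j)%N.

Definition read_set d (s : store) (j : nat) : {fset point R d} :=
  [fset v in [seq read_point d s (imem s j.*2 + t * d)%N
             | t <- iota 0 (imem s j.*2.+1)]]%fset.

Definition outputs d (s : store) (N : nat) (F : 'I_N -> {fset point R d}) : Prop :=
  ireg s 0 = N /\ forall j, F j = read_set d s j.

End Machine.

(* Main.v *)
(** The whole point set is normalized once: Gaussian elimination with pivoting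
    writes p_i - p_0 = sum_j mu_ij e_j with |mu_ij| <= 1, where |<u, e_j>| is at
    most 2^d times the width W_u of the set in direction u.  In the coordinates mu,
    a realization is replaced by the present points nearest to the nodes of a grid
    of step about eps^(r/2) on the faces of a cube; this displaces its extreme
    points by at most (c eps)^r W_u in every direction.  As x^(1/r) is concave,
    such a displacement changes T_r by at most c eps tau_u, where tau_u is the
    value of T_r on the whole set, and tau_u <= E[T_r] / beta^2 because the two
    extreme points in direction u are both present with probability >= beta^2.

    The number N of realizations is controlled without VC theory.  Rounding the
    coordinates of u and the resulting inner products writes T_r(., u), up to
    c eps tau_u, as a combination with weights of total mass at most 3 tau_u of
    the events that the realization meets H, where H ranges over a family of
    poly(1/eps) sets of points that does not depend on u.  A Chernoff bound and a
    union bound over this family give N = O(eps^-2 log(1/eps)), which leaves time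
    to search each nearest point by brute force. *)
Require Import Defs.
From mathcomp Require Import all_boot all_order all_algebra.
From mathcomp Require Import finmap zify ring lra.
From mathcomp Require Import boolp reals exp.

Set Implicit Arguments.
Unset Strict Implicit.
Unset Printing Implicit Defensive.

Import Order.TTheory GRing.Theory Num.Theory.

Local Open Scope fset_scope.
Local Open Scope ring_scope.

(** * Programs without coins *)

(** The machine has no roots, logarithms or roundings, so no parameter can be computed from [eps]
    directly: [l] counts the doublings that bring [eps] up to 1, and [t] is the least exponent with
    4^t >= 2^(r l), which gives 2^t the order of eps^(-r/2). Sample size, grid and accuracy are
    built from 2^l and 2^t and are right up to constants. With accuracy a = 1 / (kap 2^l), the error
    in a direction is at most 7 a tau_u: 3 from the deviations of the hitting events, 2 from writing
    T_r as their combination, 2 from the nearest points, one at each end. Taking kap > 7 / beta^2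
    turns it into at most eps E[T_r]. The Chernoff exponent is K1 (l + 1) and the number of events
    is polynomial in 2^l, so a constant K1 keeps the failure probability at most delta for every
    eps; the factor l + 1 is the only source of logarithms in the bounds. Only the coin phase is
    probabilistic. All other code is executed by the big-step relation [ev], which removes it from
    [run_prob], and good realizations lead to a good output with certainty. *)

Inductive loc := LInt of nat | LReal of nat | LIMem | LRMem.

(** Registers are addressed by constants, so a program text shows which ones it changes; a memory is
    addressed at run time and therefore counts as one location. *)
Definition writes_instr (x : loc) (i : instr) : bool :=
  match i, x with
  | (IConst a _ | IAdd a _ _ | ISub a _ _ | ILoad a _), LInt b => a == b
  | (ROfNat a _ | RAdd a _ _ | RSub a _ _ | RMul a _ _ | RDiv a _ _ | RLoad a _),
    LReal b => a == b
  | IStore _ _, LIMem => true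
  | RStore _ _, LRMem => true
  | _, _ => false
  end.

Fixpoint writes1 (x : loc) (c : stmt) : bool :=
  match c with
  | Do i => writes_instr x i
  | If _ c1 c2 => has (writes1 x) c1 || has (writes1 x) c2
  | While _ c1 => has (writes1 x) c1
  end.

Definition writes (k : seq stmt) (x : loc) : bool := has (writes1 x) k.

(** Register 1 must hold 1 throughout, because the machine cannot add a constant. *)
Definition For (c b : nat) (body : seq stmt) : seq stmt :=
  [:: Do (IConst c 0); While (ILt c b) (body ++ [:: Do (IAdd c c 1)])].

Lemma writes_cat k1 k2 x : writes (k1 ++ k2) x = writes k1 x || writes k2 x.
Proof. exact: has_cat. Qed.

Section Semantics.
Variable R : realType.
Implicit Types (s : store R) (k : seq stmt).

Definition deterministic (b : test) : bool := if b is Coin _ then false else true.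

Definition holds (b : test) s : bool :=
  match b with
  | ILt a c => (ireg s a < ireg s c)%N
  | RLt a c => rreg s a < rreg s c
  | Coin _ => false
  end.

Definition same (x : loc) s s' : Prop :=
  match x with
  | LInt a => ireg s' a = ireg s a
  | LReal a => rreg s' a = rreg s a
  | LIMem => imem s' = imem s
  | LRMem => rmem s' = rmem s
  end.

Lemma same_refl x s : same x s s.
Proof. by case: x. Qed.

Lemma same_trans x s s' s'' : same x s s' -> same x s' s'' -> same x s s''.
Proof. by case: x => /= [a|a||] -> ->. Qed.

Definition frame k s s' : Prop := forall x, ~~ writes k x -> same x s s'.

Lemma frame_ireg k s s' a : frame k s s' -> ~~ writes k (LInt a) -> ireg s' a = ireg s a.
Proof. by move=> fr; exact: fr (LInt a). Qed.

Lemma frame_rreg k s s' a : frame k s s' -> ~~ writes k (LReal a) -> rreg s' a = rreg s a.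
Proof. by move=> fr; exact: fr (LReal a). Qed.

Lemma frame_imem k s s' : frame k s s' -> ~~ writes k LIMem -> imem s' = imem s.
Proof. by move=> fr; exact: fr LIMem. Qed.

Lemma frame_rmem k s s' : frame k s s' -> ~~ writes k LRMem -> rmem s' = rmem s.
Proof. by move=> fr; exact: fr LRMem. Qed.

(** The time is exact and counts what the fuel of [run_prob] counts, so a run can be cut out of
    [run_prob] without loss ([ev_sound]). *)
Inductive ev : seq stmt -> store R -> nat -> store R -> Prop :=
| ev_nil s : ev [::] s 0 s
| ev_do i k s t s' : ev k (exec i s) t s' -> ev (Do i :: k) s t.+1 s'
| ev_if b c1 c2 k s t1 t2 s1 s' :
    deterministic b -> ev (if holds b s then c1 else c2) s t1 s1 ->
    ev k s1 t2 s' -> ev (If b c1 c2 :: k) s (t1 + t2).+1 s'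
| ev_while0 b c k s t s' :
    deterministic b -> ~~ holds b s -> ev k s t s' ->
    ev (While b c :: k) s t.+1 s'
| ev_while1 b c k s t1 t2 s1 s' :
    deterministic b -> holds b s -> ev c s t1 s1 ->
    ev (While b c :: k) s1 t2 s' -> ev (While b c :: k) s (t1 + t2).+1 s'.

Lemma test_prob_det b s : deterministic b -> test_prob b s = (holds b s)%:R.
Proof. by case: b. Qed.

Lemma ev_sound k s t s' : ev k s t s' ->
  forall Q T k', run_prob Q (t + T) (k ++ k') s = run_prob Q T k' s'.
Proof.
elim=> {k s t s'}
  [s|i k s t s' _ IH|b c1 c2 k s t1 t2 s1 s' db _ IH1 _ IH2
  |b c k s t s' db hb _ IH|b c k s t1 t2 s1 s' db hb _ IH1 _ IH2] Q T k' //=.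
- rewrite test_prob_det //.
  case: (holds b s) IH1 => IH1;
    by rewrite ?mul1r ?mul0r ?subrr ?subr0 ?mul0r ?addr0 ?add0r ?mul1r -addnA IH1 IH2.
- by rewrite test_prob_det // (negbTE hb) mul0r add0r subr0 mul1r IH.
- by rewrite test_prob_det // hb mul1r subrr mul0r addr0 -addnA IH1 IH2.
Qed.

Lemma exec_frame i s x : ~~ writes_instr x i -> same x s (exec i s).
Proof.
by case: i x => [a b|a b c|a b c|a b|a b|a b|a b c|a b c|a b c|a b c|a b|a b]
  [e|e||] //=; rewrite /upd eq_sym => /negbTE ->.
Qed.

Lemma ev_frame k s t s' : ev k s t s' -> frame k s s'.
Proof.
elim=> {k s t s'}
  [s|i k s t s' _ IH|b c1 c2 k s t1 t2 s1 s' db _ IH1 _ IH2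
  |b c k s t s' db hb _ IH|b c k s t1 t2 s1 s' db hb _ IH1 _ IH2] x;
  rewrite /writes /= ?negb_or.
- by move=> _; exact: same_refl.
- move=> /andP[wi wk]; exact: same_trans (exec_frame s wi) (IH _ wk).
- move=> /andP[/andP[w1 w2] wk]; apply: same_trans (IH2 _ wk).
  by apply: IH1; case: (holds b s).
- by move=> /andP[_ wk]; exact: IH.
- move=> /andP[wc wk]; apply: same_trans (IH1 _ wc) (IH2 _ _).
  by rewrite /writes /= negb_or wc.
Qed.

Lemma ev_cat k1 k2 s t1 t2 s1 s2 :
  ev k1 s t1 s1 -> ev k2 s1 t2 s2 -> ev (k1 ++ k2) s (t1 + t2) s2.
Proof.
move=> e1 e2; elim: e1 e2 => {k1 s t1 s1}
  [s|i k s t s' _ IH|b c1 c2 k s t1 t3 s1 s' db h1 IH1 _ IH2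
  |b c k s t s' db hb _ IH|b c k s t1 t3 s1 s' db hb h1 IH1 _ IH2] e2 //=;
  rewrite ?addSn -?addnA.
- by apply: ev_do; exact: IH.
- by apply: ev_if h1 _ => //; exact: IH2.
- by apply: ev_while0 => //; exact: IH.
- by apply: ev_while1 h1 _ => //; exact: IH2.
Qed.

(* Total correctness with a time bound, in weakest-precondition form. *)
Definition runs k s (tau : nat) (Q : store R -> Prop) : Prop :=
  exists t s', [/\ ev k s t s', (t <= tau)%N & Q s'].

Lemma runs_nil s tau (Q : store R -> Prop) : Q s -> runs [::] s tau Q.
Proof. by move=> Qs; exists 0%N, s; split => //; exact: ev_nil. Qed.

Lemma runs_weaken k s t1 t2 (Q1 Q2 : store R -> Prop) :
  (t1 <= t2)%N -> (forall s', Q1 s' -> Q2 s') -> runs k s t1 Q1 -> runs k s t2 Q2.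
Proof.
move=> t12 Q12 [t [s' [e le q]]]; exists t, s'; split => //.
  exact: leq_trans le t12.
exact: Q12.
Qed.

Lemma runs_frame k s tau Q :
  runs k s tau (fun s' => frame k s s' -> Q s') -> runs k s tau Q.
Proof.
move=> [t [s' [e le q]]]; exists t, s'; split => //.
exact/q/(ev_frame e).
Qed.

Lemma runs_cat k1 k2 s t1 t2 Q :
  runs k1 s t1 (fun s1 => runs k2 s1 t2 Q) -> runs (k1 ++ k2) s (t1 + t2) Q.
Proof.
move=> [u1 [s1 [e1 l1 [u2 [s2 [e2 l2 q]]]]]].
by exists (u1 + u2)%N, s2; split; [exact: ev_cat e2|exact: leq_add|].
Qed.

Lemma runs_cat_le T t1 t2 k1 k2 s Q : (t1 + t2 <= T)%N ->
  runs k1 s t1 (fun s1 => runs k2 s1 t2 Q) -> runs (k1 ++ k2) s T Q.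
Proof. by move=> le r; apply: (runs_weaken le) (runs_cat r). Qed.

Lemma runs_do i k s tau Q :
  runs k (exec i s) tau Q -> runs (Do i :: k) s tau.+1 Q.
Proof.
by move=> [t [s' [e l q]]]; exists t.+1, s'; split => //; exact: ev_do.
Qed.

Lemma runs_if b c1 c2 k s t1 t2 Q : deterministic b ->
  runs (if holds b s then c1 else c2) s t1 (fun s1 => runs k s1 t2 Q) ->
  runs (If b c1 c2 :: k) s (t1 + t2).+1 Q.
Proof.
move=> db [u1 [s1 [e1 l1 [u2 [s2 [e2 l2 q]]]]]].
by exists (u1 + u2).+1, s2; split; [exact: ev_if e2|rewrite ltnS leq_add|].
Qed.

(** The number [L] of rounds is fixed in advance and the invariant is indexed by the rounds done.
    The frame hypothesis relates each round to the entry store, so the invariant only has to mention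
    what the body changes. *)
Lemma runs_while b c L tau (I : nat -> store R -> Prop) s : deterministic b ->
  I 0%N s ->
  (forall j s', (j < L)%N -> frame c s s' -> I j s' ->
     holds b s' /\ runs c s' tau (I j.+1)) ->
  (forall s', frame c s s' -> I L s' -> ~~ holds b s') ->
  runs [:: While b c] s (L * tau.+1).+1 (I L).
Proof.
move=> db I0 IS IL.
(* Induction on the number [j] of rounds still to come. *)
have main j s1 : (j <= L)%N -> frame c s s1 -> I (L - j)%N s1 ->
    runs [:: While b c] s1 (j * tau.+1).+1 (I L).
  elim: j s1 => [|j IH] s1 lej fr Ij.
    rewrite subn0 in Ij; exists 1%N, s1; split => //.
    by apply: ev_while0 => //; [exact: IL|exact: ev_nil].
  have [|hb [t1 [s2 [e1 l1 I1]]]] := IS _ _ _ fr Ij; first by lia.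
  have {}I1 : I (L - j)%N s2 by rewrite -subnSK.
  have fr2 : frame c s s2.
    by move=> x wx; exact: same_trans (fr x wx) (ev_frame e1 wx).
  have [t2 [s3 [e2 l2 I2]]] := IH _ (ltnW lej) fr2 I1.
  exists (t1 + t2).+1, s3; split => //; first exact: ev_while1 e2.
  by rewrite mulSn; lia.
apply: main => //; last by rewrite subnn.
by move=> x _; exact: same_refl.
Qed.

(** The increment closes each round, hence [I j.+1] is required of the store with the counter
    already set to [j.+1]. A round costs [tau] and two units for test and increment; the
    initialization and the last test give the final two. *)
Lemma runs_for c b body nn tau (I : nat -> store R -> Prop) s :
  ~~ writes body (LInt c) -> ~~ writes body (LInt b) -> ~~ writes body (LInt 1) ->
  c != b -> c != 1%N -> ireg s 1 = 1%N -> ireg s b = nn ->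
  I 0%N (set_ireg s c 0) ->
  (forall j s', (j < nn)%N -> frame (For c b body) s s' -> ireg s' c = j -> I j s' ->
    runs body s' tau (fun s'' => frame body s' s'' -> I j.+1 (set_ireg s'' c j.+1))) ->
  runs (For c b body) s (nn * tau.+2).+2 (I nn).
Proof.
move=> wc wb w1 cb c1 s1 sb I0 IS.
apply: runs_do => /=; set s0 := set_ireg s c 0.
have updn s2 a x : a != c -> ireg (set_ireg s2 c x) a = ireg s2 a.
  by rewrite /= /upd => /negbTE ->.
have fr0 s' : frame (body ++ [:: Do (IAdd c c 1)]) s0 s' -> frame (For c b body) s s'.
  move=> fr x; rewrite {1}/writes /= negb_or => /andP[wx]; rewrite orbF => wx'.
  apply: same_trans (fr x _); last exact: wx'.
  by apply: (@exec_frame (IConst c 0)) => /=; move: wx.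
apply: (runs_weaken (t1 := (nn * tau.+2).+1)
  (Q1 := fun s' => I nn s' /\ ireg s' c = nn)) => //; first by move=> s' [].
apply: (runs_while (tau := tau.+1) (I := fun j s' => I j s' /\ ireg s' c = j)) => //.
- by split => //=; rewrite /upd eqxx.
- move=> j s' ltj fr [Ij cj]; have fr' := fr0 _ fr.
  have wfor a : a != c -> ~~ writes body (LInt a) -> ireg s' a = ireg s a.
    move=> ac wa; apply: (frame_ireg fr'); rewrite /writes /= has_cat /= !orbF.
    by rewrite !negb_or [c == a]eq_sym ac andbT.
  have b' : ireg s' b = nn by rewrite wfor // eq_sym.
  split; first by rewrite /= cj b'.
  rewrite -[tau.+1]addn1; apply: runs_cat.
  have [t [s2 [e l q]]] := IS _ _ ltj fr' cj Ij.
  have fr2 := ev_frame e.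
  exists t, s2; split => //; apply: runs_do; apply: runs_nil => /=.
  rewrite (frame_ireg fr2 wc) cj (frame_ireg fr2 w1).
  rewrite wfor 1?eq_sym // s1 addn1; split; first exact: q.
  by rewrite /= /upd eqxx.
- move=> s' fr [Ij cj]; have fr' := fr0 _ fr; rewrite /= cj.
  rewrite (_ : ireg s' b = nn) ?ltnn // -sb.
  apply: (frame_ireg fr'); rewrite /writes /= has_cat /= !orbF.
  by rewrite !negb_or cb andbT.
Qed.

End Semantics.
Ltac step := apply: runs_do.
Ltac comp := rewrite /= /upd /=.

(** * Loops that fill a block of d cells *)

Section VectorLoop.
Variable R : realType.
Implicit Types s : store R.

Lemma runs_vec body a d F tau s :
  ~~ writes body (LInt 10) -> ~~ writes body (LInt 5) -> ~~ writes body (LInt 1) ->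
  ireg s 1 = 1%N -> ireg s 5 = d ->
  (forall k s', (k < d)%N -> frame (For 10 5 body) s s' -> ireg s' 10 = k ->
     (forall x, rmem s' x = if (a <= x < a + k)%N then F (x - a)%N else rmem s x) ->
     runs body s' tau
       (fun s'' => forall x, rmem s'' x = if x == (a + k)%N then F k else rmem s' x)) ->
  runs (For 10 5 body) s (d * tau.+2).+2
    (fun s' => forall x,
       rmem s' x = if (a <= x < a + d)%N then F (x - a)%N else rmem s x).
Proof.
move=> w10 w5 w1 s1 s5 H.
apply: (runs_for (I := fun k s' => forall x,
  rmem s' x = if (a <= x < a + k)%N then F (x - a)%N else rmem s x)) => //=.
- by move=> x; case: ifP => //; lia.
- move=> k s' ltk fr s10 Ik; apply: (runs_weaken _ _ (H _ _ ltk fr s10 Ik)) => //.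
  move=> s'' e _ x; rewrite e Ik; case: eqP => [->|ne].
    by rewrite leq_addr ltn_add2l ltnSn /= addKn.
  by do 2 case: ifP => //; lia.
Qed.

End VectorLoop.

(** * Normalizing coordinates *)

(* Memory layout, with b = n (d + 1) and rows of stride d + 1: real memory holds
   the input in [0, b), the residuals of the elimination in [b, 2b), the
   coordinates mu in [2b, 3b), one vector (the pivot row, later the current grid
   node) in [3b, 3b + d), then the output points; integer memory holds the output
   table below 2N, then the outcomes of the coins.  Integer registers 0 to 7 hold
   n, 1, N, the number of grid nodes per axis, d + 1, d, b and 3b; real registers
   3 and 4 hold the grid step and 4. *)
Definition mul_code : seq stmt := Do (IConst 6 0) :: For 9 0 [:: Do (IAdd 6 6 4)].

Definition shift_code : seq stmt :=
  Do (IConst 11 0) :: For 9 0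
    (For 10 5 [:: Do (IAdd 12 11 10); Do (RLoad 5 12); Do (RLoad 6 10);
                  Do (RSub 5 5 6); Do (IAdd 12 12 6); Do (RStore 12 5)]
     ++ [:: Do (IAdd 11 11 4)]).

(** Squares are compared because there is no absolute value. Multiplying by real register 1, which
    holds 1, copies a real. The record starts at 0 with row 0, which remains the pivot if the whole
    column is zero. *)
Definition find_code : seq stmt :=
  [:: Do (IConst 11 0); Do (IConst 24 0); Do (IConst 14 0); Do (ROfNat 7 14)]
  ++ For 9 0
    [:: Do (IAdd 12 11 6); Do (IAdd 12 12 8); Do (RLoad 5 12); Do (RMul 5 5 5);
        If (RLt 7 5) [:: Do (RMul 7 5 1); Do (IConst 24 0); Do (IAdd 24 24 11)] [::];
        Do (IAdd 11 11 4)].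

(** The pivot row is reduced along with all the others, so the elimination must read it from a
    copy. *)
Definition save_code : seq stmt :=
  Do (IAdd 24 24 6) ::
  For 10 5 [:: Do (IAdd 12 24 10); Do (RLoad 5 12); Do (IAdd 12 7 10);
               Do (RStore 12 5)]
  ++ [:: Do (IAdd 12 7 8); Do (RLoad 8 12); Do (IConst 11 0)].

(* A zero pivot column needs no special case, since 0 / 0 = 0. *)
Definition sub_code : seq stmt :=
  [:: Do (IAdd 12 11 6); Do (IAdd 13 12 8); Do (RLoad 5 13); Do (RDiv 9 5 8);
      Do (IAdd 13 13 6); Do (RStore 13 9)]
  ++ For 10 5 [:: Do (IAdd 13 12 10); Do (RLoad 5 13); Do (IAdd 14 7 10);
                  Do (RLoad 6 14); Do (RMul 6 6 9); Do (RSub 5 5 6);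
                  Do (RStore 13 5)]
  ++ [:: Do (IAdd 11 11 4)].

Definition pivot_code : seq stmt := find_code ++ save_code ++ For 9 0 sub_code.

Section Phases.
Variables (R : realType) (d n : nat).
Implicit Types s : store R.

Let b : nat := (n * d.+1)%N.

Record std s : Prop := Std {
  std0 : ireg s 0 = n;
  std1 : ireg s 1 = 1%N;
  std4 : ireg s 4 = d.+1;
  std5 : ireg s 5 = d;
  std6 : ireg s 6 = b;
  std7 : ireg s 7 = (3 * b)%N;
  stdr1 : rreg s 1 = 1
}.

Lemma frame_std k s s' :
  ~~ has (writes k) [:: LInt 0; LInt 1; LInt 4; LInt 5; LInt 6; LInt 7; LReal 1] ->
  frame k s s' -> std s -> std s'.
Proof.
rewrite /= !negb_or => /and5P[w0 w1 w4 w5 /and4P[w6 w7 wr1 _]] fr [? ? ? ? ? ? ?].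
by split; rewrite ?(frame_ireg fr) ?(frame_rreg fr).
Qed.

(** There is no integer multiplication; n additions stay within the linear running time. *)
Lemma runs_mul s : ireg s 0 = n -> ireg s 1 = 1%N -> ireg s 4 = d.+1 ->
  runs mul_code s (n * 3 + 3) (fun s' => ireg s' 6 = b).
Proof.
move=> s0 s1 s4; rewrite addnS; step.
apply: (runs_weaken _ _ (runs_for (tau := 1) (nn := n)
  (I := fun i s' => ireg s' 6 = (i * d.+1)%N) _ _ _ _ _ _ _ _ _)) => //.
- by rewrite addn2.
- move=> i s' lti fr s9 I6; step; apply: runs_nil; comp => _.
  rewrite I6 (frame_ireg fr) //= /upd /= s4 mulSn; lia.
Qed.


Definition row (a i k : nat) : nat := (a + i * d.+1 + k)%N.

Lemma row_step i j : (i < j)%N -> (i * d.+1 + d.+1 <= j * d.+1)%N.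
Proof. by move=> ij; rewrite addnC -mulSn leq_mul2r ij orbT. Qed.

Lemma row_end i : (i < n)%N -> (i * d.+1 + d.+1 <= b)%N.
Proof. exact: row_step. Qed.

Lemma row_lt a i j k l : (i < j)%N -> (k < d)%N -> (row a i k < row a j l)%N.
Proof.
move=> ij kd; have : (i.+1 * d.+1 <= j * d.+1)%N by rewrite leq_mul2r ij orbT.
by rewrite /row mulSn; lia.
Qed.

Lemma row_ltn a i k : (i < n)%N -> (k < d)%N -> (row a i k < a + b)%N.
Proof. by move=> lin ld; have := row_lt a 0 lin ld; rewrite /row; lia. Qed.


Lemma runs_shift s : std s ->
  runs shift_code s (n * (d * 8 + 5)).+3
   (fun s' => (forall x, (x < b)%N -> rmem s' x = rmem s x) /\
     forall i k, (i < n)%N -> (k < d)%N ->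
       rmem s' (row b i k) = rmem s (row 0 i k) - rmem s k).
Proof.
move=> [s0 s1 s4 s5 s6 s7 sr1]; step.
pose I i s' := [/\ ireg s' 11 = (i * d.+1)%N,
   (forall x, (x < b)%N -> rmem s' x = rmem s x) &
     forall i' k, (i' < i)%N -> (k < d)%N ->
       rmem s' (row b i' k) = rmem s (row 0 i' k) - rmem s k].
apply: (runs_weaken _ _ (runs_for (tau := d * 8 + 3) (nn := n) (I := I)
   _ _ _ _ _ _ _ _ _)) => //.
- by lia.
- by move=> s' [].
move=> i s' lti fr s9 [s11 lo hi].
have [f0 f1 f4 f5 f6 f7 fr1] : std s' by apply: frame_std fr _.
apply: (runs_cat_le (t1 := (d * 8).+2) (t2 := 1)); first by lia.
apply: runs_frame.
apply: (runs_weaken _ _ (runs_vec (a := row b i 0) (d := d) (tau := 6)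
  (F := fun k => rmem s (row 0 i k) - rmem s k) _ _ _ _ _ _)) => //.
- move=> s2 m2 fr2; step; apply: runs_nil; comp => _; split => //=.
  + comp; rewrite !(frame_ireg fr2) // s11 f4 mulSn; lia.
  + by move=> x xlt; rewrite m2 ifF ?lo // /row; lia.
  + move=> i' k; rewrite ltnS leq_eqVlt => /orP[/eqP->|lt] ltk; rewrite m2.
      by rewrite ifT; [congr (rmem s _ - rmem s _)|]; rewrite /row; lia.
    by rewrite ifF ?hi //; have := row_lt b 0 lt ltk; lia.
- move=> k s2 ltk fr2 s10 m2.
  have lt1 := row_ltn 0 lti ltk.
  do 6 step; apply: runs_nil => x; comp.
  rewrite s10 (frame_ireg fr2) // s11 (frame_ireg fr2) // f6.
  rewrite (_ : _ + _ + _ = row b i 0 + k)%N; last by rewrite /row; lia.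
  case: ifP => // _; rewrite !m2 !ifF ?lo //; rewrite /row in lt1 *; try lia.
Qed.

(** The bound [maxn n 1] admits row 0 as pivot of an empty input. *)
Lemma runs_find s j : std s -> ireg s 8 = j ->
  runs find_code s (n * 12).+4.+2
   (fun s' => exists piv, [/\ (piv < maxn n 1)%N, ireg s' 24 = (piv * d.+1)%N &
      forall i, (i < n)%N ->
        rmem s (row b i j) * rmem s (row b i j)
          <= rmem s (row b piv j) * rmem s (row b piv j)]).
Proof.
move=> ss s8; do 4 step.
set s1 := exec _ _.
have st1 : std s1 by case: ss => *; split; comp.
have m1 : rmem s1 = rmem s by [].
pose sq i := rmem s (row b i j) * rmem s (row b i j).
(* Only an upper bound on register 7: it starts at 0, while row 0 may have a larger square. *)
pose I i s' := ireg s' 11 = (i * d.+1)%N /\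
  exists piv, [/\ (piv < maxn i 1)%N, ireg s' 24 = (piv * d.+1)%N,
     rreg s' 7 <= sq piv & forall i', (i' < i)%N -> sq i' <= rreg s' 7].
apply: (runs_weaken _ _ (runs_for (tau := 10) (nn := n) (I := I)
   _ _ _ _ _ _ _ _ _)) => //; try by case: st1.
- by move=> s' [_ [piv [? ? h1 h2]]]; exists piv; split => // i /h2 /le_trans; apply.
- split => //; exists 0%N; split => //; rewrite /= /upd /= /upd /=.
  by rewrite /sq -expr2 sqr_ge0.
move=> i s2 lti fr s9 [s11 [piv [pn s24 h1 h2]]].
have [f0 f1 f4 f5 f6 f7 fr1] : std s2 by apply: frame_std fr _.
have m2 : rmem s2 = rmem s by rewrite (frame_rmem fr).
have f8 : ireg s2 8 = j by rewrite (frame_ireg fr).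
do 4 step; comp.
rewrite s11 f6 f8 m2 [(i * _ + _)%N]addnC -/(row b i j).
apply: (runs_if (t1 := 3) (t2 := 2)) => //=.
rewrite /upd /= -/(sq i).
case: ltP => hlt.
  do 3 step; apply: runs_nil; step; apply: runs_nil; comp => _; split => //=.
    by comp; rewrite s11 f4 mulSn addnC.
  exists i; split; comp => //; rewrite ?fr1 ?mulr1 ?leq_maxl //.
  move=> i'; rewrite ltnS leq_eqVlt => /orP[/eqP->//|/h2 h3].
  exact: le_trans h3 (ltW hlt).
apply: runs_nil; step; apply: runs_nil; comp => _; split => //=.
  by comp; rewrite s11 f4 mulSn addnC.
exists piv; split; comp => //; first by lia.
by move=> i'; rewrite ltnS leq_eqVlt => /orP[/eqP->|/h2].
Qed.

Lemma runs_save s j piv : std s -> ireg s 8 = j -> (j < d)%N ->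
  (piv < maxn n 1)%N -> ireg s 24 = (piv * d.+1)%N ->
  runs save_code s (d * 6).+4.+2
   (fun s' => [/\ ireg s' 11 = 0%N, rreg s' 8 = rmem s (row b piv j) &
     forall x, rmem s' x = if (3 * b <= x < 3 * b + d)%N
                           then rmem s (row b piv (x - 3 * b)) else rmem s x]).
Proof.
move=> st s8 jd pn s24; rewrite /save_code.
(* For n = 0 all blocks start at address 0, and the copy writes each cell onto itself. *)
have rowP k : (k < d)%N ->
    (row b piv k < 3 * b)%N \/ (b = 0%N /\ row b piv k = k).
  move=> kd; case: (posnP n) => [n0|np].
    by right; rewrite /row /b; move: pn; rewrite n0 => /eqP; lia.
  left; have := @row_ltn b piv k; rewrite kd; lia.
step; set s1 := exec _ _.
have st1 : std s1 by case: st => *; split; comp.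
apply: (runs_cat_le (t1 := (d * 6).+2) (t2 := 3)); first by lia.
apply: runs_frame.
apply: (runs_weaken _ _ (runs_vec (a := 3 * b) (d := d) (tau := 4)
  (F := fun k => rmem s (row b piv k)) _ _ _ _ _ _)) => //; try by case: st1.
- move=> s2 m2 fr2; have st2 : std s2 by apply: frame_std fr2 _.
  do 3 step; apply: runs_nil; comp; split => //.
  rewrite (std7 st2) [ireg s2 8](frame_ireg fr2) //= /upd /= s8 m2 ifT; last by lia.
  by rewrite addKn.
- move=> k s2 kd fr2 s10 m2; have st2 : std s2 by apply: frame_std fr2 _.
  do 4 step; apply: runs_nil => x; comp.
  rewrite s10 (std7 st2) [ireg s2 24](frame_ireg fr2) //= /upd /= s24 (std6 st).
  case: ifP => // _.
  rewrite (_ : _ + _ + _ = row b piv k)%N; last by rewrite /row; lia.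
  rewrite m2 ifF //; have [] := rowP _ kd; lia.
Qed.

Lemma runs_sub s j : std s -> ireg s 8 = j -> (j < d)%N -> ireg s 11 = 0%N ->
  runs (For 9 0 sub_code) s (n * (d * 9 + 11)).+2
   (fun s' => let mu i := rmem s (row b i j) / rreg s 8 in
     [/\ forall x, (x < b)%N -> rmem s' x = rmem s x,
        forall i, (i < n)%N -> rmem s' (row (2 * b) i j) = mu i,
        forall i k, (i < n)%N -> (k < d)%N -> k != j ->
          rmem s' (row (2 * b) i k) = rmem s (row (2 * b) i k) &
        forall i k, (i < n)%N -> (k < d)%N ->
          rmem s' (row b i k) = rmem s (row b i k) - mu i * rmem s (3 * b + k)]).
Proof.
move=> st s8 jd s11.
pose mu i := rmem s (row b i j) / rreg s 8.
pose I i s' := ireg s' 11 = (i * d.+1)%N /\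
  [/\ forall x, (x < b)%N -> rmem s' x = rmem s x,
     forall k, (k < d)%N -> rmem s' (3 * b + k)%N = rmem s (3 * b + k)%N,
     forall i', (i' < i)%N -> rmem s' (row (2 * b) i' j) = mu i',
     forall i' k, (i' < n)%N -> (k < d)%N -> k != j ->
       rmem s' (row (2 * b) i' k) = rmem s (row (2 * b) i' k) &
     forall i' k, (i' < n)%N -> (k < d)%N -> rmem s' (row b i' k) =
       if (i' < i)%N then rmem s (row b i' k) - mu i' * rmem s (3 * b + k)%N
       else rmem s (row b i' k)].
apply: (runs_weaken _ _ (runs_for (tau := d * 9 + 9) (nn := n) (I := I)
   _ _ _ _ _ _ _ _ _)) => //; try by case: st.
- by lia.
- by move=> s' [_ [? ? ? ? h]]; split => // i k lti ltk; rewrite h // lti.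
move=> i s1 lti fr s9 [s11' [A V M1 M2 RR]].
have bi := row_end lti.
have st1 : std s1 by apply: frame_std fr _.
have f8 : ireg s1 8 = j by rewrite (frame_ireg fr).
have r8 : rreg s1 8 = rreg s 8 by rewrite (frame_rreg fr).
rewrite (_ : d * 9 + 9 = (d * 9 + 3).+4.+2)%N; last by lia.
do 6 step; set s2 := exec _ _.
have st2 : std s2 by case: st1 => *; split; comp.
have r29 : rreg s2 9 = mu i.
  rewrite /s2; comp; rewrite s11' (std6 st1) f8 r8 /mu.
  rewrite (_ : _ + _ + _ = row b i j)%N; last by rewrite /row; lia.
  by rewrite RR // ltnn.
have m2 x : rmem s2 x = if x == row (2 * b) i j then mu i else rmem s1 x.
  rewrite -r29 {1}/s2; comp; rewrite s11' (std6 st1) f8.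
  rewrite (_ : _ + _ + _ + _ = row (2 * b) i j)%N; last by rewrite /row; lia.
  by case: ifP => // _; rewrite /s2; comp; rewrite s11' (std6 st1) f8.
have s2_12 : ireg s2 12 = row b i 0.
  by rewrite /s2; comp; rewrite s11' (std6 st1) /row; lia.
have {}s11' : ireg s2 11 = (i * d.+1)%N by rewrite /s2; comp.
clearbody s2.
apply: (runs_cat_le (t1 := (d * 9).+2) (t2 := 1)); first by lia.
apply: runs_frame.
apply: (runs_weaken _ _ (runs_vec (a := row b i 0) (d := d) (tau := 7)
  (F := fun k => rmem s (row b i k) - mu i * rmem s (3 * b + k)%N) _ _ _ _ _ _))
  => //; try by case: st2.
- move=> s3 m3 fr3; step; apply: runs_nil; comp => _; split => //=; comp.
    by rewrite !(frame_ireg fr3) // s11' (std4 st2) mulSn; lia.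
  split.
  + move=> x xlt; rewrite m3 m2 !ifF ?A //; rewrite /row; lia.
  + move=> k ltk; rewrite m3 m2 !ifF ?V //; rewrite /row; lia.
  + move=> i' lti'; rewrite m3 m2 ifF; last by rewrite /row; lia.
    case: eqP => [e|ne]; last first.
      by apply: M1; rewrite ltn_neqAle -ltnS lti' andbT; apply/eqP => e; rewrite e in ne.
    have [lt|gt|-> //] := ltngtP i' i; last by lia.
    by have := row_lt (2 * b) j lt jd; lia.
  + move=> i' k lti' ltk kj; rewrite m3 m2 !ifF ?M2 //.
      apply/eqP => e; have [lt|lt|ii] := ltngtP i' i.
      * by have := row_lt (2 * b) j lt ltk; lia.
      * by have := row_lt (2 * b) k lt jd; lia.
      * by move/eqP: kj; apply; move: e; rewrite ii /row; lia.
    by rewrite /row; lia.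
  + move=> i' k lti' ltk; have bi' := row_end lti'; rewrite m3 m2.
    have ne : (row b i' k == row (2 * b) i j) = false.
      by rewrite /row; lia.
    rewrite ne; have [lt|lt|->] := ltngtP i' i.
    * rewrite ifF; last by have := row_lt b 0 lt ltk; lia.
      by rewrite RR // lt ltnS (ltnW lt).
    * rewrite ifF; last first.
        by have := row_step lt; rewrite /row; lia.
      by rewrite RR // ltnNge (ltnW lt) /= ltnNge lt.
    * rewrite ltnSn ifT /=; last by rewrite /row; lia.
      by congr (rmem s _ - mu i * rmem s _); rewrite /row; lia.
- move=> k s3 ltk fr3 s10 m3.
  have st3 : std s3 by apply: frame_std fr3 _.
  do 7 step; apply: runs_nil => x; comp.
  rewrite s10 [ireg s3 12](frame_ireg fr3) // s2_12 (std7 st3).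
  case: ifP => // _; rewrite [rreg s3 9](frame_rreg fr3) // r29.
  rewrite !m3 !m2 !ifF.
  + rewrite V // mulrC; congr (_ - _).
    by rewrite (_ : _ + _ = row b i k)%N ?RR ?ltnn // /row; lia.
  all: by rewrite /row; lia.
Qed.

Lemma runs_pivot s j : std s -> ireg s 8 = j -> (j < d)%N ->
  runs pivot_code s (n * (d * 9 + 23) + d * 6 + 14)
   (fun s' => exists piv, [/\ (piv < maxn n 1)%N,
     forall i, (i < n)%N -> rmem s (row b i j) * rmem s (row b i j)
                            <= rmem s (row b piv j) * rmem s (row b piv j),
     forall x, (x < b)%N -> rmem s' x = rmem s x,
     forall i k, (i < n)%N -> (k < d)%N -> rmem s' (row (2 * b) i k) =
       if k == j then rmem s (row b i j) / rmem s (row b piv j)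
       else rmem s (row (2 * b) i k) &
     forall i k, (i < n)%N -> (k < d)%N -> rmem s' (row b i k) =
       rmem s (row b i k)
       - rmem s (row b i j) / rmem s (row b piv j) * rmem s (row b piv k)]).
Proof.
move=> st s8 jd.
apply: (runs_cat_le (t1 := (n * 12).+4.+2) (t2 := (d * 6).+4.+2 + (n * (d * 9 + 11)).+2)).
  by lia.
apply: runs_frame; apply: (runs_weaken _ _ (runs_find st s8)) => //.
move=> s1 [piv [pn s24 pmax]] fr1.
have st1 : std s1 by apply: frame_std fr1 _.
have m1 : rmem s1 = rmem s by rewrite (frame_rmem fr1).
have f8 : ireg s1 8 = j by rewrite (frame_ireg fr1).
apply: runs_cat; apply: runs_frame.
apply: (runs_weaken _ _ (runs_save st1 f8 jd pn s24)) => //.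
move=> s2 [s2_11 s2_8 m2] fr2; rewrite m1 in s2_8 m2.
have st2 : std s2 by apply: frame_std fr2 _.
have f8' : ireg s2 8 = j by rewrite (frame_ireg fr2).
have m2' i a k : (i < n)%N -> (k < d)%N -> (a + b <= 3 * b)%N ->
    rmem s2 (row a i k) = rmem s (row a i k).
  by move=> lti ltk le; rewrite m2 ifF //; have := row_ltn a lti ltk; lia.
apply: (runs_weaken _ _ (runs_sub st2 f8' jd s2_11)) => //.
move=> s3 [A M1 M2 RR]; exists piv; split => //.
- by move=> x xb; rewrite A // m2 ifF //; lia.
- move=> i k lti ltk; case: eqP => [->|/eqP kj].
    by rewrite M1 // m2' ?s2_8 //; lia.
  by rewrite M2 // m2' //; lia.
- move=> i k lti ltk; rewrite RR // !m2' //; try lia.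
  rewrite s2_8 m2 ifT; last by lia.
  by rewrite addKn.
Qed.

End Phases.

(** * Invariant of the Gaussian elimination *)

Section Coordinates.
Variables (R : realType) (d : nat).
Implicit Types u v : point R d.

Lemma dotDr u v w : dot u (v + w) = dot u v + dot u w.
Proof. by rewrite -big_split; apply: eq_bigr => j _; rewrite mxE mulrDr. Qed.

Lemma dotZr u a v : dot u (a *: v) = a * dot u v.
Proof. by rewrite mulr_sumr; apply: eq_bigr => j _; rewrite mxE mulrCA. Qed.

Lemma dotNr u v : dot u (- v) = - dot u v.
Proof. by rewrite -scaleN1r dotZr mulN1r. Qed.

Lemma dotBr u v w : dot u (v - w) = dot u v - dot u w.
Proof. by rewrite dotDr dotNr. Qed.

Lemma dot_sumr u (I : finType) (F : I -> point R d) :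
  dot u (\sum_i F i) = \sum_i dot u (F i).
Proof.
elim/big_rec2: _ => [|i x y _ <-]; last by rewrite dotDr.
by rewrite /dot big1 // => j _; rewrite mxE mulr0.
Qed.

(* The last clause says that the basis is short: in every direction u it is
   bounded by 2^d times the width of the points. *)
Definition coordinates n (p : nat -> point R d) (mu : nat -> nat -> R) : Prop :=
  exists e : 'I_d -> point R d,
  [/\ forall i, (i < n)%N -> p i - p 0%N = \sum_(k < d) mu i k *: e k,
      forall i (k : 'I_d), (i < n)%N -> `|mu i k| <= 1 &
      forall u W, (forall i j, (i < n)%N -> (j < n)%N -> dot u (p i - p j) <= W) ->
        forall k, `|dot u (e k)| <= 2 ^+ d * W].

(* The state after the elimination of j columns; rs holds the residuals. *)
Definition partial_coordinates n (p : nat -> point R d) (mu rs : nat -> nat -> R)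
    (j : nat) : Prop :=
  exists e : nat -> point R d,
  [/\ forall i, (i < n)%N ->
        p i - p 0%N = \sum_(k < j) mu i k *: e k + \row_k rs i k,
      forall i k, (i < n)%N -> (k < j)%N -> `|mu i k| <= 1,
      forall i k, (i < n)%N -> (k < j)%N -> rs i k = 0 &
      forall u W, (forall i j, (i < n)%N -> (j < n)%N -> dot u (p i - p j) <= W) ->
        (forall i, (i < n)%N -> `|dot u (\row_k rs i k)| <= 2 ^+ j * W) /\
        forall k, (k < j)%N -> (0 < n)%N -> `|dot u (e k)| <= 2 ^+ k * W].

Lemma partial_coordinates0 n (p : nat -> point R d) mu (rs : nat -> nat -> R) :
  (forall i (k : 'I_d), (i < n)%N -> rs i k = p i 0 k - p 0%N 0 k) ->
  partial_coordinates n p mu rs 0.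
Proof.
move=> rsE; exists (fun=> 0).
have rowE i : (i < n)%N -> \row_k rs i k = p i - p 0%N.
  by move=> lti; apply/rowP => k; rewrite !mxE rsE.
split => // [i lti|u W HW]; first by rewrite big_ord0 add0r rowE.
split => // i lti; rewrite rowE // expr0 mul1r ler_norml lerNl -dotNr opprB.
by rewrite !HW //; exact: leq_ltn_trans lti.
Qed.

(** The new basis vector is the pivot residual. Choosing the largest entry as pivot bounds every
    multiplier by 1, so subtracting a multiple of the pivot residual at most doubles the bound on
    the residuals in any direction; this is where the power of 2 comes from. Columns already cleared
    stay zero since the pivot row vanishes there. *)
Lemma partial_coordinatesS n p mu rs mu' rs' j piv :
  partial_coordinates n p mu rs j -> (j < d)%N -> (piv < maxn n 1)%N ->
  (forall i, (i < n)%N -> rs i j * rs i j <= rs piv j * rs piv j) ->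
  (forall i k, (i < n)%N -> (k < d)%N ->
     mu' i k = if k == j then rs i j / rs piv j else mu i k) ->
  (forall i k, (i < n)%N -> (k < d)%N ->
     rs' i k = rs i k - rs i j / rs piv j * rs piv k) ->
  partial_coordinates n p mu' rs' j.+1.
Proof.
move=> [e [eE mu1 rs0 eW]] jd pn pmax mu'E rs'E.
exists (fun k => if k == j then \row_l rs piv l else e k).
have muj i k : (i < n)%N -> (k < j)%N -> mu' i k = mu i k.
  by move=> lti ltk; rewrite mu'E ?(ltn_trans ltk jd) // ltn_eqF.
have rsrow i : (i < n)%N ->
    \row_k rs' i k = \row_k rs i k - (rs i j / rs piv j) *: \row_k rs piv k :> 'rV[R]_d.
  by move=> lti; apply/rowP => k; rewrite !mxE rs'E.
have pivn i : (i < n)%N -> (piv < n)%N by lia.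
have ab i : (i < n)%N -> `|rs i j| <= `|rs piv j|.
  move=> lti; rewrite -(@ler_pXn2r _ 2) ?nnegrE ?normr_ge0 //.
  by rewrite !real_normK ?num_real // !expr2 pmax.
have q1 i : (i < n)%N -> `|rs i j / rs piv j| <= 1.
  move=> lti; have [p0|p0] := eqVneq (rs piv j) 0.
    by rewrite p0 invr0 mulr0 normr0.
  by rewrite normf_div ler_pdivrMr ?normr_gt0 // mul1r ab.
split.
- move=> i lti; rewrite eE // big_ord_recr /= eqxx mu'E // eqxx rsrow //.
  rewrite -[RHS]addrA [X in _ = _ + X]addrC subrK; congr (_ + _).
  by apply: eq_bigr => k _; rewrite muj // (ltn_eqF (ltn_ord k)).
- move=> i k lti; rewrite ltnS leq_eqVlt => /orP[/eqP->|ltk].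
    by rewrite mu'E // eqxx q1.
  by rewrite muj // mu1.
- move=> i k lti; rewrite ltnS leq_eqVlt => /orP[/eqP->|ltk].
    (* A zero pivot is the largest entry of its column, which is then already clear. *)
    rewrite rs'E //; have [p0|p0] := eqVneq (rs piv j) 0; last by rewrite divfK ?subrr.
    by have := ab _ lti; rewrite p0 normr0 normr_le0 => /eqP->; rewrite !mul0r subrr.
  by rewrite rs'E ?(ltn_trans ltk jd) // (rs0 i k) // (rs0 piv k) ?(pivn i) // mulr0 subrr.
- move=> u W /eW [rsW ekW]; split.
    move=> i lti; rewrite rsrow // dotBr dotZr.
    have -> : 2 ^+ j.+1 * W = 2 ^+ j * W + 2 ^+ j * W by rewrite exprS; ring.
    apply: le_trans (ler_normB _ _) _; rewrite lerD ?rsW // normrM.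
    rewrite -[leRHS]mul1r ler_pM ?normr_ge0 ?q1 ?rsW //; exact: pivn lti.
  move=> k; rewrite ltnS leq_eqVlt => /orP[/eqP->|ltk] n0.
    by rewrite eqxx rsW //; exact: pivn n0.
  by rewrite (ltn_eqF ltk) ekW.
Qed.

Lemma partial_coordinates_full n p mu rs : (0 < n)%N ->
  partial_coordinates n p mu rs d -> coordinates n p mu.
Proof.
move=> n0 [e [eE mu1 rs0 eW]]; exists e; split.
- move=> i lti; rewrite eE // [X in _ + X](_ : _ = 0) ?addr0 //.
  by apply/rowP => k; rewrite !mxE rs0.
- by move=> i k lti; exact: mu1.
- move=> u W HW k; have [_ /(_ k (ltn_ord k) n0)/le_trans] := eW u W HW; apply.
  rewrite ler_wpM2r //; last by rewrite ler_eXn2l ?ltr1n // ltnW.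
  by have := HW _ _ n0 n0; rewrite subrr /dot big1 // => i _; rewrite mxE mulr0.
Qed.

End Coordinates.

(** * Normalization as a program *)

Definition norm_code : seq stmt :=
  mul_code ++ ([:: Do (IAdd 7 6 6); Do (IAdd 7 7 6)] ++ (shift_code ++ For 8 5 pivot_code)).

Definition norm_time (d n : nat) : nat :=
  (n * 3 + 3 + (2 + ((n * (d * 8 + 5)).+3
   + (d * (n * (d * 9 + 23) + d * 6 + 14).+2).+2)))%N.

Section Normalization.
Variables (R : realType) (d n : nat).
Implicit Types s : store R.
Let b : nat := (n * d.+1)%N.

Definition input_point s (i : nat) : point R d := \row_k rmem s (row d 0 i k).

Definition coordinate s (i k : nat) : R := rmem s (row d (2 * b) i k).

Lemma runs_norm s : ireg s 0 = n -> ireg s 1 = 1%N -> ireg s 4 = d.+1 ->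
  ireg s 5 = d -> rreg s 1 = 1 ->
  runs norm_code s (norm_time d n)
    (fun s' => [/\ std d n s', forall x, (x < b)%N -> rmem s' x = rmem s x &
       (0 < n)%N -> coordinates n (input_point s) (coordinate s')]).
Proof.
move=> s0 s1 s4 s5 r1; apply: runs_cat; apply: runs_frame.
apply: (runs_weaken _ _ (runs_mul s0 s1 s4)) => // s2 s26 fr2.
apply: (runs_cat_le (leqnn _)); do 2 step; apply: runs_nil.
set s3 := exec _ _.
have st3 : std d n s3.
  split; rewrite /s3; comp; rewrite ?s26 ?(frame_ireg fr2) ?(frame_rreg fr2) //.
  by rewrite /b; lia.
have m3 : rmem s3 = rmem s by rewrite /s3; comp; rewrite (frame_rmem fr2).
clearbody s3; apply: runs_cat; apply: runs_frame.
apply: (runs_weaken _ _ (runs_shift st3)) => // s4' [lo4 hi4] fr4.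
have {}st4 : std d n s4' by apply: frame_std fr4 st3.
rewrite m3 in lo4 hi4; apply: runs_frame.
apply: (runs_weaken _ _ (runs_for (tau := n * (d * 9 + 23) + d * 6 + 14) (nn := d)
  (I := fun j s' => (forall x, (x < b)%N -> rmem s' x = rmem s x) /\
    partial_coordinates n (input_point s) (coordinate s')
      (fun i k => rmem s' (row d b i k)) j)
   _ _ _ _ _ _ _ _ _)) => //; try by case: st4.
- move=> s5' [lo5 /(partial_coordinates_full _) c5] fr5; split => //.
  by apply: frame_std fr5 st4.
- split; first exact: lo4.
  apply: partial_coordinates0 => i k lti /=; rewrite !mxE hi4 //.
move=> j s5' ltj fr5 s8 [lo pc].
have st5 : std d n s5' by apply: frame_std fr5 st4.
apply: (runs_weaken _ _ (runs_pivot st5 s8 ltj)) => // s6.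
move=> [piv [pn pmax lo6 M RR]] _; split => //.
  by move=> x xb; rewrite lo6 ?lo.
exact: (partial_coordinatesS (mu' := coordinate s6)
  (rs' := fun i k => rmem s6 (row d b i k)) pc ltj pn pmax M RR).
Qed.

End Normalization.
(** * Nearest points on the grid *)

Definition dist_code : seq stmt :=
  [:: Do (IConst 14 0); Do (ROfNat 6 14); Do (IAdd 12 11 6); Do (IAdd 12 12 6)]
  ++ For 10 5 [:: Do (IAdd 13 12 10); Do (RLoad 5 13); Do (IAdd 13 7 10);
                  Do (RLoad 8 13); Do (RSub 5 5 8); Do (RMul 5 5 5);
                  Do (RAdd 6 6 5)].

(* 25 d + 1 exceeds every squared distance between [-1, 1]^d and [-4, 4]^d. *)
Definition search_code (d : nat) : seq stmt :=
  [:: Do (IConst 11 0); Do (IConst 18 0); Do (IConst 15 0); Do (IAdd 15 15 16);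
      Do (IConst 14 (d * 25).+1); Do (ROfNat 7 14)]
  ++ For 9 0
    [:: Do (ILoad 14 15);
        If (ILt 14 1) [::]
          (dist_code ++
           [:: If (RLt 6 7) [:: Do (RMul 7 6 1); Do (IConst 18 1);
                                Do (IConst 17 0); Do (IAdd 17 17 11)] [::]]);
        Do (IAdd 15 15 1); Do (IAdd 11 11 4)].

(** The search compares coordinates mu, but the point copied is the original one from the input
    block. The same point may be emitted for several nodes; [read_set] merges the copies. *)
Definition emit_code : seq stmt :=
  [:: If (ILt 18 1) [::]
       (For 10 5 [:: Do (IAdd 12 17 10); Do (RLoad 5 12); Do (IAdd 12 19 10);
                     Do (RStore 12 5)]
        ++ [:: Do (IAdd 19 19 5); Do (IAdd 20 20 1)])].

Definition coord_code (j sc off : nat) : seq stmt :=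
  [:: Do (ROfNat 5 (30 + j)); Do (RMul 5 5 sc); Do (RSub 5 5 off);
      Do (IConst 12 j); Do (IAdd 12 12 7); Do (RStore 12 5)].

(* Registers 26 and 3 hold 2 and the number of grid nodes: the coordinate j0
   runs over {-2, 2} and the others over the grid. *)
Fixpoint nest_code (j0 : nat) (js : seq nat) (body : seq stmt) : seq stmt :=
  if js is j :: js' then
    if j == j0 then For (30 + j) 26 (coord_code j 4 10 ++ nest_code j0 js' body)
    else For (30 + j) 3 (coord_code j 3 4 ++ nest_code j0 js' body)
  else body.

Section Nearest.
Variables (R : realType) (d n : nat).
Implicit Types s : store R.
Let b : nat := (n * d.+1)%N.

Definition sqdist (mu : nat -> nat -> R) (g : seq R) (i : nat) : R :=
  \sum_(k < d) (mu i k - g`_k) ^+ 2.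

Lemma runs_dist s i (g : seq R) : std d n s -> ireg s 11 = (i * d.+1)%N ->
  (forall k, (k < d)%N -> rmem s (3 * b + k)%N = g`_k) ->
  runs dist_code s (d * 9).+4.+2
    (fun s' => rreg s' 6 = sqdist (coordinate d n s) g i).
Proof.
move=> st s11 gE; do 4 step; set s1 := exec _ _.
have st1 : std d n s1 by case: st => *; split; comp.
have m1 : rmem s1 = rmem s by [].
have s1_12 : ireg s1 12 = row d (2 * b) i 0.
  by rewrite /s1; comp; rewrite s11 (std6 st) /row; lia.
have r6 : rreg s1 6 = 0 by [].
clearbody s1.
apply: (runs_weaken _ _ (runs_for (tau := 7) (nn := d) (I := fun k s' =>
   rreg s' 6 = \sum_(l < k) (coordinate d n s i l - g`_l) ^+ 2) _ _ _ _ _ _ _ _ _)) => //;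
  try by case: st1.
- by rewrite big_ord0.
- move=> k s2 ltk fr2 s10 I2; have st2 : std d n s2 by apply: frame_std fr2 _.
  do 7 step; apply: runs_nil; comp => _.
  rewrite big_ord_recr /= I2 s10 [ireg s2 12](frame_ireg fr2) // s1_12 (std7 st2).
  rewrite (frame_rmem fr2) // m1 gE // expr2 /coordinate.
  rewrite (_ : _ + _ = row d (2 * b) i k)%N //; by rewrite /row; lia.
Qed.

Definition nearest (A : pred nat) (mu : nat -> nat -> R) (g : seq R) (i : nat) : Prop :=
  [/\ (i < n)%N, A i &
      forall i', (i' < n)%N -> A i' -> sqdist mu g i <= sqdist mu g i'].

Lemma runs_search s (A : pred nat) (g : seq R) : std d n s ->
  (forall i, (i < n)%N -> imem s (ireg s 16 + i)%N = A i) ->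
  (forall k, (k < d)%N -> rmem s (3 * b + k)%N = g`_k) ->
  (forall i, (i < n)%N -> sqdist (coordinate d n s) g i <= (d * 25)%:R) ->
  runs (search_code d) s (n * (d * 9 + 18)).+4.+4
    (fun s' => if ireg s' 18 == 0%N then forall i, (i < n)%N -> ~~ A i
       else ireg s' 18 = 1%N /\ exists i, ireg s' 17 = (i * d.+1)%N /\
            nearest A (coordinate d n s) g i).
Proof.
move=> st flag gE bnd; do 6 step; set s1 := exec _ _.
have st1 : std d n s1 by case: st => *; split; comp.
set ds := sqdist (coordinate d n s) g in bnd *.
(* As long as register 18 is 0, register 7 keeps the sentinel 25 d + 1, so by [bnd] the first
   present point is always accepted. *)
pose I i s' := [/\ ireg s' 11 = (i * d.+1)%N, ireg s' 15 = (ireg s 16 + i)%N &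
  if ireg s' 18 == 0%N then rreg s' 7 = (d * 25).+1%:R /\ forall i', (i' < i)%N -> ~~ A i'
  else ireg s' 18 = 1%N /\ exists i0,
    [/\ ireg s' 17 = (i0 * d.+1)%N, (i0 < i)%N, A i0, rreg s' 7 = ds i0 &
        forall i', (i' < i)%N -> A i' -> ds i0 <= ds i']].
apply: (runs_weaken _ _ (runs_for (tau := d * 9 + 16) (nn := n) (I := I)
   _ _ _ _ _ _ _ _ _)) => //; try by case: st1.
- by lia.
- move=> s' [_ _]; case: ifP => _; first by case.
  by move=> [? [i [? ? ? ? ?]]]; split => //; exists i; split => //; split.
- by split => //=; comp; lia.
move=> i s2 lti fr2 s9 [s11 s15 I2].
have st2 : std d n s2 by apply: frame_std fr2 _.
have m2 : rmem s2 = rmem s by rewrite (frame_rmem fr2).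
have im2 : imem s2 = imem s by rewrite (frame_imem fr2).
rewrite (_ : d * 9 + 16 = ((d * 9 + 12) + 2).+2)%N; last by lia.
step; set s3 := exec _ _.
have s3_14 : ireg s3 14 = A i by rewrite /s3; comp; rewrite im2 s15 flag.
have st3 : std d n s3 by case: st2 => *; split; comp.
have ec a : a != 14%N -> ireg s3 a = ireg s2 a by rewrite /s3; comp => /negbTE->.
have er : rreg s3 = rreg s2 by [].
have m3 : rmem s3 = rmem s by rewrite -m2.
clearbody s3; apply: runs_if => //; rewrite [holds _ _]/=.
rewrite s3_14 (std1 st3) ltnS leqn0 eqb0; case: ifPn => [nA|]; last rewrite negbK => Ai.
  apply: runs_nil; do 2 step; apply: runs_nil; comp => _; split; comp.
  - by rewrite ec // s11 (std4 st3) mulSn addnC.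
  - by rewrite ec // s15 (std1 st3); lia.
  - rewrite ec // er; move: I2; case: ifP => _ [h1 h2].
      split => // i'; rewrite ltnS leq_eqVlt => /orP[/eqP->//|]; exact: h2.
    split => //; case: h2 => i0 [h3 h4 h5 h6 h7]; exists i0; split => //.
    + by rewrite ec.
    + exact: ltnW.
    + by move=> i'; rewrite ltnS leq_eqVlt => /orP[/eqP->|/h7//]; rewrite (negbTE nA).
apply: (runs_cat_le (t1 := (d * 9).+4.+2) (t2 := 5)); first by lia.
apply: runs_frame; apply: (runs_weaken _ _ (runs_dist (i := i) (g := g) st3 _ _)) => //;
  [|by rewrite ec|by move=> k ltk; rewrite m3 gE].
move=> s4; have -> : sqdist (coordinate d n s3) g i = ds i.
  by rewrite /ds /sqdist; apply: eq_bigr => k _; rewrite /coordinate m3.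
move=> s4_6 fr4; have st4 : std d n s4 by apply: frame_std fr4 _.
have e11 : ireg s4 11 = (i * d.+1)%N by rewrite (frame_ireg fr4) // ec.
have e15 : ireg s4 15 = (ireg s 16 + i)%N by rewrite (frame_ireg fr4) // ec.
have e17 : ireg s4 17 = ireg s2 17 by rewrite (frame_ireg fr4) // ec.
have e18 : ireg s4 18 = ireg s2 18 by rewrite (frame_ireg fr4) // ec.
have e7 : rreg s4 7 = rreg s2 7 by rewrite (frame_rreg fr4) // er.
apply: (runs_if (t1 := 4) (t2 := 0)) => //=; rewrite s4_6 e7.
case: ltP => hlt.
  do 4 step; do 2 apply: runs_nil; do 2 step; apply: runs_nil; comp => _; split; comp.
  - by rewrite e11 (std4 st4) mulSn addnC.
  - by rewrite e15 (std1 st4); lia.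
  - split => //; exists i; split; comp => //; rewrite ?s4_6 ?(stdr1 st4) ?mulr1 //.
    move=> i'; rewrite ltnS leq_eqVlt => /orP[/eqP->//|lti'] Ai'.
    move: I2; case: ifP => _ [_]; first by move=> /(_ _ lti'); rewrite Ai'.
    by move=> [i0 [_ _ _ r7 /(_ _ lti' Ai')]]; apply: le_trans; rewrite -r7 ltW.
do 2 apply: runs_nil; do 2 step; apply: runs_nil; comp => _; split; comp.
- by rewrite e11 (std4 st4) mulSn addnC.
- by rewrite e15 (std1 st4); lia.
- rewrite e18 e7; move: I2; case: ifP => _ [h1 h2].
    by have := bnd i lti; move: hlt; rewrite h1 -natr1; lra.
  split => //; case: h2 => i0 [h3 h4 h5 h6 h7]; exists i0; split => //.
  + by rewrite e17.
  + exact: ltnW.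
  + by move=> i'; rewrite ltnS leq_eqVlt => /orP[/eqP-> _|/h7//]; rewrite -h6.
Qed.

Lemma runs_emit s i o : std d n s -> ireg s 18 = 1%N -> ireg s 17 = (i * d.+1)%N ->
  (i < n)%N -> ireg s 19 = o -> (3 * b + d <= o)%N ->
  runs emit_code s (d * 6 + 5)
    (fun s' => [/\ ireg s' 19 = (o + d)%N, ireg s' 20 = (ireg s 20).+1 &
       forall x, rmem s' x = if (o <= x < o + d)%N then rmem s (row d 0 i (x - o))
                             else rmem s x]).
Proof.
move=> st s18 s17 lti s19 ole.
apply: (runs_weaken (t1 := (((d * 6).+2 + 2) + 0).+1) (Q2 := _)
  _ (fun s' h => h)); first by lia.
apply: runs_if => //; rewrite [holds _ _]/= s18 (std1 st) ltnn.
apply: runs_cat; apply: runs_frame.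
apply: (runs_weaken _ _ (runs_vec (a := o) (d := d) (tau := 4)
  (F := fun k => rmem s (row d 0 i k)) _ _ _ _ _ _)) => //; try by case: st.
- move=> s2 m2 fr2; have st2 : std d n s2 by apply: frame_std fr2 _.
  do 2 step; do 2 apply: runs_nil; split => //; comp.
  + by rewrite (frame_ireg fr2) // s19 (std5 st2).
  + by rewrite (frame_ireg fr2) // (std1 st2) addn1.
- move=> k s2 ltk fr2 s10 m2.
  do 4 step; apply: runs_nil => x; comp.
  rewrite s10 !(frame_ireg fr2) // s17 s19; case: ifP => // _.
  rewrite (_ : _ + _ = row d 0 i k)%N // m2 ifF //.
  by have := @row_ltn d n 0 i k lti ltk; rewrite -/b; lia.
Qed.

Section Emitted.
Variables (m0 : nat -> R) (A : pred nat) (f0 o0 m1 : nat) (h : R) (im : nat -> nat).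
Hypothesis o0P : (3 * b + d <= o0)%N.
Hypothesis imP : forall i, (i < n)%N -> im (f0 + i)%N = A i.

Let pt i : point R d := \row_k m0 (row d 0 i k).
Let mu i k : R := m0 (row d (2 * b) i k).

(** Invariant within one sample: [L] lists the nodes searched so far. A node yields at most one
    point, which bounds the count by [size L]; [em_lo] omits the d cells at [3 * b], which hold the
    current node. *)
Record emitted (L : seq (seq R)) s : Prop := Emitted {
  em_std : std d n s;
  em_3 : ireg s 3 = m1;
  em_26 : ireg s 26 = 2%N;
  em_16 : ireg s 16 = f0;
  em_r3 : rreg s 3 = h;
  em_r4 : rreg s 4 = 4%:R;
  em_r10 : rreg s 10 = 2%:R;
  em_imem : imem s = im;
  em_lo : forall x, (x < 3 * b)%N || (3 * b + d <= x < o0)%N -> rmem s x = m0 x;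
  em_19 : ireg s 19 = (o0 + ireg s 20 * d)%N;
  em_20 : (ireg s 20 <= size L)%N;
  em_pts : forall t, (t < ireg s 20)%N ->
    exists i, [/\ (i < n)%N, A i & read_point d s (o0 + t * d) = pt i];
  em_nearest : forall g i0, g \in L -> (i0 < n)%N -> A i0 ->
    exists i t, [/\ nearest A mu g i, (t < ireg s 20)%N &
                     read_point d s (o0 + t * d) = pt i]
}.

Lemma emitted_stable L s s' : emitted L s ->
  (forall a, a \in [:: 0; 1; 3; 4; 5; 6; 7; 16; 19; 20; 26]%N -> ireg s' a = ireg s a) ->
  (forall a, a \in [:: 1; 3; 4; 10]%N -> rreg s' a = rreg s a) ->
  imem s' = imem s ->
  (forall x, ~~ (3 * b <= x < 3 * b + d)%N -> rmem s' x = rmem s x) ->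
  emitted L s'.
Proof.
move=> [[s0 s1 s4 s5 s6 s7 r1] s3 s26 s16 r3 r4 r10 ims lo s19 s20 pts nn] iE rE imE mE.
have rp t : read_point d s' (o0 + t * d) = read_point d s (o0 + t * d).
  by apply/rowP => k; rewrite !mxE mE //; lia.
split; rewrite ?iE ?rE // ?imE //; first by split; rewrite ?iE ?rE.
- by move=> x /[dup] /lo <- hx; apply: mE; lia.
- by move=> t /pts [i [? ? ?]]; exists i; rewrite rp.
- by move=> g i0 gL i0n Ai0; have [i [t [? ? ?]]] := nn g i0 gL i0n Ai0; exists i, t; rewrite rp.
Qed.

Lemma runs_leaf L s g : emitted L s ->
  (forall k, (k < d)%N -> rmem s (3 * b + k)%N = g`_k) ->
  (forall i, (i < n)%N -> sqdist mu g i <= (d * 25)%:R) ->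
  runs (search_code d ++ emit_code) s (n * (d * 9 + 18) + d * 6 + 13)
    (fun s' => emitted (rcons L g) s' /\
       forall k, (k < d)%N -> rmem s' (3 * b + k)%N = g`_k).
Proof.
move=> E gE bnd; have st := em_std E.
have dE g' i : (i < n)%N -> sqdist (coordinate d n s) g' i = sqdist mu g' i.
  move=> lti; apply: eq_bigr => k _; rewrite /coordinate (em_lo E) //.
  by have := @row_ltn d n (2 * b) i k lti (ltn_ord k); rewrite -/b; lia.
apply: (runs_cat_le (t1 := (n * (d * 9 + 18)).+4.+4) (t2 := d * 6 + 5)); first by lia.
apply: runs_frame; apply: (runs_weaken _ _ (runs_search (A := A) (g := g) st _ _ _)) => //;
  last 2 first.
- by move=> i lti; rewrite (em_imem E) (em_16 E) imP.
- by move=> i lti; rewrite dE ?bnd.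
move=> s2 post fr2; have st2 : std d n s2 by apply: frame_std fr2 _.
have m2 : rmem s2 = rmem s by rewrite (frame_rmem fr2).
have E2 : emitted L s2.
  apply: (emitted_stable E) => [a|a||x _]; rewrite ?m2 ?(frame_imem fr2) //.
    by rewrite !inE => H; rewrite (frame_ireg fr2) //; move: H; do ![case/orP => [/eqP->//|]] => /eqP->.
  by rewrite !inE => H; rewrite (frame_rreg fr2) //; move: H; do ![case/orP => [/eqP->//|]] => /eqP->.
case: ifP post => [/eqP s18 nA|_ [s18 [i [s17 [lti Ai inn]]]]].
  apply: (runs_weaken (t1 := 1) (Q2 := _) _ (fun s' h => h)); first by lia.
  apply: (runs_if (t1 := 0) (t2 := 0)) => //; rewrite [holds _ _]/= s18 (std1 st2).
  do 2 apply: runs_nil; split; last by move=> k ltk; rewrite m2 gE.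
  case: E2 => *; split => //; first by rewrite size_rcons leqW.
  by move=> g' i0 _ i0n Ai0; move/negP: (nA _ i0n).
have o19 : (3 * b + d <= ireg s2 19)%N by rewrite (em_19 E2); lia.
apply: runs_frame; apply: (runs_weaken _ _ (runs_emit st2 s18 s17 lti erefl o19)) => //.
move=> s3 [s3_19 s3_20 m3] fr3.
have rp t : (t < ireg s2 20)%N ->
    read_point d s3 (o0 + t * d) = read_point d s2 (o0 + t * d).
  move=> ltt; apply/rowP => k; rewrite !mxE m3 ifF //.
  have : (t.+1 * d <= ireg s2 20 * d)%N by rewrite leq_mul2r ltt orbT.
  by rewrite mulSn (em_19 E2); have := ltn_ord k; lia.
have rpN : read_point d s3 (o0 + ireg s2 20 * d) = pt i.
  apply/rowP => k; rewrite !mxE m3 -(em_19 E2) ifT; last by have := ltn_ord k; lia.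
  rewrite addKn (em_lo E2) //.
  by have := @row_ltn d n 0 i k lti (ltn_ord k); rewrite -/b; lia.
split; last first.
  by move=> k ltk; rewrite m3 ifF ?m2 ?gE //; lia.
have st3 : std d n s3 by apply: frame_std fr3 _.
have inn' : nearest A mu g i.
  split => // i' lti' Ai'.
  by rewrite -(dE g i lti) -(dE g i' lti'); exact: inn.
case: E2 => _ e3 e26 e16 er3 er4 er10 eim lo e19 e20 pts nn.
split; rewrite ?s3_19 ?s3_20 ?(frame_ireg fr3) ?(frame_rreg fr3) ?(frame_imem fr3) //.
- by move=> x hx; rewrite m3 ifF ?lo //; rewrite e19; lia.
- by rewrite e19 mulSn; lia.
- by rewrite size_rcons ltnS.
- move=> t; rewrite ltnS leq_eqVlt => /orP[/eqP->|ltt].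
    by exists i.
  by rewrite rp //; exact: pts.
- move=> g' i0; rewrite mem_rcons inE => /orP[/eqP->|gL] i0n Ai0.
    by exists i, (ireg s2 20).
  have [i1 [t [? ltt ?]]] := nn g' i0 gL i0n Ai0.
  by exists i1, t; rewrite rp // ltnW.
Qed.

Definition cnt (j0 j : nat) : nat := if j == j0 then 2 else m1.

(** On the axis [j0] the values are -2 and 2. The other axes have to cover [-4, 4]: a ray from a
    point of [-1, 1]^d meets a face hyperplane of its dominant axis after a length of at most 3, and
    its other coordinates may then exceed 2. *)
Definition coord_val (j0 j a : nat) : R :=
  if j == j0 then a%:R * 4%:R - 2%:R else a%:R * h - 4%:R.

Fixpoint grid (j0 : nat) (js : seq nat) : seq (seq R) :=
  if js is j :: js' then
    flatten [seq [seq coord_val j0 j a :: g | g <- grid j0 js'] | a <- iota 0 (cnt j0 j)]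
  else [:: [::]].

Fixpoint nest_time (j0 : nat) (js : seq nat) (tau : nat) : nat :=
  if js is j :: js' then (cnt j0 j * (nest_time j0 js' tau).+4.+4).+2 else tau.

Definition leaf_code : seq stmt := search_code d ++ emit_code.

Definition leaf_time : nat := (n * (d * 9 + 18) + d * 6 + 13)%N.

Lemma writes_nest j0 js x :
  x \notin [:: 12] ++ [seq 30 + j | j <- js]%N ->
  ~~ writes leaf_code (LInt x) -> ~~ writes (nest_code j0 js leaf_code) (LInt x).
Proof.
move=> xn wx; elim: js xn => [|j js IH] //=.
rewrite !inE !negb_or => /and3P[x12 xj xjs].
have {}IH : ~~ writes (nest_code j0 js leaf_code) (LInt x).
  by apply: IH; rewrite !inE negb_or x12 xjs.
have /negbTE xj' : (30 + j)%N != x by rewrite eq_sym.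
have /negbTE x12' : 12%N != x by rewrite eq_sym.
by case: ifP => _; rewrite /writes /= has_cat /= xj' x12' !orbF.
Qed.

Lemma emitted_frame L j sc off s s' :
  emitted L s -> frame (coord_code j sc off) s s' ->
  (forall x, ~~ (3 * b <= x < 3 * b + d)%N -> rmem s' x = rmem s x) ->
  emitted L s'.
Proof.
move=> E fr mE; apply: (emitted_stable E) => // [a|a|].
- by rewrite !inE => H; rewrite (frame_ireg fr) //; move: H; do ![case/orP => [/eqP->//|]] => /eqP->.
- by rewrite !inE => H; rewrite (frame_rreg fr) //; move: H; do ![case/orP => [/eqP->//|]] => /eqP->.
- by rewrite (frame_imem fr).
Qed.

Hypothesis mu1 : forall i k, (i < n)%N -> (k < d)%N -> `|mu i k| <= 1.
Hypothesis hP : forall a, (a < m1)%N -> `|a%:R * h - 4%:R| <= 4%:R.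

Lemma coord_val_le j0 j a : (a < cnt j0 j)%N -> `|coord_val j0 j a| <= 4%:R.
Proof.
rewrite /cnt /coord_val; case: ifP => _; last exact: hP.
by case: a => [|[|//]] _; rewrite ler_norml; apply/andP; split; lra.
Qed.

Lemma sqdist_le g i : (i < n)%N -> size g = d -> (forall x, x \in g -> `|x| <= 4%:R) ->
  sqdist mu g i <= (d * 25)%:R.
Proof.
move=> lti sg gP; rewrite natrM mulr_natl -[in leRHS](card_ord d) -sumr_const.
apply: ler_sum => k _.
have := mu1 lti (ltn_ord k); have /gP : g`_k \in g by rewrite mem_nth // sg.
by rewrite !ler_norml => /andP[? ?] /andP[? ?]; nra.
Qed.

(** Induction on the axes still to be enumerated, for any prefix [pre] already written to the node
    cells. That the prefix survives is part of the conclusion because the enclosing loops resume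
    with it. *)
Lemma runs_nest j0 m pre L s : (size pre + m = d)%N ->
  (forall x, x \in pre -> `|x| <= 4%:R) -> emitted L s ->
  (forall k, (k < size pre)%N -> rmem s (3 * b + k)%N = pre`_k) ->
  runs (nest_code j0 (iota (size pre) m) leaf_code) s
       (nest_time j0 (iota (size pre) m) leaf_time)
    (fun s' => emitted (L ++ [seq pre ++ g | g <- grid j0 (iota (size pre) m)]) s' /\
       forall k, (k < size pre)%N -> rmem s' (3 * b + k)%N = pre`_k).
Proof.
elim: m pre L s => [|m IH] pre L s.
  rewrite addn0 => sz preP E preE /=; rewrite cats0 cats1.
  by rewrite sz in preE *; apply: runs_leaf => // i lti; exact: sqdist_le.
move=> sz preP E preE; set j := size pre.
have jd : (j < d)%N by rewrite /j; lia.
(* One argument for both kinds of axis: they differ in the register of the bound and in scale and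
   offset only. *)
have loop bd sc off : bd \in [:: 3; 26]%N -> sc != 5%N -> off != 5%N ->
    (forall L' s', emitted L' s' -> ireg s' bd = cnt j0 j /\
       forall a, a%:R * rreg s' sc - rreg s' off = coord_val j0 j a) ->
    runs (For (30 + j) bd (coord_code j sc off ++ nest_code j0 (iota j.+1 m) leaf_code)) s
      (nest_time j0 (iota j m.+1) leaf_time)
      (fun s' => emitted (L ++ [seq pre ++ g | g <- grid j0 (iota j m.+1)]) s' /\
         forall k, (k < j)%N -> rmem s' (3 * b + k)%N = pre`_k).
  move=> bdP /negbTE sc5 /negbTE off5 bdE.
  have wn x : (x < 30 + j.+1)%N -> x != 12%N -> ~~ writes leaf_code (LInt x) ->
      ~~ writes (coord_code j sc off ++ nest_code j0 (iota j.+1 m) leaf_code) (LInt x).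
    move=> xj x12 xl; rewrite writes_cat negb_or writes_nest ?andbT //.
      by rewrite /writes /= [12%N == x]eq_sym (negbTE x12).
    rewrite inE negb_or x12; apply/negP => /mapP[y]; rewrite mem_iota; lia.
  have wl : ~~ writes leaf_code (LInt (30 + j)) by [].
  pose I a s' := emitted (L ++ flatten
      [seq [seq pre ++ (coord_val j0 j a' :: g) | g <- grid j0 (iota j.+1 m)] | a' <- iota 0 a]) s'
    /\ forall k, (k < j)%N -> rmem s' (3 * b + k)%N = pre`_k.
  have [bdn _] := bdE _ _ E.
  apply: (runs_weaken _ _ (runs_for (tau := (nest_time j0 (iota j.+1 m) leaf_time).+4.+2)
    (nn := cnt j0 j) (I := I) _ _ _ _ _ _ _ _ _)) => //.
  - move=> s' [E' preE']; split => //; congr emitted: E'; congr (_ ++ _) => /=.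
    by rewrite map_flatten -map_comp; congr flatten; apply: eq_map => a; rewrite /= -map_comp.
  - by apply: wn => //; lia.
  - by move: bdP; rewrite !inE => /orP[] /eqP->; apply: wn => //; lia.
  - by apply: wn => //; lia.
  - by move: bdP; rewrite !inE => /orP[] /eqP->.
  - exact: std1 (em_std E).
  - split => //=; rewrite cats0; apply: (emitted_stable E) => // a.
    by rewrite !inE; comp; do ![case/orP => [/eqP->//|]] => /eqP->.
  move=> a s1 lta fr s1c [E1 preE1].
  have st1 := em_std E1; have [_ valE] := bdE _ _ E1.
  apply: (runs_cat_le (t1 := 6) (t2 := nest_time j0 (iota j.+1 m) leaf_time)); first by lia.
  apply: runs_frame; do 6 step; apply: runs_nil; set s2 := exec _ _ => fr2.
  have m2 x : rmem s2 x = if x == (3 * b + j)%N then coord_val j0 j a else rmem s1 x.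
    rewrite /s2; comp; rewrite (std7 st1) addnC; case: ifP => // _.
    by rewrite sc5 off5 -/j s1c valE.
  clearbody s2.
  set v := coord_val j0 j a in m2.
  have E2 := emitted_frame E1 fr2.
  have {}E2 : emitted (L ++ flatten
      [seq [seq pre ++ (coord_val j0 j a' :: g) | g <- grid j0 (iota j.+1 m)] | a' <- iota 0 a]) s2.
    by apply: E2 => x hx; rewrite m2 ifF //; lia.
  have szr : size (rcons pre v) = j.+1 by rewrite size_rcons.
  have := IH (rcons pre v) _ s2; rewrite szr => {}IH.
  apply: runs_weaken (leqnn _) _ (IH _ _ _ E2 _) => [s3 [E3 preE3] _|||].
  - split=> [|k ltk]; last first.
      by rewrite preE3 ?nth_rcons ?ltk //; exact: ltnW.
    rewrite -[in iota 0 _]addn1 iotaD map_cat flatten_cat /= add0n cats0 catA.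
    have {}E3 : emitted ((L ++ flatten
      [seq [seq pre ++ (coord_val j0 j a' :: g) | g <- grid j0 (iota j.+1 m)] | a' <- iota 0 a])
      ++ [seq pre ++ (v :: g) | g <- grid j0 (iota j.+1 m)]) s3.
      by congr emitted: E3; congr (_ ++ _); apply: eq_map => g; rewrite cat_rcons.
    apply: (emitted_stable E3) => // a'.
    by rewrite !inE; comp; do ![case/orP => [/eqP->//|]] => /eqP->.
  - by rewrite /j; lia.
  - move=> x; rewrite mem_rcons inE => /orP[/eqP->|/preP//].
    exact: coord_val_le.
  - move=> k; rewrite ltnS leq_eqVlt m2 nth_rcons => /orP[/eqP->|ltk].
      by rewrite eqxx ltnn eqxx.
    by rewrite ltk ifF ?preE1 //; lia.
rewrite /=; case: eqP => jj0.
  apply: (loop 26 4 10)%N => // L' s' E'; split.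
    by rewrite (em_26 E') /cnt jj0 eqxx.
  by move=> a; rewrite (em_r4 E') (em_r10 E') /coord_val jj0 eqxx.
have jj0' : (j == j0) = false by apply/eqP.
apply: (loop 3 3 4)%N => // L' s' E'; split.
  by rewrite (em_3 E') /cnt jj0'.
by move=> a; rewrite (em_r3 E') (em_r4 E') /coord_val jj0'.
Qed.

End Emitted.

End Nearest.

(** * One sample, and the output table *)

Definition faces_code (d : nat) : seq stmt :=
  flatten [seq nest_code j0 (iota 0 d) (leaf_code d) | j0 <- iota 0 d].

Definition sample_code (d : nat) : seq stmt :=
  [:: Do (IStore 21 19); Do (IConst 20 0)] ++
  (faces_code d ++ [:: Do (IAdd 21 21 1); Do (IStore 21 20); Do (IAdd 21 21 1);
                       Do (IAdd 16 16 0)]).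

Section Output.
Variables (R : realType) (d n m1 : nat) (h : R).
Implicit Types s : store R.
Let b : nat := (n * d.+1)%N.

Definition full_grid : seq (seq R) :=
  flatten [seq grid m1 h j0 (iota 0 d) | j0 <- iota 0 d].

Definition faces_time : nat :=
  \sum_(j0 <- iota 0 d) nest_time m1 j0 (iota 0 d) (leaf_time d n).

Lemma writes_faces x :
  x \notin [:: 12] ++ [seq 30 + j | j <- iota 0 d]%N ->
  ~~ writes (leaf_code d) (LInt x) -> ~~ writes (faces_code d) (LInt x).
Proof.
move=> xn wx; rewrite /faces_code; elim: {2}(iota 0 d) => //= j0 js IH.
by rewrite writes_cat negb_or IH andbT; apply: writes_nest.
Qed.

Section Faces.
Variables (m0 : nat -> R) (A : pred nat) (f0 o0 : nat) (im : nat -> nat).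
Hypothesis o0P : (3 * b + d <= o0)%N.
Hypothesis imP : forall i, (i < n)%N -> im (f0 + i)%N = A i.
Hypothesis mu1 : forall i k, (i < n)%N -> (k < d)%N ->
  `|m0 (row d (2 * b) i k)| <= 1.
Hypothesis hP : forall a, (a < m1)%N -> `|a%:R * h - 4%:R| <= 4%:R.

Lemma runs_faces s : emitted d n m0 A f0 o0 m1 h im [::] s ->
  runs (faces_code d) s faces_time (emitted d n m0 A f0 o0 m1 h im full_grid).
Proof.
have main js L s1 : emitted d n m0 A f0 o0 m1 h im L s1 ->
    runs (flatten [seq nest_code j0 (iota 0 d) (leaf_code d) | j0 <- js]) s1
      (\sum_(j0 <- js) nest_time m1 j0 (iota 0 d) (leaf_time d n))
      (emitted d n m0 A f0 o0 m1 h im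
        (L ++ flatten [seq grid m1 h j0 (iota 0 d) | j0 <- js])).
  elim: js L s1 => [|j0 js IH] L s1 E /=.
    by rewrite cats0; apply: runs_nil.
  rewrite big_cons; apply: runs_cat.
  have := @runs_nest _ _ _ _ _ _ _ _ _ _ o0P imP mu1 hP j0 d [::] L s1 erefl.
  move=> H; apply: runs_weaken (leqnn _) _ (H _ E _) => // s' [E' _].
  rewrite catA; apply: IH; congr emitted: E'; congr (_ ++ _).
  by rewrite /= map_id.
exact: (main _ [::]).
Qed.

End Faces.

Variables (N : nat) (A : nat -> pred nat) (s0 : store R).
Hypothesis flagP : forall j i, (j < N)%N -> (i < n)%N ->
  imem s0 (N + N + j * n + i)%N = A j i.
Hypothesis mu1 : forall i k, (i < n)%N -> (k < d)%N -> `|coordinate d n s0 i k| <= 1.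
Hypothesis hP : forall a, (a < m1)%N -> `|a%:R * h - 4%:R| <= 4%:R.

Record covered s j : Prop := Covered {
  cov_len : (imem s j.*2.+1 <= size full_grid)%N;
  cov_sub : forall v, v \in read_set d s j ->
    exists i, [/\ (i < n)%N, A j i & v = input_point d s0 i];
  cov_nearest : forall g i0, g \in full_grid -> (i0 < n)%N -> A j i0 ->
    exists i, nearest d n (A j) (coordinate d n s0) g i /\
              input_point d s0 i \in read_set d s j
}.

(** Later samples write to the node cells and from the free address in register 19 upwards, so a
    list placed between them is never overwritten. *)
Definition placed s j : Prop := (3 * b + d <= imem s j.*2)%N /\
  (imem s j.*2 + imem s j.*2.+1 * d <= ireg s 19)%N.

Lemma read_setP s j v : reflect
  (exists2 t, (t < imem s j.*2.+1)%N & v = read_point d s (imem s j.*2 + t * d))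
  (v \in read_set d s j).
Proof.
rewrite /read_set in_fset /=; apply: (iffP mapP) => [[t]|[t tl ->]].
  by rewrite mem_iota => /andP[_ tl] ->; exists t.
by exists t => //; rewrite mem_iota.
Qed.

Lemma covered_stable s s' j : covered s j -> placed s j ->
  (forall x, x \in [:: j.*2; j.*2.+1] -> imem s' x = imem s x) ->
  (forall x, (3 * b + d <= x < ireg s 19)%N -> rmem s' x = rmem s x) ->
  covered s' j.
Proof.
move=> [l sub nn] [p1 p2] imE mE.
have E x : (x \in read_set d s' j) = (x \in read_set d s j).
  have rE t : (t < imem s j.*2.+1)%N ->
      read_point d s' (imem s j.*2 + t * d) = read_point d s (imem s j.*2 + t * d).
    move=> ltt; apply/rowP => k; rewrite !mxE mE //.
    have : (t.+1 * d <= imem s j.*2.+1 * d)%N by rewrite leq_mul2r ltt orbT.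
    by rewrite mulSn; have := ltn_ord k; lia.
  apply/read_setP/read_setP; rewrite !imE ?inE ?eqxx ?orbT // => -[t lt ->];
    by exists t => //; rewrite rE.
split; first by rewrite imE // !inE eqxx orbT.
  by move=> v; rewrite E; exact: sub.
by move=> g i0 gG i0n Ai0; have [i [? ?]] := nn g i0 gG i0n Ai0; exists i; rewrite E.
Qed.

Lemma writes_sample x : (x < 30)%N -> x \notin [:: 12; 16; 20; 21]%N ->
  ~~ writes (leaf_code d) (LInt x) -> ~~ writes (sample_code d) (LInt x).
Proof.
move=> x30 xn wx; move: xn; rewrite !inE => /norP[x12 /norP[x16 /norP[x20 x21]]].
have /negbTE f16 : 16%N != x by rewrite eq_sym.
have /negbTE f20 : 20%N != x by rewrite eq_sym.
have /negbTE f21 : 21%N != x by rewrite eq_sym.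
have -> : writes (sample_code d) (LInt x) = writes (faces_code d) (LInt x).
  by rewrite /sample_code !writes_cat /writes /= f20 f16 f21 /= orbF.
by apply: writes_faces => //; rewrite inE negb_or x12; apply/negP => /mapP[y _]; lia.
Qed.

Record sample_inv j s : Prop := SampleInv {
  si_std : std d n s;
  si_consts : ireg s 3 = m1 /\ ireg s 26 = 2%N;
  si_reals : [/\ rreg s 3 = h, rreg s 4 = 4%:R & rreg s 10 = 2%:R];
  si_16 : ireg s 16 = (N + N + j * n)%N;
  si_21 : ireg s 21 = j.*2;
  si_19 : (3 * b + d <= ireg s 19)%N;
  si_rmem : forall x, (x < 3 * b)%N -> rmem s x = rmem s0 x;
  si_imem : forall x, (N + N <= x)%N -> imem s x = imem s0 x;
  si_done : forall j', (j' < j)%N -> covered s j' /\ placed s j'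
}.

Lemma runs_sample s j : (j < N)%N -> sample_inv j s ->
  runs (sample_code d) s (faces_time + 6) (sample_inv j.+1).
Proof.
move=> jN [st [c3 c26] [r3 r4 r10] s16 s21 s19 rm im dn].
rewrite (_ : faces_time + 6 = (faces_time + 4).+2)%N; last by lia.
do 2 step; rewrite -/cat; set s1 := exec _ _.
have st1 : std d n s1 by case: st => *; split; comp.
set o0 := ireg s 19 in s19.
have m1E : rmem s1 = rmem s by [].
have im1 x : imem s1 x = if x == j.*2 then o0 else imem s x by rewrite /s1; comp; rewrite s21.
have pE x i k : (x + b <= 3 * b)%N -> (i < n)%N -> (k < d)%N ->
    rmem s1 (row d x i k) = rmem s0 (row d x i k).
  by move=> xb lti ltk; rewrite m1E rm //; have := @row_ltn d n x i k lti ltk; rewrite -/b; lia.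
have E1 : emitted d n (rmem s1) (A j) (ireg s 16) o0 m1 h (imem s1) [::] s1.
  by split => //; rewrite /s1; comp; rewrite ?mul0n ?addn0 // => *.
have e21 : ireg s1 21 = j.*2 by [].
have imP i : (i < n)%N -> imem s1 (ireg s 16 + i)%N = A j i.
  move=> lti; rewrite im1 ifF; last by rewrite s16; lia.
  by rewrite im s16 ?flagP //; lia.
have mu1' i k : (i < n)%N -> (k < d)%N -> `|rmem s1 (row d (2 * b) i k)| <= 1.
  by move=> lti ltk; rewrite pE ?mu1 //; lia.
clearbody s1; apply: runs_cat; apply: runs_frame.
apply: runs_weaken (leqnn _) _ (runs_faces s19 imP mu1' hP E1) => s2 E fr2.
have s2_21 : ireg s2 21 = j.*2.
  rewrite (frame_ireg fr2) // writes_faces // inE negb_or /=.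
  by apply/negP => /mapP[y _]; lia.
do 4 step; apply: runs_nil; set s3 := exec _ _.
have st2 := em_std E.
have i3 x : imem s3 x = if x == j.*2.+1 then ireg s2 20 else
    if x == j.*2 then o0 else imem s x.
  rewrite /s3; comp; rewrite s2_21 (std1 st2) addn1 (em_imem E).
  by case: ifP => // _; rewrite im1.
have r3E : rmem s3 = rmem s2 by [].
have s3_19 : ireg s3 19 = (o0 + ireg s2 20 * d)%N by rewrite /s3; comp; rewrite (em_19 E).
have inpE i : (i < n)%N -> \row_k rmem s1 (row d 0 i k) = input_point d s0 i.
  by move=> lti; apply/rowP => k; rewrite !mxE pE //; lia.
have dE g i : (i < n)%N ->
    sqdist d (fun i k => rmem s1 (row d (2 * b) i k)) g i = sqdist d (coordinate d n s0) g i.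
  by move=> lti; apply: eq_bigr => k _; rewrite pE //; lia.
have rp x : read_point d s3 x = read_point d s2 x by [].
split.
- by case: st2 => *; split; rewrite /s3; comp.
- by rewrite /s3; comp; rewrite (em_3 E) (em_26 E).
- by rewrite /s3; comp; rewrite (em_r3 E) (em_r4 E) (em_r10 E).
- by rewrite /s3; comp; rewrite (em_16 E) (std0 st2) s16 mulSn; lia.
- by rewrite /s3; comp; rewrite s2_21 (std1 st2); lia.
- by rewrite s3_19; lia.
- by move=> x xb; rewrite r3E (em_lo E) ?xb // m1E rm.
- by move=> x xN; rewrite i3 !ifF ?im //; lia.
move=> j'; rewrite ltnS leq_eqVlt => /orP[/eqP->|ltj].
  have ij : imem s3 j.*2 = o0 by rewrite i3 ifF ?eqxx //; lia.
  have ij1 : imem s3 j.*2.+1 = ireg s2 20 by rewrite i3 eqxx.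
  split; last by rewrite /placed ij ij1 s3_19.
  split; first by rewrite ij1 (em_20 E).
    move=> v /read_setP [t]; rewrite ij ij1 => ltt ->.
    by have [i [lti Ai e]] := em_pts E ltt; exists i; rewrite rp e inpE.
  move=> g i0 gG i0n Ai0; have [i [t [[lti Ai nn] ltt e]]] := em_nearest E gG i0n Ai0.
  exists i; split.
    by split => // i' lti' Ai'; rewrite -!dE //; exact: nn.
  by apply/read_setP; rewrite ij ij1; exists t => //; rewrite rp e inpE.
have [cv pl] := dn _ ltj.
have iE x : x \in [:: j'.*2; j'.*2.+1] -> imem s3 x = imem s x.
  by rewrite !inE => H; rewrite i3 !ifF //; move: H; lia.
split.
  apply: (covered_stable cv pl iE) => x; rewrite -/o0 => hx.
  by rewrite r3E (em_lo E) ?m1E // hx orbT.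
case: pl => p1 p2; rewrite /placed !iE ?inE ?eqxx ?orbT //; split => //.
by apply: leq_trans p2 _; rewrite s3_19 leq_addr.
Qed.

(** Register 0 serves as n until the last two instructions, which put N there as the output
    convention demands. *)
Lemma runs_output : sample_inv 0 s0 -> ireg s0 2 = N ->
  runs (For 8 2 (sample_code d) ++ [:: Do (IConst 0 0); Do (IAdd 0 0 2)]) s0
    (N * (faces_time + 8) + 4)
    (fun s => ireg s 0 = N /\ forall j, (j < N)%N -> covered s j).
Proof.
move=> I0 s2.
apply: (runs_cat_le (t1 := (N * (faces_time + 6).+2).+2) (t2 := 2)); first by lia.
have w2 : ~~ writes (sample_code d) (LInt 2) by apply: writes_sample.
apply: runs_frame.
apply: (runs_weaken _ _ (runs_for (tau := faces_time + 6) (nn := N) (I := sample_inv)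
   _ _ _ _ _ _ _ _ _)) => //.
- move=> s [_ _ _ _ _ _ _ _ dn] fr; do 2 step; apply: runs_nil; split.
    comp; rewrite (frame_ireg fr) //.
    by apply/negP; rewrite /writes /= has_cat /= !orbF; apply/negP.
  move=> j jN; have [cv pl] := dn j jN.
  by apply: (covered_stable cv pl).
- exact: writes_sample.
- exact: writes_sample.
- exact: std1 (si_std I0).
- case: I0 => st [? ?] [? ? ?] ? ? ? ? ? ?; split => //.
  by case: st => *; split; comp.
move=> j s ltj fr _ Ij; apply: runs_weaken (leqnn _) _ (runs_sample ltj Ij) => s' Ij' _.
case: Ij' => st [? ?] [? ? ?] ? ? ? ? ? dn; split => //.
  by case: st => *; split; comp.
by move=> j' /dn[cv pl]; split => //; apply: (covered_stable cv pl).
Qed.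

End Output.
(** * Sample size, grid and coins *)

Definition params_code (d r K Km : nat) : seq stmt :=
  [:: Do (IConst 1 1); Do (IConst 4 d.+1); Do (IConst 5 d); Do (IConst 26 2);
      Do (ROfNat 1 1); Do (IConst 22 K); Do (IConst 2 K); Do (IConst 14 (2 ^ r));
      Do (ROfNat 9 14); Do (RMul 6 1 1); Do (RMul 5 0 1)]
  ++ ([:: While (RLt 5 1)
         [:: Do (RAdd 5 5 5); Do (RMul 6 6 9); Do (IAdd 22 22 22);
             Do (IAdd 22 22 22); Do (IAdd 2 2 2); Do (IAdd 2 2 2);
             Do (IAdd 2 2 22)]]
  ++ ([:: Do (ROfNat 7 1); Do (IConst 14 4); Do (ROfNat 4 14); Do (IConst 3 Km)]
  ++ ([:: While (RLt 7 6) [:: Do (RMul 7 7 4); Do (IAdd 3 3 3)]]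
  ++ [:: Do (ROfNat 5 3); Do (IConst 14 8); Do (ROfNat 3 14); Do (RDiv 3 3 5);
         Do (IAdd 3 3 1); Do (ROfNat 10 26)]))).

Section Initialization.
Variables (R : realType) (d r K Km : nat).
Implicit Types s : store R.

Lemma first_failure (P : pred nat) : (exists m, ~~ P m) ->
  exists m, ~~ P m /\ forall j, (j < m)%N -> P j.
Proof.
move=> ex; case: (ex_minnP ex) => m nPm mmin; exists m; split => // j jm.
by apply/negPn/negP => /mmin; rewrite leqNgt jm.
Qed.

Lemma exp2_unbounded (x : R) : exists m, x <= 2 ^+ m.
Proof.
exists (Num.truncn x).+1; rewrite -natrX.
apply: le_trans (ltW (truncnS_gt x)) _.
by rewrite ler_nat ltnW // ltn_expl.
Qed.

(** The first loop doubles a copy of [eps] and builds 2^(r l) and K 4^l (l + 1); the factor l + 1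
    arises by adding the current K 4^j in each round. The second loop replaces a square root: while
    a power of 4 grows up to 2^(r l), the grid size is doubled, ending at Km 2^t. *)
Lemma runs_params s : 0 < rreg s 0 ->
  exists l t : nat,
   [/\ 1 <= 2 ^+ l * rreg s 0, forall j, (j < l)%N -> 2 ^+ j * rreg s 0 < 1,
       (2 ^ r) ^+ l <= 4 ^+ t :> R, forall j, (j < t)%N -> (4 ^ j < (2 ^ r) ^ l)%N &
  runs (params_code d r K Km) s (l * 8 + t * 3 + 30)
    (fun s' => [/\ ireg s' 1 = 1%N, ireg s' 4 = d.+1, ireg s' 5 = d, ireg s' 26 = 2%N &
      [/\ ireg s' 2 = (K * 4 ^ l * l.+1)%N,
          ireg s' 3 = (Km * 2 ^ t).+1, rreg s' 3 = 8%:R / (Km * 2 ^ t)%:R &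
          [/\ rreg s' 1 = 1, rreg s' 4 = 4%:R & rreg s' 10 = 2%:R]]])].
Proof.
set eps := rreg s 0 => eps0.
have [l [l1 l2]] : exists l, ~~ (2 ^+ l * eps < 1) /\
    forall j, (j < l)%N -> 2 ^+ j * eps < 1.
  apply: (@first_failure (fun l => 2 ^+ l * eps < 1)).
  have [m hm] := exp2_unbounded eps^-1; exists m.
  by rewrite -leNgt -ler_pdivrMr // mul1r.
have [t [t1 t2]] : exists t, ~~ (4 ^ t < (2 ^ r) ^ l)%N /\
    forall j, (j < t)%N -> (4 ^ j < (2 ^ r) ^ l)%N.
  apply: (@first_failure (fun t => 4 ^ t < (2 ^ r) ^ l)%N).
  by exists (r * l)%N; rewrite -leqNgt -[4%N]/(2 ^ 2)%N -!expnM leq_exp2l //; lia.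
rewrite -leNgt in l1; rewrite -leqNgt in t1.
exists l, t; split => //; first by rewrite -(ler_nat R) !natrX in t1.
rewrite (_ : l * 8 + t * 3 + 30 = (l * 8 + t * 3 + 19).+4.+4.+3)%N; last by lia.
do 11 step; set s1 := exec _ _; rewrite -/cat.
have e1 : [/\ ireg s1 1 = 1%N, ireg s1 4 = d.+1, ireg s1 5 = d, ireg s1 26 = 2%N &
   [/\ rreg s1 1 = 1, rreg s1 9 = (2 ^ r)%:R & [/\ rreg s1 5 = 2 ^+ 0 * eps,
       rreg s1 6 = ((2 ^ r) ^ 0)%:R, ireg s1 22 = (K * 4 ^ 0)%N &
       ireg s1 2 = (K * 4 ^ 0 * 1)%N]]].
  by split => //=; split => //=; rewrite /s1; comp; rewrite ?mulr1 ?mul1r ?expr0 ?mul1r ?muln1.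
clearbody s1; case: e1 => f1 f4 f5 f26 [fr1 fr9 I0].
apply: (runs_cat_le (t1 := (l * 8).+1) (t2 := t * 3 + 18)); first by lia.
apply: runs_frame.
apply: (runs_weaken _ _ (runs_while (L := l) (tau := 7) (I := fun j s' =>
  [/\ rreg s' 5 = 2 ^+ j * eps, rreg s' 6 = ((2 ^ r) ^ j)%:R,
      ireg s' 22 = (K * 4 ^ j)%N & ireg s' 2 = (K * 4 ^ j * j.+1)%N]) _ _ _ _)) => //;
  last 2 first.
- move=> j s' ltj fr [r5 r6 i22 i2]; split.
    by rewrite /= r5 (frame_rreg fr) // fr1 l2.
  do 7 step; apply: runs_nil; comp; rewrite r5 r6 i22 i2 (frame_rreg fr) // fr9.
  split.
  + by rewrite exprS; ring.
  + by rewrite expnS mulnC natrM.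
  + by rewrite expnS; lia.
  + by rewrite expnS; nia.
- by move=> s' fr [r5 _ _ _]; rewrite /= r5 (frame_rreg fr) // fr1 -leNgt.
move=> s2 [r5 r6 _ i2] fr2; apply: (runs_cat_le (t1 := 4) (t2 := t * 3 + 14)); first by lia.
do 4 step; apply: runs_nil; set s3 := exec _ _.
have e3 : [/\ ireg s3 1 = 1%N, ireg s3 4 = d.+1, ireg s3 5 = d, ireg s3 26 = 2%N &
   [/\ rreg s3 1 = 1, rreg s3 6 = ((2 ^ r) ^ l)%:R, rreg s3 4 = 4%:R,
       ireg s3 2 = (K * 4 ^ l * l.+1)%N & rreg s3 7 = 4 ^+ 0 /\
       ireg s3 3 = (Km * 2 ^ 0)%N]].
  by split => //=; rewrite /s3; comp;
    rewrite ?r6 ?i2 ?(frame_ireg fr2) ?(frame_rreg fr2) ?f1 ?muln1.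
clearbody s3; case: e3 => {}f1 {}f4 {}f5 {}f26 [{}fr1 {}r6 r4 {}i2 {}I0].
apply: (runs_cat_le (t1 := (t * 3).+1) (t2 := 6)); first by lia.
apply: runs_frame.
apply: (runs_weaken _ _ (runs_while (L := t) (tau := 2) (I := fun j s' =>
  rreg s' 7 = 4 ^+ j /\ ireg s' 3 = (Km * 2 ^ j)%N) _ _ _ _)) => //; last 2 first.
- move=> j s' ltj fr [r7 i3]; split.
    by rewrite /= r7 (frame_rreg fr) // r6 -natrX ltr_nat t2.
  do 2 step; apply: runs_nil; comp; rewrite r7 i3 (frame_rreg fr) // r4.
  by rewrite exprS mulrC expnS; split => //; lia.
- by move=> s' fr [r7 _]; rewrite /= r7 (frame_rreg fr) // r6 -leNgt -natrX ler_nat.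
move=> s4 [r7 i3] fr4; do 6 step; apply: runs_nil; comp.
by rewrite i3 !(frame_ireg fr4) // !(frame_rreg fr4) // f1 f26 addn1.
Qed.

End Initialization.

(** * The coin tosses *)

Definition flip_code : seq stmt :=
  [:: Do (RLoad 5 11); If (Coin 5) [:: Do (IConst 14 1)] [:: Do (IConst 14 0)];
      Do (IStore 15 14); Do (IAdd 15 15 1); Do (IAdd 11 11 4)].

Definition coin_code : seq stmt :=
  Do (IAdd 15 2 2) ::
  For 8 2 ([:: Do (IConst 11 0); Do (IAdd 11 11 5)] ++ For 9 0 flip_code).

Section Coins.
Variable R : realType.
Implicit Types s : store R.

(** The expectation over independent tosses, by recursion in the order in which the machine makes
    them, so that it unfolds in step with [run_prob]; [flips_law] relates it to the product law of
    the input. *)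
Fixpoint flips (p : nat -> R) (js : seq nat) (B : nat -> bool)
    (f : (nat -> bool) -> R) : R :=
  if js is i :: js' then
    p i * flips p js' (upd B i true) f + (1 - p i) * flips p js' (upd B i false) f
  else f B.

Fixpoint nsamples (p : nat -> R) (n N : nat) (acc : seq (nat -> bool))
    (f : seq (nat -> bool) -> R) : R :=
  if N is N'.+1 then
    flips p (iota 0 n) (fun=> false) (fun A => nsamples p n N' (rcons acc A) f)
  else f acc.

Lemma run_do Q t i k s : run_prob Q t.+1 (Do i :: k) s = run_prob Q t k (exec i s).
Proof. by []. Qed.

Lemma run_while Q t b c k s : deterministic b ->
  run_prob Q t.+1 (While b c :: k) s =
  if holds b s then run_prob Q t (c ++ While b c :: k) s else run_prob Q t k s.
Proof.
by move=> db /=; rewrite test_prob_det //; case: (holds b s);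
  rewrite ?mul1r ?mul0r ?subrr ?subr0 ?mul0r ?mul1r ?addr0 ?add0r.
Qed.

Lemma test_prob_itv b s : 0 <= test_prob b s <= 1.
Proof.
case: b => [a c|a c|a] /=; [by case: ltnP; rewrite ?ler01 ?lexx|by case: ltP; rewrite ?ler01 ?lexx|].
by rewrite le_max lexx ge_max ler01 ge_min lexx.
Qed.

Lemma run_prob_le1 Q t k s : run_prob Q t k s <= 1.
Proof.
elim: t k s => [|t IH] [|c k] s; try by rewrite /=; case: asbool; rewrite ?ler01.
- exact: ler01.
case: c => [i|b c1 c2|b c1]; first exact: IH.
- have /andP[t0 t1] := test_prob_itv b s.
  have t2 : 0 <= 1 - test_prob b s by rewrite subr_ge0.
  apply: le_trans (lerD (ler_wpM2l t0 (IH _ _)) (ler_wpM2l t2 (IH _ _))) _.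
  by rewrite !mulr1 addrC subrK.
- have /andP[t0 t1] := test_prob_itv b s.
  have t2 : 0 <= 1 - test_prob b s by rewrite subr_ge0.
  apply: le_trans (lerD (ler_wpM2l t0 (IH _ _)) (ler_wpM2l t2 (IH _ _))) _.
  by rewrite !mulr1 addrC subrK.
Qed.

Lemma run_prob_ge0 Q t k s : 0 <= run_prob Q t k s.
Proof.
elim: t k s => [|t IH] [|c k] s; try by rewrite /=; case: asbool; rewrite ?ler01.
- exact: lexx.
case: c => [i|b c1 c2|b c1]; first exact: IH.
- have /andP[t0 t1] := test_prob_itv b s.
  by rewrite addr_ge0 // mulr_ge0 ?subr_ge0 // IH.
- have /andP[t0 t1] := test_prob_itv b s.
  by rewrite addr_ge0 // mulr_ge0 ?subr_ge0 // IH.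
Qed.

Definition same_but_coins s s' : Prop :=
  [/\ forall a, a \notin [:: 8; 9; 11; 14; 15]%N -> ireg s' a = ireg s a,
      forall a, a != 5%N -> rreg s' a = rreg s a & rmem s' = rmem s].

Variables (d n N : nat) (s0 : store R).
Hypothesis sn : ireg s0 0 = n.
Hypothesis s1 : ireg s0 1 = 1%N.
Hypothesis sN : ireg s0 2 = N.
Hypothesis s4 : ireg s0 4 = d.+1.
Hypothesis s5 : ireg s0 5 = d.

Let p i : R := rmem s0 (i * d.+1 + d)%N.
Hypothesis p01 : forall i, (i < n)%N -> 0 <= p i <= 1.

(** A lower bound in continuation style: if [f] bounds the success probability of the rest from
    below for every outcome, then its expectation bounds that of the loop followed by the rest. *)
Lemma run_flips Q T k (f : (nat -> bool) -> R) (im : nat -> nat) (j f0 m i : nat)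
    (B : nat -> bool) s :
  (i + m)%N = n -> same_but_coins s0 s -> ireg s 8 = j -> ireg s 9 = i ->
  ireg s 11 = (i * d.+1 + d)%N -> ireg s 15 = (f0 + i)%N ->
  (forall i', (i' < i)%N -> imem s (f0 + i')%N = B i') ->
  (forall x, (x < f0)%N -> imem s x = im x) ->
  (forall (B' : nat -> bool) s', same_but_coins s0 s' -> ireg s' 8 = j -> ireg s' 15 = (f0 + n)%N ->
     (forall i', (i' < n)%N -> imem s' (f0 + i')%N = B' i') ->
     (forall x, (x < f0)%N -> imem s' x = im x) ->
     f B' <= run_prob Q T k s') ->
  flips p (iota i m) B f <=
  run_prob Q (m * 8 + T).+1 (While (ILt 9 0) (flip_code ++ [:: Do (IAdd 9 9 1)]) :: k) s.
Proof.
elim: m i B s => [|m IH] i B s.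
  rewrite addn0 => -> [ie re me] s8 s9 s11 s15 fl lo H.
  by rewrite run_while //= s9 (ie 0%N) // sn ltnn H.
move=> im' [ie re me] s8 s9 s11 s15 fl lo H.
have lti : (i < n)%N by lia.
rewrite run_while // [holds _ _]/= s9 (ie 0%N) // sn lti.
have step bit : flips p (iota i.+1 m) (upd B i bit) f <=
    run_prob Q (m * 8 + T).+1 (While (ILt 9 0) (flip_code ++ [:: Do (IAdd 9 9 1)]) :: k)
      (exec (IAdd 9 9 1) (exec (IAdd 11 11 4) (exec (IAdd 15 15 1) (exec (IStore 15 14)
         (exec (IConst 14 bit) (exec (RLoad 5 11) s)))))).
  set s2 := exec _ _.
  have im2 x : imem s2 x = if x == (f0 + i)%N then bit : nat else imem s x.
    by rewrite /s2; comp; rewrite s15.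
  have {}im' : (i.+1 + m)%N = n by rewrite addSnnS.
  apply: IH => //.
  - split.
    + move=> a; rewrite !inE => /norP[a8 /norP[a9 /norP[a11 /norP[a14 a15]]]].
      rewrite /s2; comp; rewrite (negbTE a9) (negbTE a11) (negbTE a14) (negbTE a15) ie //.
      by rewrite !inE !negb_or a8 a9 a11 a14 a15.
    + by move=> a a5; rewrite /s2; comp; rewrite (negbTE a5) re.
    + by rewrite /s2; comp.
  - by rewrite /s2; comp; rewrite s9 (ie 1%N) // s1 addn1.
  - by rewrite /s2; comp; rewrite s11 (ie 4%N) // s4 mulSn; lia.
  - by rewrite /s2; comp; rewrite s15 (ie 1%N) // s1; lia.
  - move=> i' lti'; rewrite im2 /upd eqn_add2l; case: eqP => // ne.
    by apply: fl; lia.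
  - by move=> x xlt; rewrite im2 ifF ?lo //; lia.
rewrite (_ : m.+1 * 8 + T = ((m * 8 + T).+1).+4.+3)%N; last by lia.
move: step; set W := While _ _ :: k; move: ((m * 8 + T).+1) W => T' W step.
have -> : run_prob Q T'.+4.+3 ((flip_code ++ [:: Do (IAdd 9 9 1)]) ++ W) s =
   p i * run_prob Q T' W (exec (IAdd 9 9 1) (exec (IAdd 11 11 4) (exec (IAdd 15 15 1) (exec (IStore 15 14)
         (exec (IConst 14 true) (exec (RLoad 5 11) s)))))) +
   (1 - p i) * run_prob Q T' W (exec (IAdd 9 9 1) (exec (IAdd 11 11 4) (exec (IAdd 15 15 1) (exec (IStore 15 14)
         (exec (IConst 14 false) (exec (RLoad 5 11) s)))))).
  (* The truncation to [0, 1] in [test_prob] has no effect on an existence probability. *)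
  have <- : test_prob (Coin 5) (exec (RLoad 5 11) s) = p i.
    comp; rewrite me s11 -/(p i); have /andP[p0 p1] := p01 lti.
    by rewrite min_r // max_r.
  by [].
have /andP[p0 p1] := p01 lti.
by rewrite /= lerD // ler_wpM2l ?subr_ge0 // step.
Qed.

Definition flags_of (acc : seq (nat -> bool)) s : Prop :=
  forall j i, (j < size acc)%N -> (i < n)%N ->
    imem s (N + N + j * n + i)%N = nth (fun=> false) acc j i.

Lemma run_samples Q T k f m acc s :
  (size acc + m)%N = N -> same_but_coins s0 s -> ireg s 8 = size acc ->
  ireg s 15 = (N + N + size acc * n)%N -> flags_of acc s ->
  (forall acc' s', size acc' = N -> same_but_coins s0 s' -> flags_of acc' s' ->
     f acc' <= run_prob Q T k s') ->
  nsamples p n m acc f <=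
  run_prob Q (m * (n * 8 + 6) + T).+1
    (While (ILt 8 2) ((([:: Do (IConst 11 0); Do (IAdd 11 11 5)] ++ For 9 0 flip_code))
                      ++ [:: Do (IAdd 8 8 1)]) :: k) s.
Proof.
elim: m acc s => [|m IH] acc s.
  rewrite addn0 => sz [ie re me] s8 s15 fl H.
  by rewrite run_while // [holds _ _]/= s8 (ie 2%N) // sN sz ltnn; exact: H.
move=> sz sb s8 s15 fl H; have [ie re me] := sb.
rewrite run_while // [holds _ _]/= s8 (ie 2%N) // sN ifT; last by lia.
rewrite (_ : m.+1 * (n * 8 + 6) + T =
  (n * 8 + ((m * (n * 8 + 6) + T).+1).+1).+4)%N; last by lia.
rewrite 3!run_do.
apply: (run_flips (im := imem s) (j := size acc) (f0 := N + N + size acc * n)) => //.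
- case: sb => ie' re' me'; split => //= a.
  rewrite !inE => /norP[a8 /norP[a9 /norP[a11 /norP[a14 a15]]]].
  comp; rewrite (negbTE a9) (negbTE a11) ie' //.
  by rewrite !inE !negb_or a8 a9 a11 a14 a15.
- by comp; rewrite (ie 5%N) // s5.
- by comp; rewrite addn0.
move=> B s' sb' s'8 s'15 fl' lo'; rewrite run_do.
have [ie' re' me'] := sb'.
have e8 : ireg s' 8 = size acc by [].
apply: IH; rewrite ?size_rcons //.
- by rewrite addSnnS.
- split => // a; rewrite !inE => /norP[a8 /norP[a9 /norP[a11 /norP[a14 a15]]]].
  comp; rewrite (negbTE a8) ie' //.
  by rewrite !inE !negb_or a8 a9 a11 a14 a15.
- by comp; rewrite s'8 (ie' 1%N) // s1 addn1.
- by comp; rewrite s'15 mulSn; lia.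
move=> j i; rewrite size_rcons ltnS nth_rcons leq_eqVlt /= => /orP[/eqP->|ltj] lti.
  by rewrite eqxx ltnn fl'.
rewrite ltj lo' ?fl //.
have : (j.+1 * n <= size acc * n)%N by rewrite leq_mul2r ltj orbT.
by rewrite mulSn; lia.
Qed.

Lemma run_coins Q T k f s : same_but_coins s0 s ->
  (forall acc' s', size acc' = N -> same_but_coins s0 s' -> flags_of acc' s' ->
     f acc' <= run_prob Q T k s') ->
  nsamples p n N [::] f <=
  run_prob Q ((N * (n * 8 + 6) + T).+3) (coin_code ++ k) s.
Proof.
move=> sb H; have [ie re me] := sb; rewrite 2!run_do; apply: run_samples => //.
- split => //= a; rewrite !inE => /norP[a8 /norP[a9 /norP[a11 /norP[a14 a15]]]].
  comp; rewrite (negbTE a8) (negbTE a15) ie //.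
  by rewrite !inE !negb_or a8 a9 a11 a14 a15.
- by comp; rewrite (ie 2%N) // sN addn0.
Qed.

End Coins.
(** * Geometry of the kernel *)

Section Root.
Variable R : realType.

(** Concavity of x^(1/r), stated for powers so that induction on [r] replaces calculus. With a, b, c
    the roots of m, m + W and y it says that raising y by t^r W raises its root by at most t times
    the spread of the roots. *)
Lemma pow_increment (r : nat) (a b c t : R) : 0 <= a -> a <= b -> a <= c ->
  0 <= t <= 1 -> c ^+ r + t ^+ r * (b ^+ r - a ^+ r) <= (c + t * (b - a)) ^+ r.
Proof.
move=> a0 ab ac /andP[t0 t1]; have c0 := le_trans a0 ac; have b0 := le_trans a0 ab.
elim: r => [|r IH]; first by rewrite !expr0 subrr mulr0 addr0.
set X := b ^+ r - a ^+ r in IH *; have X0 : 0 <= X by rewrite subr_ge0 lerXn2r.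
have cz : 0 <= c + t * (b - a) by rewrite addr_ge0 ?mulr_ge0 ?subr_ge0.
rewrite [leRHS]exprS; apply: le_trans (ler_wpM2l cz IH).
have -> : b ^+ r.+1 - a ^+ r.+1 = b * X + (b - a) * a ^+ r by rewrite /X !exprS; ring.
have h1 : a ^+ r <= c ^+ r by rewrite lerXn2r.
have tr0 : 0 <= t ^+ r by rewrite exprn_ge0.
have tr1 : t ^+ r <= 1 by rewrite exprn_ile1.
have ar0 : 0 <= a ^+ r by rewrite exprn_ge0.
have k1 : t * (b - a) * (t ^+ r * a ^+ r) <= t * (b - a) * c ^+ r.
  rewrite ler_wpM2l ?mulr_ge0 ?subr_ge0 //.
  by apply: le_trans h1; rewrite ler_piMl.
have k2 : t ^+ r * X * (t * a) <= t ^+ r * X * c.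
  rewrite ler_wpM2l ?mulr_ge0 //; apply: le_trans ac; rewrite ler_piMl //.
rewrite !exprS -subr_ge0.
(* What is left after the induction hypothesis is the sum of the two gaps in [k1] and [k2]. *)
have -> : (c + t * (b - a)) * (c ^+ r + t ^+ r * X) -
   (c * c ^+ r + t * t ^+ r * (b * X + (b - a) * a ^+ r)) =
  (t * (b - a) * c ^+ r - t * (b - a) * (t ^+ r * a ^+ r)) +
  (t ^+ r * X * c - t ^+ r * X * (t * a)) by ring.
by rewrite addr_ge0 ?subr_ge0.
Qed.

Definition root (r : nat) (x : R) : R := x `^ r%:R^-1.

Lemma root_ge0 r x : 0 <= root r x.
Proof. exact: powR_ge0. Qed.

Lemma rootK r x : (0 < r)%N -> 0 <= x -> root r x ^+ r = x.
Proof.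
move=> r0 x0; rewrite -powR_mulrn ?root_ge0 // /root -powRrM mulVf ?powRr1 //.
by rewrite pnatr_eq0 -lt0n.
Qed.

Lemma root_le r x y : 0 <= x -> x <= y -> root r x <= root r y.
Proof.
move=> x0 xy; apply: ge0_ler_powR; rewrite ?nnegrE ?invr_ge0 ?ler0n //.
exact: le_trans xy.
Qed.

Lemma root_increment r (m W t y y' : R) : (0 < r)%N -> 0 <= m -> 0 <= W ->
  0 <= t <= 1 -> m <= y -> m <= y' -> y' <= y + t ^+ r * W ->
  root r y' <= root r y + t * (root r (m + W) - root r m).
Proof.
move=> r0 m0 W0 t01 my my' yy'; have y0 := le_trans m0 my; have y'0 := le_trans m0 my'.
have mW : m <= m + W by rewrite lerDl.
have := pow_increment r (root_ge0 r m) (root_le r m0 mW) (root_le r m0 my) t01.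
rewrite !rootK ?(le_trans m0 mW) // [m + W]addrC addrK -[W + m]addrC => h.
have z0 : 0 <= root r y + t * (root r (m + W) - root r m).
  by rewrite addr_ge0 ?root_ge0 // mulr_ge0 ?subr_ge0 ?root_le //; case/andP: t01.
rewrite -(@ler_pXn2r _ r) ?nnegrE ?root_ge0 // rootK //.
exact: le_trans h.
Qed.

End Root.

Section Support.
Variables (R : realType) (d n m : nat).
Hypothesis m_gt0 : (0 < m)%N.
Let h : R := 8%:R / m%:R.

Lemma step_gt0 : 0 < h.
Proof. by rewrite divr_gt0 ?ltr0n. Qed.

Lemma step_grid a : (a < m.+1)%N -> `|a%:R * h - 4%:R| <= 4%:R.
Proof.
rewrite ltnS => am; rewrite ler_norml.
have : a%:R * h <= m%:R * h by rewrite ler_wpM2r ?ler_nat // ltW ?step_gt0.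
have : 0 <= a%:R * h by rewrite mulr_ge0 ?ler0n // ltW ?step_gt0.
have -> : m%:R * h = 8%:R by rewrite /h mulrC divfK // pnatr_eq0 -lt0n.
by move=> ? ?; apply/andP; split; lra.
Qed.

Lemma grid_near j0 (js : seq nat) (x : nat -> R) :
  x j0 = 2%:R \/ x j0 = - 2%:R -> (forall j, `|x j| <= 4%:R) ->
  exists g, [/\ g \in grid m.+1 h j0 js, size g = size js &
    forall k, (k < size js)%N -> `|g`_k - x (nth 0%N js k)| <= h].
Proof.
move=> x0 x4; elim: js => [|j js [g [gG sg gx]]]; first by exists [::].
have [a [am ax]] : exists a, (a < cnt m.+1 j0 j)%N /\
    `|coord_val h j0 j a - x j| <= h.
  rewrite /cnt /coord_val; case: eqP => [->|_].
    by case: x0 => ->; [exists 1%N|exists 0%N]; split => //;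
       rewrite ?mul1r ?mul0r [X in `|X|](_ : _ = 0) ?normr0 ?(ltW step_gt0) //; lra.
  have /andP[xl xu] : - 4%:R <= x j <= 4%:R by rewrite -ler_norml.
  have h0 := step_gt0; pose z := (x j + 4%:R) / h.
  have z0 : 0 <= z by rewrite divr_ge0 ?(ltW h0) //; lra.
  have /andP[z1 z2] := truncn_itv z0.
  exists (Num.truncn z); split.
    rewrite ltnS -(ler_nat R); apply: le_trans z1 _.
    rewrite /z ler_pdivrMr // /h mulrC divfK ?pnatr_eq0 -?lt0n //; lra.
  move: z1 z2; move: (Num.truncn z) => T.
  rewrite /z ler_pdivlMr // ltr_pdivrMr // -[T.+1%:R]natr1 mulrDl mul1r => z1 z2.
  by rewrite ler_norml; apply/andP; split; lra.
exists (coord_val h j0 j a :: g); split => /=; last 2 first.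
- by rewrite sg.
- by case=> [|k] //= /gx.
apply/flattenP; exists [seq coord_val h j0 j a :: g' | g' <- grid m.+1 h j0 js].
  by apply/mapP; exists a; rewrite // mem_iota.
exact: map_f.
Qed.

Lemma full_gridP j0 g : (j0 < d)%N -> g \in grid m.+1 h j0 (iota 0 d) ->
  g \in full_grid d m.+1 h.
Proof.
move=> j0d gG; apply/flattenP; exists (grid m.+1 h j0 (iota 0 d)) => //.
by apply/mapP; exists j0; rewrite // mem_iota.
Qed.

(* The ray from the point i0 in direction w is followed until it leaves the cube
   [-2, 2]^d through the face of its dominant coordinate; g is the grid point
   next to the exit point, at offset y.  With v the displacement from i0 to i and
   l >= 1 the travelled length, the inequality |v - (l w + y)| <= |l w + y| gives
   2 l <w, v> >= |v|^2 - 2 <y, v> >= - |y|^2. *)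
Lemma nearest_support (A : pred nat) (mu : nat -> nat -> R) (w : nat -> R) V i0 :
  (0 < d)%N -> (forall i k, (i < n)%N -> (k < d)%N -> `|mu i k| <= 1) ->
  (forall k, (k < d)%N -> `|w k| <= V) -> (i0 < n)%N -> A i0 ->
  exists2 g, g \in full_grid d m.+1 h & forall i, nearest d n A mu g i ->
    \sum_(k < d) w k * mu i0 k - d%:R * h ^+ 2 / 2%:R * V <= \sum_(k < d) w k * mu i k.
Proof.
move=> d0 mu1 wV i0n Ai0; have h0 := step_gt0.
have V0 : 0 <= V by apply: le_trans (wV _ d0).
have [j0 _ j0max] := @Order.TotalTheory.arg_maxP _ _ _ (Ordinal d0) xpredT
  (fun k : 'I_d => `|w k|) isT.
set z := `|w j0| in j0max; have {}j0max (k : 'I_d) : `|w k| <= z by exact: j0max.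
 have z0 : 0 <= z by exact: normr_ge0.
have zV : z <= V by exact: wV.
have err0 : 0 <= d%:R * h ^+ 2 / 2%:R by rewrite divr_ge0 ?ler0n // mulr_ge0 ?ler0n ?sqr_ge0.
(* Here w = 0, both sums vanish and any node serves; the other case allows division by z. *)
have [zz|zn] := eqVneq z 0.
  have [g [gG _ _]] := @grid_near j0 (iota 0 d) (fun=> 2%:R) (or_introl erefl)
    (fun=> ltac:(rewrite ger0_norm; lra)).
  exists g; first exact: full_gridP gG.
  move=> i _; have w0 (k : 'I_d) : w k = 0.
    by apply/eqP; rewrite -normr_le0 -zz j0max.
  rewrite !big1 => [|k _|k _]; rewrite ?w0 ?mul0r // sub0r oppr_le0.
  by rewrite mulr_ge0.
have zp : 0 < z by rewrite lt_neqAle eq_sym zn.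
pose wt k := w k / z.
have wt1 (k : 'I_d) : `|wt k| <= 1.
  by rewrite normf_div (ger0_norm z0) ler_pdivrMr // mul1r j0max.
have wtj0 : wt j0 = 1 \/ wt j0 = -1.
  rewrite /wt /z; have [wp|wn] := leP 0 (w j0).
    by left; rewrite ger0_norm // divff // -(ger0_norm wp).
  by right; rewrite ltr0_norm // invrN mulrN divff // lt_eqF.
(* Since wt j0 is 1 or -1, this length takes the coordinate j0 from mu i0 j0 exactly to twice wt j0,
   a face of the cube. *)
pose l := 2%:R - wt j0 * mu i0 j0.
have /andP[mul muu] : -1 <= mu i0 j0 <= 1 by rewrite -ler_norml mu1.
have [l1 l3] : 1 <= l /\ l <= 3%:R.
  by rewrite /l; case: wtj0 => ->; split; lra.
pose x k := if (k < d)%N then mu i0 k + l * wt k else 0.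
have xj0 : x j0 = 2%:R \/ x j0 = - 2%:R.
  rewrite /x ltn_ord /l; case: wtj0 => ->; [left|right]; lra.
have x4 k : `|x k| <= 4%:R.
  rewrite /x; case: ifP => [kd|_]; last by rewrite normr0 ler0n.
  have := wt1 (Ordinal kd); have := mu1 _ _ i0n kd; rewrite !ler_norml /=.
  by move=> /andP[? ?] /andP[? ?]; apply/andP; split; nra.
have [g [gG _ gx]] := grid_near (iota 0 d) xj0 x4.
exists g; first exact: full_gridP gG.
move=> i [lti Ai /(_ _ i0n Ai0) gi].
have {}gx (k : 'I_d) : (g`_k - x k) ^+ 2 <= h ^+ 2.
  have := gx k; rewrite size_iota ltn_ord nth_iota // add0n => /(_ isT).
  by rewrite -(@ler_pXn2r _ 2) ?nnegrE ?(ltW h0) // real_normK ?num_real.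
have key : - (d%:R * h ^+ 2) <= 2%:R * l * \sum_(k < d) wt k * (mu i k - mu i0 k).
  have -> : d%:R * h ^+ 2 = \sum_(k < d) h ^+ 2 by rewrite sumr_const card_ord mulr_natl.
  rewrite mulr_sumr -sumrN.
  rewrite -[leLHS]addr0 -[leRHS](subrK (sqdist d mu g i0 - sqdist d mu g i)).
  rewrite lerD ?subr_ge0 // -sumrB -sumrB; apply: ler_sum => k _.
  have -> : 2%:R * l * (wt k * (mu i k - mu i0 k)) -
     ((mu i0 k - g`_k) ^+ 2 - (mu i k - g`_k) ^+ 2) =
     (mu i k - mu i0 k - (g`_k - x k)) ^+ 2 - (g`_k - x k) ^+ 2.
    by rewrite /x ltn_ord; ring.
  by have := gx k; have := sqr_ge0 (mu i k - mu i0 k - (g`_k - x k)); lra.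
set S := \sum_(k < d) wt k * _ in key.
have SE : \sum_(k < d) w k * mu i k - \sum_(k < d) w k * mu i0 k = z * S.
  rewrite -sumrB mulr_sumr; apply: eq_bigr => k _.
  by rewrite /wt mulrA [z * _]mulrC divfK // mulrBr.
(* If [S] is negative, l >= 1 gives 2 l S <= 2 S, so [key] bounds 2 S from below. *)
have S1 : - (d%:R * h ^+ 2 / 2%:R) <= S.
  have [S0|S0] := leP 0 S; first by apply: le_trans S0; rewrite oppr_le0.
  have : 2%:R * l * S <= 2%:R * S.
    by rewrite -mulrA ler_wpM2l // ?ler0n // -[leRHS]mul1r ler_wnM2r // ltW.
  lra.
set E := d%:R * h ^+ 2 / 2%:R in err0 S1 *.
have a1 : - (z * E) <= z * S by rewrite -mulrN ler_wpM2l.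
have a2 : z * E <= E * V by rewrite mulrC ler_wpM2l.
move: SE; lra.
Qed.

End Support.
(** * Concentration *)

Local Notation expR := sequences.expR.

Section Expectation.
Variables (R : realType) (p : nat -> R) (n : nat).
Hypothesis p01 : forall i, (i < n)%N -> 0 <= p i <= 1.

Lemma flips_linear js B f g c :
  flips p js B (fun A => f A + c * g A) = flips p js B f + c * flips p js B g.
Proof. by elim: js B => //= i js IH B; rewrite !IH; ring. Qed.

Lemma flips_const js B (c : R) : flips p js B (fun=> c) = c.
Proof. by elim: js B => //= i js IH B; rewrite !IH; ring. Qed.

Lemma flips_le js B f g : (forall i, i \in js -> (i < n)%N) ->
  (forall A, f A <= g A) -> flips p js B f <= flips p js B g.
Proof.
move=> jsn fg; elim: js jsn B => //= i js IH jsn B.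
have /andP[p0 p1] := p01 (jsn i (mem_head _ _)).
have {}IH B' : flips p js B' f <= flips p js B' g.
  by apply: IH => k kjs; apply: jsn; rewrite inE kjs orbT.
by rewrite lerD // ler_wpM2l // subr_ge0.
Qed.

Definition mean (f : (nat -> bool) -> R) : R := flips p (iota 0 n) (fun=> false) f.

Lemma mean_le f g : (forall A, f A <= g A) -> mean f <= mean g.
Proof. by apply: flips_le => i; rewrite mem_iota. Qed.

Lemma nsamples_linear N acc f g c :
  nsamples p n N acc (fun l => f l + c * g l) =
  nsamples p n N acc f + c * nsamples p n N acc g.
Proof.
elim: N acc => //= N IH acc; rewrite -flips_linear.
by congr flips; apply/funext => A; rewrite IH.
Qed.

Lemma nsamples_const N acc (c : R) : nsamples p n N acc (fun=> c) = c.
Proof.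
elim: N acc => //= N IH acc; rewrite -[RHS](flips_const (iota 0 n) (fun=> false)).
by congr flips; apply/funext => A; rewrite IH.
Qed.

Lemma nsamples_le N acc f g : (forall l, f l <= g l) ->
  nsamples p n N acc f <= nsamples p n N acc g.
Proof. by move=> fg; elim: N acc => //= N IH acc; apply: mean_le. Qed.

Lemma nsamples_sum (I : Type) (r : seq I) N acc (f : I -> seq (nat -> bool) -> R) :
  nsamples p n N acc (fun l => \sum_(i <- r) f i l) =
  \sum_(i <- r) nsamples p n N acc (f i).
Proof.
elim: r => [|i r IH].
  rewrite big_nil -[RHS](nsamples_const N acc); congr nsamples.
  by apply/funext => l; rewrite big_nil.
rewrite big_cons -IH -[X in _ + X]mul1r -nsamples_linear; congr nsamples.
by apply/funext => l; rewrite big_cons mul1r.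
Qed.

Lemma nsamples_prod N acc (X : (nat -> bool) -> R) :
  nsamples p n N acc (fun l => \prod_(A <- l) X A) =
  \prod_(A <- acc) X A * mean X ^+ N.
Proof.
elim: N acc => [|N IH] acc /=; first by rewrite expr0 mulr1.
rewrite exprS mulrCA [RHS]mulrC /mean.
transitivity (flips p (iota 0 n) (fun=> false)
   (fun A => 0 + (\prod_(B <- acc) X B * mean X ^+ N) * X A)).
  congr flips; apply/funext => A.
  by rewrite IH big_rcons /= add0r mulrAC.
by rewrite flips_linear flips_const add0r.
Qed.

(** From exp(-y) >= 1 - y one gets exp(y) <= 1 / (1 - y), and (1 - y)(1 + y + 2 y^2) = 1 + y^2 (1 -
    2 y). *)
Lemma expR_le_quad (y : R) : y <= 2^-1 -> expR y <= 1 + y + 2 * y ^+ 2.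
Proof.
move=> y2; have := expR_ge1Dx (- y); rewrite expRN => h.
have y1 : 0 < 1 - y by lra.
rewrite -[leLHS]invrK; have := expR_gt0 y => e0.
have e1 : (1 - y) * expR y <= 1.
  by rewrite -ler_pdivlMr // mul1r.
have e2 : 1 <= (1 - y) * (1 + y + 2 * y ^+ 2) by nra.
rewrite invrK; rewrite -(ler_pM2l y1); exact: le_trans e2.
Qed.

(** Exponential Markov inequality: the moment generating function is at most exp(2 lam^2), and lam =
    t / 4 minimizes 2 lam^2 - lam t, with value - t^2 / 8. *)
Lemma deviation N (Y : (nat -> bool) -> R) (t : R) : 0 <= t <= 1 ->
  (forall A, `|Y A| <= 1) -> mean Y = 0 ->
  nsamples p n N [::] (fun l => (N%:R * t <= \sum_(A <- l) Y A)%R%:R)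
    <= expR (- (N%:R * t ^+ 2 / 8%:R)).
Proof.
move=> /andP[t0 t1] Y1 EY; pose lam := t / 4%:R.
have lam0 : 0 <= lam by rewrite divr_ge0 ?ler0n.
have mgf : mean (fun A => expR (lam * Y A)) <= expR (2 * lam ^+ 2).
  apply: le_trans (expR_ge1Dx _).
  have -> : 1 + 2 * lam ^+ 2 = mean (fun A => (1 + 2 * lam ^+ 2) + lam * Y A).
    by rewrite /mean flips_linear flips_const -/(mean Y) EY mulr0 addr0.
  apply: mean_le => A; have := Y1 A; rewrite ler_norml => /andP[ya yb].
  have yl : lam * Y A <= 2^-1 by rewrite /lam; nra.
  apply: le_trans (expR_le_quad yl) _.
  have : (lam * Y A) ^+ 2 <= lam ^+ 2.
    by rewrite exprMn ler_piMr ?sqr_ge0 // -real_normK ?num_real // exprn_ile1.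
  lra.
apply: (@le_trans _ _ (nsamples p n N [::] (fun l =>
   0 + expR (- (lam * (N%:R * t))) * \prod_(A <- l) expR (lam * Y A)))).
  apply: nsamples_le => l; rewrite add0r -expR_sum -expRD -mulr_sumr.
  case: (leP (N%:R * t)) => [h|_]; last exact: expR_ge0.
  by rewrite -[leLHS]expR0 ler_expR addrC -mulrBr mulr_ge0 // subr_ge0.
rewrite nsamples_linear nsamples_const add0r nsamples_prod big_nil mul1r.
apply: le_trans (ler_wpM2l (expR_ge0 _) (_ : _ <= expR (2 * lam ^+ 2) ^+ N)) _.
  rewrite lerXn2r ?nnegrE ?expR_ge0 //.
  rewrite -[leLHS](flips_const (iota 0 n) (fun=> false)).
  by apply: mean_le => A; exact: expR_ge0.
rewrite -expRM_natl -expRD ler_expR /lam.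
have : 0 <= N%:R * t ^+ 2 by rewrite mulr_ge0 ?ler0n ?sqr_ge0.
rewrite -[_ *+ N]mulr_natl; nra.
Qed.

Definition concentrated (I : finType) (X : I -> (nat -> bool) -> R) (t : R)
    (l : seq (nat -> bool)) : bool :=
  [forall i, `|\sum_(A <- l) (X i A - mean (X i))| < (size l)%:R * t].

(** [concentrated] speaks of [size l] and [nsamples_le] compares functions on all lists, so the
    length has to be replaced by its constant value first. *)
Lemma nsamples_size N acc (f : nat -> seq (nat -> bool) -> R) :
  nsamples p n N acc (fun l => f (size l) l) =
  nsamples p n N acc (f (size acc + N)%N).
Proof.
elim: N acc => [|N IH] acc /=; first by rewrite addn0.
by congr flips; apply/funext => A; rewrite IH size_rcons addSnnS.
Qed.

(** Union bound over the two tails of each [X i]; the boolean index of [Y] is the sign, whence the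
    factor 2. *)
Lemma concentration N (I : finType) (X : I -> (nat -> bool) -> R) (t : R) :
  0 <= t <= 1 -> (forall i A, 0 <= X i A <= 1) ->
  1 - (2 * #|I|)%:R * expR (- (N%:R * t ^+ 2 / 8%:R)) <=
  nsamples p n N [::] (fun l => (concentrated X t l)%:R).
Proof.
move=> t01 X01.
have mean01 i : 0 <= mean (X i) <= 1.
  have cst c : mean (fun=> c) = c by exact: flips_const.
  by rewrite -{1}(cst 0) -(cst 1); apply/andP; split; apply: mean_le => A;
    have /andP[] := X01 i A.
pose Y (i : I) (b : bool) A : R := if b then X i A - mean (X i) else mean (X i) - X i A.
have EY i b : mean (Y i b) = 0.
  rewrite /Y; case: b.
    transitivity (mean (fun A => X i A + (-1) * mean (X i))).
      by congr mean; apply/funext => A; rewrite mulN1r.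
    by rewrite /mean flips_linear flips_const -/(mean (X i)); ring.
  transitivity (mean (fun A => mean (X i) + (-1) * X i A)).
    by congr mean; apply/funext => A; rewrite mulN1r.
  by rewrite /mean flips_linear flips_const -/(mean (X i)); ring.
have Y1 i b A : `|Y i b A| <= 1.
  have := X01 i A; have := mean01 i => /andP[? ?] /andP[? ?].
  by rewrite ler_norml /Y; case: b; apply/andP; split; lra.
set e := expR _.
pose bad l : R := \sum_(ib : I * bool) (N%:R * t <= \sum_(A <- l) Y ib.1 ib.2 A)%R%:R.
apply: (@le_trans _ _ (nsamples p n N [::] (fun l => 1 + (-1) * bad l))).
  rewrite nsamples_linear nsamples_const nsamples_sum lerD2l mulN1r lerN2.
  have -> : (2 * #|I|)%:R * e = \sum_(ib : I * bool) e.
    by rewrite sumr_const card_prod card_bool mulnC mulr_natl.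
  by apply: ler_sum => ib _; apply: deviation.
rewrite (nsamples_size N [::] (fun m l =>
  [forall i, `|\sum_(A <- l) (X i A - mean (X i))| < m%:R * t]%:R)) add0n.
apply: nsamples_le => l; rewrite /bad mulN1r.
case: forallP => [_|nf].
  by rewrite gerBl sumr_ge0 // => ib _; rewrite ler0n.
have [i /negP ni] : exists i, ~ (`|\sum_(A <- l) (X i A - mean (X i))| < N%:R * t).
  by apply/existsNP => H; apply: nf.
rewrite -leNgt in ni; rewrite subr_le0.
pose b := 0 <= \sum_(A <- l) (X i A - mean (X i)).
rewrite (bigD1 (i, b)) //= -[leLHS]addr0; apply: lerD;
  last by apply: sumr_ge0 => ib _; rewrite ler0n.
suff -> : N%:R * t <= \sum_(A <- l) Y i b A by [].
move: ni; rewrite /Y /b; case: (leP 0 (\sum_(A <- l) (X i A - mean (X i)))) => s0.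
  by rewrite ger0_norm.
rewrite ltr0_norm // -sumrN => /le_trans; apply.
by apply: ler_sum => A _; rewrite opprB.
Qed.

End Expectation.

(** * The product law of the input *)

Section Law.
Variables (R : realType) (n : nat).

(* em_law sum with arbitrary weights q; it is affine in each q i, and flips
   resolves the coordinates one after the other. *)
Definition bernoulli_sum (q : nat -> R) (F : {set 'I_n} -> R) : R :=
  \sum_(A : {set 'I_n}) (\prod_(i < n) (if i \in A then q i else 1 - q i)) * F A.

Lemma bernoulli_sum_affine q F j : bernoulli_sum q F =
  q j * bernoulli_sum (upd q j 1) F + (1 - q j) * bernoulli_sum (upd q j 0) F.
Proof.
rewrite /bernoulli_sum !mulr_sumr -big_split; apply: eq_bigr => A _ /=.
have [jn|jn] := ltnP j n; last first.
  have E x : \prod_(i < n) (if i \in A then upd q j x i else 1 - upd q j x i) =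
             \prod_(i < n) (if i \in A then q i else 1 - q i).
    by apply: eq_bigr => i _; rewrite /upd ltn_eqF // (leq_trans (ltn_ord i)).
  by rewrite !E; ring.
have E x : \prod_(i < n) (if i \in A then upd q j x i else 1 - upd q j x i) =
   (if Ordinal jn \in A then x else 1 - x) *
   \prod_(i < n | i != Ordinal jn) (if i \in A then q i else 1 - q i).
  rewrite (bigD1 (Ordinal jn)) //= /upd eqxx; congr (_ * _).
  by apply: eq_bigr => i ij; rewrite (_ : (i : nat) == j = false) //;
    apply/negP => /eqP e; move/eqP: ij; apply; apply: val_inj.
rewrite !E (bigD1 (Ordinal jn)) //=.
by case: ifP => _; ring.
Qed.

Lemma bernoulli_sum_indicator (B : nat -> bool) F :
  bernoulli_sum (fun i => (B i)%:R) F = F [set i : 'I_n | B i].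
Proof.
rewrite /bernoulli_sum (bigD1 [set i : 'I_n | B i]) //= big1 => [|i _].
  rewrite mul1r big1 ?addr0 // => A AB.
  have [i iAB] : exists i : 'I_n, (i \in A) != B i.
    apply/existsP; rewrite -negb_forall; apply: contra AB => /forallP H.
    by apply/eqP/setP => i; rewrite inE; exact/eqP.
  rewrite (bigD1 i) //=; move: iAB; case: ifP => _; case: (B i) => // _;
    by rewrite ?subrr !mul0r.
by rewrite inE; case: (B i); rewrite ?subr0.
Qed.

Lemma flips_law (p : nat -> R) F :
  mean p n (fun B => F [set i : 'I_n | B i]) = bernoulli_sum p F.
Proof.
(* After j tosses the weights below j have become the outcomes 0 or 1; when all are resolved,
   [bernoulli_sum_indicator] leaves a single term. *)
have main m j B : (j + m)%N = n ->
    flips p (iota j m) B (fun B => F [set i : 'I_n | B i]) =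
    bernoulli_sum (fun i => if (j <= i)%N then p i else (B i)%:R) F.
  elim: m j B => [|m IH] j B jm /=.
    rewrite -bernoulli_sum_indicator; apply: eq_bigr => A _; congr (_ * _).
    by apply: eq_bigr => i _; have -> : (j <= i)%N = false by have := ltn_ord i; lia.
  rewrite [RHS](bernoulli_sum_affine _ _ j) leqnn !IH ?addSnnS //.
  congr (_ * _ + _ * _); apply: eq_bigr => A _; congr (_ * _);
    apply: eq_bigr => i _; rewrite /upd ltn_neqAle eq_sym;
    by case: eqP => [->|_] /=; rewrite ?leqnn ?eqxx.
rewrite /mean main // /bernoulli_sum; apply: eq_bigr => A _; congr (_ * _).
Qed.

End Law.

(** * Maxima as combinations of hitting events *)

Section Levels.
Variables (R : realType) (n : nat).

Definition hit (kap : nat -> nat) (A : nat -> bool) (k : nat) : bool :=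
  [exists i : 'I_n, A i && (k <= kap i)%N].

(* The maximum of g over A is, up to eta, a nonnegative combination of the
   events that A hits an upper level set of kap, whatever A is. *)
Lemma level_combination (kap : nat -> nat) (D : nat) (g : nat -> R) (tau eta : R) :
  0 <= tau ->
  (forall i, (i < n)%N -> 0 <= g i <= tau) -> (forall i, (i < n)%N -> (kap i <= D)%N) ->
  (forall i i', (i < n)%N -> (i' < n)%N -> (kap i' <= kap i)%N -> g i' <= g i + eta) ->
  exists D_ : nat -> R, [/\ forall k, 0 <= D_ k, \sum_(k < D.+1) D_ k <= tau &
    forall (A : nat -> bool) i1, (i1 < n)%N -> A i1 ->
      (forall i, (i < n)%N -> A i -> g i <= g i1) ->
      g i1 <= \sum_(k < D.+1) D_ k * (hit kap A k)%:R <= g i1 + eta].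
Proof.
move=> tau0 g01 kD gmod.
(* Running maximum over the points of level at most k. Its increments [D_] are the weights, and A
   hits level k exactly when k does not exceed its top level, so the combination telescopes to [hk]
   at that level. *)
pose hk k : R := \big[Num.max/0]_(i < n | (kap i <= k)%N) g i.
have hk_ge (i : 'I_n) k : (kap i <= k)%N -> g i <= hk k by move=> ik; apply: le_bigmax_cond.
have hk_le k x : 0 <= x -> (forall i : 'I_n, (kap i <= k)%N -> g i <= x) -> hk k <= x.
  by move=> x0 H; apply/bigmax_leP.
have hk0 k : 0 <= hk k by apply: bigmax_ge_id.
have hkS k : hk k <= hk k.+1.
  by apply: hk_le => // i ik; apply: hk_ge; exact: leqW.
pose D_ k := if k is k'.+1 then hk k - hk k' else hk 0%N.
have D0 k : 0 <= D_ k by case: k => [|k] //=; rewrite subr_ge0.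
have sumD K : \sum_(k < K.+1) D_ k = hk K.
  elim: K => [|K IH]; first by rewrite big_ord1.
  by rewrite big_ord_recr IH /= addrC subrK.
have hktau k : hk k <= tau.
  by apply: hk_le => // i _; case/andP: (g01 i (ltn_ord i)).
exists D_; split => //; first by rewrite sumD.
move=> A i1 lti1 Ai1 gmax.
have [i0 Ai0 i0max] := @arg_maxnP _ (Ordinal lti1) (fun i : 'I_n => A i) (fun i => kap i) Ai1.
have -> : \sum_(k < D.+1) D_ k * (hit kap A k)%:R = hk (kap i0).
  rewrite -(sumD (kap i0)) (big_ord_widen D.+1 D_) ?ltnS ?kD //.
  rewrite [RHS]big_mkcond; apply: eq_bigr => k _; rewrite ltnS.
  have -> : hit kap A k = (k <= kap i0)%N.
    apply/existsP/idP => [[i /andP[Ai ki]]|ki]; last by exists i0; rewrite Ai0.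
    exact: leq_trans ki (i0max _ Ai).
  by case: ifP; rewrite ?mulr1 ?mulr0.
apply/andP; split.
  by apply: (hk_ge (Ordinal lti1)); exact: (i0max (Ordinal lti1)).
have eta0 : 0 <= eta by have := gmod _ _ lti1 lti1 (leqnn _); rewrite lerDl.
have /andP[g0 _] := g01 _ lti1.
apply: hk_le => [|i ik]; first exact: addr_ge0.
apply: le_trans (gmod _ _ (ltn_ord i0) (ltn_ord i) ik) _.
by rewrite lerD2r gmax.
Qed.

End Levels.

(** * Rounding of directions *)

Section Directions.
Variables (R : realType) (d n B G : nat) (mu : nat -> nat -> R).
Hypothesis G_gt0 : (0 < G)%N.
Hypothesis mu1 : forall i k, (i < n)%N -> (k < d)%N -> `|mu i k| <= 1.

(** Integer vectors with entries in [- B G, B G], shifted to natural numbers: the coefficients of a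
    direction relative to the width, scaled by G. *)
Definition direction : finType := {ffun 'I_d -> 'I_(2 * B * G).+1}.

(** The added d B G makes the truncated number nonnegative ([level_arg]), so that truncation is
    rounding down. *)
Definition level (a : direction) (i : nat) : nat :=
  Num.truncn (\sum_(k < d) mu i k * ((a k)%:R - (B * G)%:R) + (d * (B * G))%:R).

Lemma level_arg (a : direction) i : (i < n)%N ->
  0 <= \sum_(k < d) mu i k * ((a k)%:R - (B * G)%:R) + (d * (B * G))%:R
    <= (2 * (d * (B * G)))%:R.
Proof.
move=> lti; have : `|\sum_(k < d) mu i k * ((a k)%:R - (B * G)%:R)| <= (d * (B * G))%:R.
  have -> : (d * (B * G))%:R = \sum_(k < d) (B * G)%:R :> R.
    by rewrite sumr_const card_ord natrM mulr_natl.
  apply: le_trans (ler_norm_sum _ _ _) _; apply: ler_sum => k _.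
  rewrite normrM -[leRHS]mul1r ler_pM ?normr_ge0 ?mu1 // ler_norml.
  have ak : (a k)%:R <= 2%:R * (B * G)%:R :> R.
    by rewrite -natrM ler_nat mulnA; have := ltn_ord (a k); rewrite ltnS.
  have a0 : 0 <= (a k)%:R :> R by rewrite ler0n.
  by apply/andP; split; lra.
by rewrite ler_norml natrM => /andP[? ?]; apply/andP; split; lra.
Qed.

Lemma level_le a i : (i < n)%N -> (level a i <= 2 * (d * (B * G)))%N.
Proof.
move=> lti; have /andP[h0 h1] := level_arg a lti.
by rewrite /level -(ler_nat R); apply: le_trans h1; rewrite truncn_le.
Qed.

(** In units of W / G, rounding the coefficients costs at most d at each of the two points and
    rounding the inner product costs 1 more, whence 2 d + 1. *)
Lemma direction_approx (c : nat -> R) (W : R) : 0 <= W ->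
  (forall k, (k < d)%N -> `|c k| <= B%:R * W) ->
  exists a : direction, forall i i', (i < n)%N -> (i' < n)%N -> (level a i' <= level a i)%N ->
    \sum_(k < d) mu i' k * c k <= \sum_(k < d) mu i k * c k + (2 * d + 1)%:R / G%:R * W.
Proof.
move=> W0 cW; have [WE|Wn] := eqVneq W 0.
  exists [ffun=> ord0] => i i' _ _ _; rewrite WE mulr0 addr0.
  have c0 (k : 'I_d) : c k = 0.
    by apply/eqP; rewrite -normr_le0; have := cW _ (ltn_ord k); rewrite WE mulr0.
  by rewrite !big1 // => k _; rewrite c0 mulr0.
have Wp : 0 < W by rewrite lt_neqAle eq_sym Wn.
have Gp : 0 < G%:R :> R by rewrite ltr0n.
pose z k := (c k / W + B%:R) * G%:R.
have zP (k : 'I_d) : 0 <= z k <= (2 * B * G)%:R.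
  have := cW _ (ltn_ord k); rewrite ler_norml => /andP[c1 c2].
  have h1 : - B%:R <= c k / W by rewrite ler_pdivlMr // mulNr.
  have h2 : c k / W <= B%:R by rewrite ler_pdivrMr.
  rewrite /z mulr_ge0 ?ler0n //=; last by lra.
  by rewrite natrM ler_wpM2r ?ler0n // natrM; lra.
have zlt (k : 'I_d) : (Num.truncn (z k) < (2 * B * G).+1)%N.
  have /andP[z0 z1] := zP k.
  by rewrite ltnS -(ler_nat R); apply: le_trans z1; rewrite truncn_le.
pose a : direction := [ffun k => Ordinal (zlt k)].
exists a => i i' lti lti' lev.
have /andP[s0 _] := level_arg a lti; have /andP[s0' _] := level_arg a lti'.
pose S i := \sum_(k < d) mu i k * ((a k)%:R - (B * G)%:R).
pose C i := \sum_(k < d) mu i k * c k.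
have SC j : (j < n)%N -> `|C j * G%:R / W - S j| <= d%:R.
  move=> ltj; have -> : d%:R = \sum_(k < d) 1 :> R by rewrite sumr_const card_ord.
  rewrite /C /S !mulr_suml -sumrB; apply: le_trans (ler_norm_sum _ _ _) _.
  apply: ler_sum => k _; rewrite ffunE /=.
  have -> : mu j k * c k * G%:R / W - mu j k * ((Num.truncn (z k))%:R - (B * G)%:R) =
            mu j k * (z k - (Num.truncn (z k))%:R) by rewrite /z natrM; ring.
  rewrite normrM -[leRHS]mul1r ler_pM ?normr_ge0 ?mu1 //.
  have /andP[z0 _] := zP k; have /andP[t1 t2] := truncn_itv z0.
  by rewrite -natr1 in t2; rewrite ler_norml; apply/andP; split; lra.
have Slt : S i' <= S i + 1.
  have /andP[_ t2] := truncn_itv s0'; have /andP[t1 _] := truncn_itv s0.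
  have lev' : (level a i').+1%:R <= (level a i)%:R + 1 :> R by rewrite natr1 ler_nat ltnS.
  rewrite -/(level a i') in t2; rewrite -/(level a i) in t1; rewrite /S; lra.
have := SC _ lti; have := SC _ lti'; rewrite !ler_norml => /andP[_ h1] /andP[h2 _].
have h3 : C i' * G%:R / W <= C i * G%:R / W + (2 * d + 1)%:R.
  by rewrite natrD natrM; lra.
rewrite -/(C i) -/(C i').
have -> : C i' = C i' * G%:R / W * (W / G%:R) by field; rewrite Wn gt_eqF.
have -> : C i + (2 * d + 1)%:R / G%:R * W =
  (C i * G%:R / W + (2 * d + 1)%:R) * (W / G%:R) by field; rewrite Wn gt_eqF.
by rewrite ler_wpM2r // divr_ge0 // ltW.
Qed.

End Directions.
(** * The spread of a realization *)

Section Spread.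
Variables (R : realType) (d : nat).

Lemma bigmax_attained (T : eqType) (s : seq T) (g : T -> R) :
  s != [::] -> (forall v, 0 <= g v) ->
  exists2 v, v \in s & \big[Num.max/0]_(v <- s) g v = g v /\ {in s, forall w, g w <= g v}.
Proof.
move=> s0 g0; elim: s s0 => // a s IH _; have [->|sn] := eqVneq s [::].
  exists a; first by rewrite mem_head.
  rewrite big_cons big_nil max_l //; split => // w.
  by rewrite mem_seq1 => /eqP->.
have [v vs [vE vmax]] := IH sn; rewrite big_cons vE.
have [av|va] := leP (g a) (g v).
  by exists v; rewrite ?inE ?vs ?orbT //; split => // w; rewrite inE => /orP[/eqP->|/vmax].
exists a; rewrite ?inE ?eqxx //; split => // w.
by rewrite inE => /orP[/eqP->//|/vmax/le_trans]; apply; exact: ltW.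
Qed.

Lemma bigmin_attained (T : eqType) (s : seq T) (g : T -> R) M :
  s != [::] -> {in s, forall v, g v <= M} ->
  exists2 v, v \in s & \big[Num.min/M]_(v <- s) g v = g v /\ {in s, forall w, g v <= g w}.
Proof.
move=> s0; elim: s s0 => // a s IH _ gM; have [s0|sn] := eqVneq s [::].
  exists a; first by rewrite mem_head.
  rewrite s0 big_cons big_nil min_l; last by apply: gM; rewrite mem_head.
  by split => // w; rewrite mem_seq1 => /eqP->.
have [v vs [vE vmin]] := IH sn (fun w ws => gM w (mem_behead (s := a :: s) ws)).
rewrite big_cons vE; have [av|va] := leP (g a) (g v).
  exists a; rewrite ?inE ?eqxx //; split => // w.
  by rewrite inE => /orP[/eqP->//|/vmin]; apply: le_trans.
exists v; rewrite ?inE ?vs ?orbT //; split => // w.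
by rewrite inE => /orP[/eqP->|/vmin//]; exact: ltW.
Qed.

Lemma Tr0 r (u : point R d) : Tr r fset0 u = 0.
Proof. by rewrite /Tr (size0nil (cardfs0 (point R d))) !big_nil subrr. Qed.

Lemma Tr_attained r (u : point R d) (F : {fset point R d}) : F != fset0 ->
  exists v1 v2, [/\ v1 \in F, v2 \in F,
    {in F, forall v, root r (dot u v) <= root r (dot u v1)},
    {in F, forall v, root r (dot u v2) <= root r (dot u v)} &
    Tr r F u = root r (dot u v1) - root r (dot u v2)].
Proof.
move=> F0; have sF : (F : seq _) != [::].
  by apply: contra F0 => /eqP e; rewrite -cardfs_eq0 e.
have [v1 v1F [E1 max1]] := bigmax_attained sF (fun v => root_ge0 r (dot u v)).
have [v2 v2F [E2 min2]] := bigmin_attained sF max1.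
by exists v1, v2; split => //; rewrite /Tr -!/(root r _) E1 E2.
Qed.

End Spread.

(** * Error analysis in a fixed direction *)

Section Estimate.
Variables (R : realType) (d n r : nat) (P : existential_model R d n).
Variables (pt : nat -> point R d) (mu : nat -> nat -> R).
Hypotheses (d_gt0 : (0 < d)%N) (r_gt0 : (0 < r)%N) (n_gt0 : (0 < n)%N).
Hypothesis ptE : forall i : 'I_n, pt i = em_point P i.
Hypothesis mu_coord : coordinates n pt mu.

Definition present (A : nat -> bool) : {set 'I_n} := [set i : 'I_n | A i].

Lemma em_realP (A : nat -> bool) v : reflect
  (exists i, [/\ (i < n)%N, A i & v = pt i]) (v \in em_real P (present A)).
Proof.
rewrite /em_real; apply: (iffP (imfsetP _ _ _ _)) => [[i /=]|[i [lti Ai ->]]].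
  by rewrite inE => Ai ->; exists i; rewrite -ptE ltn_ord.
by exists (Ordinal lti); rewrite ?inE //= -ptE.
Qed.

Section Direction.
Variable u : point R d.
Hypothesis u_polar : in_polar P u.
Let y i : R := dot u (pt i).

(** The coefficients are c k = [dot u (e k)], so that the estimates at the lower end can be made
    with - c. This avoids the direction - u, which need not lie in the polar set. *)
Lemma width_data : exists i1 i2 (c : nat -> R),
  let m := y i1 in let W := y i2 - y i1 in
  [/\ (i1 < n)%N /\ (i2 < n)%N, 0 <= m, forall i, (i < n)%N -> m <= y i <= m + W,
      forall i j, (i < n)%N -> (j < n)%N ->
        y i - y j = \sum_(k < d) mu i k * c k - \sum_(k < d) mu j k * c k &
      forall k, (k < d)%N -> `|c k| <= 2 ^+ d * W].
Proof.
have [e [eE mu1 eW]] := mu_coord.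
have [i1 _ i1P] := @Order.TotalTheory.arg_minP _ _ _ (Ordinal n_gt0) xpredT
  (fun i : 'I_n => y i) isT.
have [i2 _ i2P] := @Order.TotalTheory.arg_maxP _ _ _ (Ordinal n_gt0) xpredT
  (fun i : 'I_n => y i) isT.
have i1le i (lti : (i < n)%N) : y i1 <= y i by exact: (i1P (Ordinal lti)).
have i2le i (lti : (i < n)%N) : y i <= y i2 by exact: (i2P (Ordinal lti)).
pose c k := if insub k is Some k' then dot u (e k') else 0.
have cE (k : 'I_d) : c k = dot u (e k) by rewrite /c valK.
exists i1, i2, c; split => //=.
- by rewrite /y ptE; exact: u_polar.
- by move=> i lti; rewrite i1le // addrC subrK i2le.
- have yE i : (i < n)%N -> y i = y 0%N + \sum_(k < d) mu i k * c k.
    move=> lti; rewrite -[y i](subrK (y 0%N)) addrC -dotBr eE // dot_sumr.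
    by congr (_ + _); apply: eq_bigr => k _; rewrite dotZr cE.
  by move=> i j lti ltj; rewrite (yE i) // (yE j) //; ring.
- move=> k kd; rewrite (cE (Ordinal kd)); apply: eW => i j lti ltj.
  by rewrite dotBr lerB ?i1le ?i2le.
Qed.

Definition spread (A : nat -> bool) : R := Tr r (em_real P (present A)) u.

Lemma spread_attained (A : nat -> bool) i : (i < n)%N -> A i ->
  exists a1 a2, [/\ (a1 < n)%N /\ A a1, (a2 < n)%N /\ A a2,
    forall j, (j < n)%N -> A j -> root r (y j) <= root r (y a1),
    forall j, (j < n)%N -> A j -> root r (y a2) <= root r (y j) &
    spread A = root r (y a1) - root r (y a2)].
Proof.
move=> lti Ai; have F0 : em_real P (present A) != fset0.
  apply/fset0Pn; exists (pt i); apply/em_realP; exists i; split => //.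
have [v1 [v2 [/em_realP[a1 [? ? ->]] /em_realP[a2 [? ? ->]] max1 min2 TE]]] :=
  Tr_attained r u F0.
exists a1, a2; split => // j ltj Aj.
  by apply: max1; apply/em_realP; exists j.
by apply: min2; apply/em_realP; exists j.
Qed.

Lemma spread0 (A : nat -> bool) : (forall i, (i < n)%N -> ~~ A i) -> spread A = 0.
Proof.
move=> A0; rewrite /spread (_ : em_real _ _ = fset0) ?Tr0 //.
apply/eqP; apply: contraT => /fset0Pn[v /em_realP[i [lti Ai _]]].
by rewrite (negbTE (A0 i lti)) in Ai.
Qed.

Lemma spread_ge0 A : 0 <= spread A.
Proof.
case: (pselect (exists i, (i < n)%N /\ A i)) => [[i [lti Ai]]|H].
  have [a1 [a2 [[l1 A1] _ _ min2 ->]]] := spread_attained lti Ai.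
  by rewrite subr_ge0 min2.
by rewrite spread0 // => i lti; apply/negP => Ai; apply: H; exists i.
Qed.

Variables (i1 i2 : nat) (c : nat -> R).
Let m := y i1.
Let W := y i2 - y i1.
Hypothesis i1n : (i1 < n)%N.
Hypothesis i2n : (i2 < n)%N.
Hypothesis m_ge0 : 0 <= m.
Hypothesis yP : forall i, (i < n)%N -> m <= y i <= m + W.
Hypothesis ycE : forall i j, (i < n)%N -> (j < n)%N ->
  y i - y j = \sum_(k < d) mu i k * c k - \sum_(k < d) mu j k * c k.
Hypothesis cW : forall k, (k < d)%N -> `|c k| <= 2 ^+ d * W.
Let tau := root r (m + W) - root r m.

Variable t : R.
Hypothesis t01 : 0 <= t <= 1.

Let W_ge0 : 0 <= W.
Proof. by have := yP i1n; rewrite -/m => /andP[_]; rewrite lerDl. Qed.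

Let tau_ge0 : 0 <= tau.
Proof. by rewrite subr_ge0 root_le // lerDl. Qed.

Lemma root_y i j : (i < n)%N -> (j < n)%N -> y j <= y i + t ^+ r * W ->
  root r (y j) <= root r (y i) + t * tau.
Proof.
by move=> lti ltj; apply: root_increment => //;
  [case/andP: (yP lti)|case/andP: (yP ltj)].
Qed.

Lemma root_itv i : (i < n)%N -> root r m <= root r (y i) <= root r (m + W).
Proof.
move=> lti; have /andP[h1 h2] := yP lti.
by rewrite !root_le // (le_trans m_ge0).
Qed.

Variables (G : nat).
Hypothesis G_gt0 : (0 < G)%N.
Hypothesis Gt : (2 * d + 1)%:R / G%:R <= t ^+ r.

Let top := (2 * (d * (2 ^ d * G)))%N.

Definition hitting (ak : direction d (2 ^ d) G * 'I_(2 * (d * (2 ^ d * G))).+1)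
    (A : nat -> bool) : R := (hit n (level mu ak.1) A ak.2)%:R.

Let mu1 i k : (i < n)%N -> (k < d)%N -> `|mu i k| <= 1.
Proof. by have [e [_ H _]] := mu_coord => lti ltk; exact: (H _ (Ordinal ltk)). Qed.

(** For nonempty A the spread is (max root y - root m) + (root (m + W) - min root y) - tau: two
    maxima of functions with values in [0, tau], each a combination of hitting events, for c and for
    - c, with error at most t tau. The correction tau is weighted by the event of hitting level 0,
    which is nonemptiness, so that an empty A gives 0. *)
Lemma spread_combination : exists (a a' : direction d (2 ^ d) G) (D D' : nat -> R),
  [/\ forall k, 0 <= D k, forall k, 0 <= D' k,
      \sum_(k < top.+1) D k <= tau, \sum_(k < top.+1) D' k <= tau &
   forall A, spread A <=
     \sum_(k < top.+1) D k * hitting (a, k) A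
     + \sum_(k < top.+1) D' k * hitting (a', k) A - tau * hitting (a, ord0) A
     <= spread A + 2 * (t * tau)].
Proof.
have cW' k : (k < d)%N -> `|c k| <= (2 ^ d)%:R * W by rewrite natrX; exact: cW.
have ncW' k : (k < d)%N -> `|- c k| <= (2 ^ d)%:R * W by rewrite normrN; exact: cW'.
have [a aP] := direction_approx G_gt0 mu1 W_ge0 cW'.
have [a' a'P] := direction_approx G_gt0 mu1 W_ge0 ncW'.
have GW : (2 * d + 1)%:R / G%:R * W <= t ^+ r * W by rewrite ler_wpM2r.
pose g i := root r (y i) - root r m.
pose g' i := root r (m + W) - root r (y i).
have g01 i : (i < n)%N -> 0 <= g i <= tau.
  by move=> lti; have /andP[? ?] := root_itv lti; rewrite /g /tau; apply/andP; split; lra.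
have g'01 i : (i < n)%N -> 0 <= g' i <= tau.
  by move=> lti; have /andP[? ?] := root_itv lti; rewrite /g' /tau; apply/andP; split; lra.
have gmod i i' : (i < n)%N -> (i' < n)%N -> (level mu a i' <= level mu a i)%N ->
    g i' <= g i + t * tau.
  move=> lti lti' lev; have := aP _ _ lti lti' lev; have := ycE lti' lti => h1 h2.
  have : root r (y i') <= root r (y i) + t * tau by apply: root_y => //; lra.
  by rewrite /g; lra.
have g'mod i i' : (i < n)%N -> (i' < n)%N -> (level mu a' i' <= level mu a' i)%N ->
    g' i' <= g' i + t * tau.
  move=> lti lti' lev; have := a'P _ _ lti lti' lev; have := ycE lti lti' => h1.
  rewrite [X in X <= _ -> _](_ : _ = - \sum_(k < d) mu i' k * c k); last first.
    by rewrite -sumrN; apply: eq_bigr => k _; rewrite mulrN.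
  rewrite [X in _ <= X + _ -> _](_ : _ = - \sum_(k < d) mu i k * c k); last first.
    by rewrite -sumrN; apply: eq_bigr => k _; rewrite mulrN.
  move=> h2; have : root r (y i) <= root r (y i') + t * tau by apply: root_y => //; lra.
  by rewrite /g'; lra.
have lev (a0 : direction d (2 ^ d) G) i : (i < n)%N -> (level mu a0 i <= top)%N.
  by move=> lti; apply: (level_le mu1).
have [D [D0 Dtau DP]] := level_combination tau_ge0 g01 (lev a) gmod.
have [D' [D'0 D'tau D'P]] := level_combination tau_ge0 g'01 (lev a') g'mod.
exists a, a', D, D'; split => // A.
case: (pselect (exists i, (i < n)%N /\ A i)) => [[i [lti Ai]]|H]; last first.
  have A0 i : (i < n)%N -> ~~ A i by move=> lti; apply/negP => Ai; apply: H; exists i.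
  have h0 ak : hitting ak A = 0.
    rewrite /hitting /hit; case: existsP => // -[j /andP[Aj _]].
    by rewrite (negbTE (A0 j (ltn_ord j))) in Aj.
  rewrite spread0 // !big1 => [|k _|k _]; rewrite ?h0 ?mulr0 //.
  have /andP[t0 _] := t01.
  by rewrite addr0 subr0 lexx add0r !mulr_ge0.
have [b1 [b2 [[l1 A1] [l2 A2] max1 min2 ->]]] := spread_attained lti Ai.
have -> : hitting (a, ord0) A = 1.
  by rewrite /hitting (_ : hit _ _ _ _) //; apply/existsP; exists (Ordinal lti); rewrite /= Ai.
have /andP[s1 s2] := DP A b1 l1 A1 (fun j lj Aj => ltac:(by rewrite lerD2r max1)).
have /andP[s3 s4] := D'P A b2 l2 A2 (fun j lj Aj => ltac:(by rewrite lerD2l lerN2 min2)).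
move: s1 s2 s3 s4; rewrite /g /g' /hitting /=.
move: (\sum_(k < top.+1) _) (\sum_(k < top.+1) _) => X Y s1 s2 s3 s4.
by apply/andP; split; rewrite /tau in s2 s4 *; lra.
Qed.

Variable p : nat -> R.
Hypothesis pE : forall i : 'I_n, p i = em_prob P i.

Let p01 i : (i < n)%N -> 0 <= p i <= 1.
Proof.
by move=> lti; rewrite (pE (Ordinal lti)) em_prob_ge0 em_prob_le1.
Qed.

Lemma mean_sum K (D : nat -> R) (X : 'I_K -> (nat -> bool) -> R) :
  mean p n (fun A => \sum_(k < K) D k * X k A) = \sum_(k < K) D k * mean p n (X k).
Proof.
rewrite unlock /=; elim: (index_enum _) => [|k s IH] /=; first exact: flips_const.
rewrite -IH addrC -flips_linear /mean; congr flips.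
by apply/funext => A; rewrite addrC.
Qed.

(** The deviations contribute 3 t tau, by the total weight of the events, and the approximation by
    the combination contributes 2 t tau. The hypothesis does not depend on [u], so one good list of
    realizations serves all directions. *)
Lemma sum_spread (l : seq (nat -> bool)) : concentrated p n hitting t l ->
  `|\sum_(A <- l) spread A - (size l)%:R * mean p n spread| <= (size l)%:R * (5%:R * (t * tau)).
Proof.
move=> /forallP conc; have [a [a' [D [D' [D0 D'0 Dtau D'tau H]]]]] := spread_combination.
pose N : R := (size l)%:R; have N0 : 0 <= N by rewrite ler0n.
have /andP[t0 _] := t01; have ttau0 : 0 <= t * tau by rewrite mulr_ge0.
pose dev ak := \sum_(A <- l) hitting ak A - N * mean p n (hitting ak).
have devP ak : `|dev ak| <= N * t.
  have := conc ak; rewrite sumrB big_const_seq count_predT iter_addr_0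
    -[mean _ _ _ *+ _]mulr_natl.
  by move/ltW.
have comb a0 (D1 : nat -> R) : (forall k, 0 <= D1 k) -> \sum_(k < top.+1) D1 k <= tau ->
    `|\sum_(A <- l) \sum_(k < top.+1) D1 k * hitting (a0, k) A
      - N * \sum_(k < top.+1) D1 k * mean p n (hitting (a0, k))| <= N * (t * tau).
  move=> D10 D1tau; rewrite exchange_big /= mulr_sumr -sumrB.
  apply: (@le_trans _ _ (\sum_(k < top.+1) D1 k * (N * t))); last first.
    by rewrite -mulr_suml mulrC -mulrA ler_wpM2l // ler_wpM2l.
  apply: le_trans (ler_norm_sum _ _ _) _; apply: ler_sum => k _.
  rewrite -mulr_sumr mulrCA -mulrBr normrM ger0_norm //.
  by rewrite ler_wpM2l ?D10 // -/(dev (a0, k)) devP.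
pose Th A := \sum_(k < top.+1) D k * hitting (a, k) A
     + \sum_(k < top.+1) D' k * hitting (a', k) A - tau * hitting (a, ord0) A.
have meanTh : mean p n Th = \sum_(k < top.+1) D k * mean p n (hitting (a, k))
     + \sum_(k < top.+1) D' k * mean p n (hitting (a', k))
     - tau * mean p n (hitting (a, ord0)).
  rewrite -!mean_sum -mulNr -addrA -[X in _ + X]mul1r -!flips_linear.
  by congr flips; apply/funext => A; rewrite /Th mul1r mulNr addrA.
have devTh : `|\sum_(A <- l) Th A - N * mean p n Th| <= N * (3%:R * (t * tau)).
  have c1 := comb a D D0 Dtau; have c2 := comb a' D' D'0 D'tau.
  have c3 : `|tau * dev (a, ord0)| <= N * (t * tau).
    rewrite normrM (ger0_norm tau_ge0) (_ : N * (t * tau) = tau * (N * t)); last by ring.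
    by rewrite ler_wpM2l.
  rewrite meanTh /Th big_split /= sumrN big_split /= -mulr_sumr.
  move: c1 c2 c3; rewrite /dev !ler_norml => /andP[? ?] /andP[? ?] /andP[? ?].
  by apply/andP; split; lra.
have l1 : \sum_(A <- l) spread A <= \sum_(A <- l) Th A.
  by apply: ler_sum => A _; have /andP[] := H A.
have l2 : \sum_(A <- l) Th A <= \sum_(A <- l) spread A + N * (2 * (t * tau)).
  have -> : N * (2 * (t * tau)) = \sum_(A <- l) 2 * (t * tau).
    by rewrite big_const_seq count_predT iter_addr_0 -[RHS]mulr_natl.
  rewrite -big_split; apply: ler_sum => A _; by have /andP[] := H A.
have m1 : mean p n spread <= mean p n Th.
  by apply: (mean_le p01) => A; have /andP[] := H A.
have m2 : mean p n Th <= mean p n spread + 2 * (t * tau).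
  have -> : mean p n spread + 2 * (t * tau) = mean p n (fun A => 2 * (t * tau) + 1 * spread A).
    by rewrite /mean flips_linear flips_const mul1r addrC.
  by apply: (mean_le p01) => A; rewrite mul1r addrC; have /andP[] := H A.
have n1 := ler_wpM2l N0 m1; have n2 := ler_wpM2l N0 m2; rewrite mulrDr in n2.
move: devTh; rewrite -/N !ler_norml => /andP[? ?].
by apply/andP; split; nra.
Qed.

Lemma mean_spread :
  mean p n spread = expectation (em_stochastic P) (fun A => Tr r A u).
Proof.
rewrite /spread (flips_law p (fun A => Tr r (em_real P A) u)) /expectation /bernoulli_sum /=.
apply: eq_bigr => A _; congr (_ * _); apply: eq_bigr => i _.
by rewrite pE.
Qed.

(** Setting the absence weights of i and j to 0 encodes the event in the product, and the sum over
    all sets then factors into p_i p_j times ones. *)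
Lemma both_present (beta : R) (i j : 'I_n) : 0 <= beta ->
  (forall i, beta <= em_prob P i) -> i != j ->
  beta ^+ 2 <= \sum_(A : {set 'I_n}) em_law P A * ((i \in A) && (j \in A))%:R.
Proof.
move=> b0 bP ij.
pose q k := if (k == i) || (k == j) then 0 else 1 - em_prob P k.
have -> : \sum_(A : {set 'I_n}) em_law P A * ((i \in A) && (j \in A))%:R =
    \sum_(A : {set 'I_n}) \prod_k (if k \in A then em_prob P k else q k).
  apply: eq_bigr => A _; rewrite /em_law.
  have [iA|iA] := boolP (i \in A); last first.
    rewrite mulr0; symmetry; apply/eqP/prodf_eq0; exists i => //.
    by rewrite (negbTE iA) /q eqxx.
  have [jA|jA] := boolP (j \in A); last first.
    rewrite mulr0; symmetry; apply/eqP/prodf_eq0; exists j => //.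
    by rewrite (negbTE jA) /q eqxx orbT.
  rewrite mulr1; apply: eq_bigr => k _; rewrite /q.
  case: ifP => // kA; rewrite ifF //; apply/negP => /orP[] /eqP e;
    by rewrite e ?iA ?jA in kA.
rewrite -bigA_distr (bigD1 i) //= (bigD1 j) 1?eq_sym //= big1 => [|k /andP[ki kj]].
  by rewrite /q !eqxx orbT !addr0 mulr1 expr2 ler_pM.
by rewrite /q (negbTE ki) (negbTE kj) subrKC.
Qed.

Lemma spread_lower (beta : R) : 0 <= beta -> (forall i, beta <= em_prob P i) ->
  beta ^+ 2 * tau <= mean p n spread.
Proof.
move=> b0 bP; have mean0 : 0 <= mean p n spread.
  rewrite mean_spread; apply: sumr_ge0 => A _; rewrite mulr_ge0 ?em_law_ge0 //.
  have := spread_ge0 (fun i => if insub i is Some i' then i' \in A else false).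
  rewrite /spread; congr (0 <= Tr r (em_real P _) u).
  by apply/setP => i; rewrite inE valK.
(* If the extreme points coincide, then the width and hence tau vanish. *)
have [i12|i12] := eqVneq i1 i2.
  by rewrite /tau /W i12 subrr addr0 subrr mulr0.
rewrite mean_spread; pose j1 := Ordinal i1n; pose j2 := Ordinal i2n.
have j12 : j1 != j2 by apply: contra i12 => /eqP/(congr1 val)/= ->.
apply: le_trans (ler_wpM2r tau_ge0 (both_present b0 bP j12)) _.
rewrite mulr_suml; apply: ler_sum => A _; rewrite -mulrA ler_wpM2l ?em_law_ge0 //.
pose B i := if insub i is Some i' then i' \in A else false.
have BA : present B = A by apply/setP => i; rewrite inE /B valK.
rewrite -BA; case: andP => [[]|_]; last first.
  by rewrite mul0r; exact: spread_ge0.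
rewrite BA => A1 A2; rewrite mul1r -/(spread B) -BA -/(spread B).
have B1 : B i1 by rewrite /B (insubT (fun i => i < n)%N i1n).
have B2 : B i2 by rewrite /B (insubT (fun i => i < n)%N i2n).
have [a1 [a2 [_ _ max1 min2 ->]]] := spread_attained i1n B1.
rewrite /tau lerB ?min2 //.
by rewrite /m /W addrC subrK max1.
Qed.

Variables (mm : nat).
Hypothesis mm_gt0 : (0 < mm)%N.
Hypothesis mmt : d%:R * (8%:R / mm%:R) ^+ 2 / 2%:R * 2 ^+ d <= t ^+ r.

(** The interface between the program and the geometry: what is known of an output set, without
    reference to a store. *)
Definition represents (F : {fset point R d}) (A : nat -> bool) : Prop :=
  (forall v, v \in F -> exists i, [/\ (i < n)%N, A i & v = pt i]) /\
  (forall g i0, g \in full_grid d mm.+1 (8%:R / mm%:R) -> (i0 < n)%N -> A i0 ->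
     exists i, nearest d n A mu g i /\ pt i \in F).

Lemma represents_support F A i0 (w : nat -> R) : represents F A ->
  (i0 < n)%N -> A i0 -> (forall k, (k < d)%N -> `|w k| <= 2 ^+ d * W) ->
  exists i, [/\ (i < n)%N, A i, pt i \in F &
    \sum_(k < d) mu i0 k * w k <= \sum_(k < d) mu i k * w k + t ^+ r * W].
Proof.
move=> [_ near] i0n Ai0 wW.
have [g gG gP] := nearest_support mm_gt0 d_gt0 mu1 wW i0n Ai0.
have [i [ni Fi]] := near _ _ gG i0n Ai0; have := gP _ ni.
case: ni => lti Ai _ h; exists i; split => //.
under eq_bigr => k _ do rewrite mulrC.
under [X in _ <= X + _]eq_bigr => k _ do rewrite mulrC.
have : d%:R * (8%:R / mm%:R) ^+ 2 / 2%:R * (2 ^+ d * W) <= t ^+ r * W.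
  by rewrite mulrA ler_wpM2r.
lra.
Qed.

(** The set consists of present points, which gives the upper bound; at each of the two ends the
    nearest point found for c or - c loses at most t tau. *)
Lemma represents_spread F A : represents F A ->
  spread A - 2 * (t * tau) <= Tr r F u <= spread A.
Proof.
move=> rep; have [sub _] := rep; have /andP[t0 _] := t01.
have tt0 : 0 <= t * tau by rewrite mulr_ge0.
case: (pselect (exists i, (i < n)%N /\ A i)) => [[i [lti Ai]]|H]; last first.
  have A0 i : (i < n)%N -> ~~ A i by move=> lti; apply/negP => Ai; apply: H; exists i.
  have -> : F = fset0.
    apply/eqP; apply: contraT => /fset0Pn[v /sub[i [lti Ai _]]].
    by rewrite (negbTE (A0 i lti)) in Ai.
  by rewrite Tr0 spread0 // lexx sub0r oppr_le0 mulr_ge0.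
have [a1 [a2 [[l1 A1] [l2 A2] max1 min2 ->]]] := spread_attained lti Ai.
have [b1 [lb1 Ab1 Fb1 h1]] := represents_support rep l1 A1 cW.
have ncW k : (k < d)%N -> `|- c k| <= 2 ^+ d * W by rewrite normrN; exact: cW.
have [b2 [lb2 Ab2 Fb2 h2]] := represents_support rep l2 A2 ncW.
have F0 : F != fset0 by apply/fset0Pn; exists (pt b1).
have [v1 [v2 [/sub[e1 [le1 Ae1 ->]] /sub[e2 [le2 Ae2 ->]] max3 min3 ->]]] :=
  Tr_attained r u F0.
have {}h1 : root r (y a1) <= root r (y b1) + t * tau.
  by apply: root_y => //; have := ycE l1 lb1; lra.
have {}h2 : root r (y b2) <= root r (y a2) + t * tau.
  apply: root_y => //; have := ycE lb2 l2; move: h2.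
  have E j : \sum_(k < d) mu j k * - c k = - \sum_(k < d) mu j k * c k.
    by rewrite -sumrN; apply: eq_bigr => k _; rewrite mulrN.
  rewrite !E; lra.
have := max3 _ Fb1; have := min3 _ Fb2; have := max1 _ le1 Ae1; have := min2 _ le2 Ae2.
by rewrite -!/(y _) => ? ? ? ?; apply/andP; split; lra.
Qed.

(** The total error 7 t tau adds 5 from sampling and 2 from the nearest points; [spread_lower]
    converts tau into the expectation at the price of beta^2. *)
Lemma kernel_direction (beta eps : R) N (N_gt0 : (0 < N)%N) (l : seq (nat -> bool))
    (F : 'I_N -> {fset point R d}) :
  0 <= beta -> (forall i, beta <= em_prob P i) -> 7%:R * t <= eps * beta ^+ 2 ->
  0 <= eps ->
  size l = N -> concentrated p n hitting t l ->
  (forall j, represents (F j) (nth (fun=> false) l j)) ->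
  (1 - eps) * expectation (em_stochastic P) (fun A => Tr r A u)
    <= expectation (uniform_family N_gt0 F) (fun A => Tr r A u)
    <= (1 + eps) * expectation (em_stochastic P) (fun A => Tr r A u).
Proof.
move=> b0 bP t7 e0 szl conc rep.
set E := expectation (em_stochastic P) _.
have EE : E = mean p n spread by rewrite mean_spread.
have low := spread_lower b0 bP; rewrite -EE in low.
have := sum_spread conc; rewrite szl -EE (big_nth (fun=> false)) szl big_mkord ler_norml.
move=> /andP[s1 s2].
have Np : 0 < N%:R :> R by rewrite ltr0n.
rewrite /expectation /= -mulr_sumr.
set S := \sum_(j < N) spread _ in s1 s2.
set S' := \sum_(i < N) _.
have S1 : S' <= S by apply: ler_sum => j _; have /andP[] := represents_spread (rep j).
have S2 : S - N%:R * (2 * (t * tau)) <= S'.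
  have -> : N%:R * (2 * (t * tau)) = \sum_(j < N) 2 * (t * tau).
    by rewrite sumr_const card_ord -[RHS]mulr_natl.
  by rewrite -sumrB; apply: ler_sum => j _; have /andP[] := represents_spread (rep j).
have tE : 7%:R * (t * tau) <= eps * E.
  apply: (@le_trans _ _ (eps * (beta ^+ 2 * tau))).
    by rewrite mulrA [X in _ <= X]mulrA ler_wpM2r.
  by rewrite ler_wpM2l.
have tE' := ler_wpM2l (ltW Np) tE.
rewrite -(ler_pM2l Np) -[X in _ && X](ler_pM2l Np) !(mulVKf (lt0r_neq0 Np)).
by apply/andP; split; lra.
Qed.

End Direction.
End Estimate.
(** * The algorithm *)

Definition init_code : seq stmt :=
  [:: Do (IAdd 16 2 2); Do (IConst 21 0); Do (IAdd 19 7 5)].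

Definition program (d r K Km : nat) : seq stmt :=
  params_code d r K Km ++ (norm_code ++ (coin_code ++ (init_code ++
    (For 8 2 (sample_code d) ++ [:: Do (IConst 0 0); Do (IAdd 0 0 2)])))).

Definition program_time (d n l t N m1 : nat) : nat :=
  (l * 8 + t * 3 + 30 + (norm_time d n + ((N * (n * 8 + 6)
    + (N * (faces_time d n m1 + 8) + 7)).+3)))%N.

Section Program.
Variables (R : realType) (d n r K Km : nat) (P : existential_model R d n) (eps : R).

Definition input_pt (i : nat) : point R d := \row_k input_rmem P (row d 0 i k).

Definition input_prob (i : nat) : R := input_rmem P (i * d.+1 + d)%N.

Lemma input_ptE (i : 'I_n) : input_pt i = em_point P i.
Proof.
apply/rowP => k; rewrite mxE /input_rmem /row add0n divnMDl // modnMDl.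
have kd : (k < d.+1)%N by rewrite ltnS ltnW.
by rewrite (divn_small kd) (modn_small kd) addn0 !valK.
Qed.

Lemma input_probE (i : 'I_n) : input_prob i = em_prob P i.
Proof.
rewrite /input_prob /input_rmem divnMDl // modnMDl (divn_small (ltnSn d)) addn0.
by rewrite (modn_small (ltnSn d)) valK insubF // ltnn.
Qed.

Lemma input_prob01 i : (i < n)%N -> 0 <= input_prob i <= 1.
Proof.
by move=> lti; rewrite (input_probE (Ordinal lti)) em_prob_ge0 em_prob_le1.
Qed.

Hypotheses (eps_gt0 : 0 < eps) (Km_gt0 : (0 < Km)%N).

(** The parameters and the coordinates are computed before any coin is tossed, so [l], [t] and [mu]
    come before [Q] and [good]. What follows the coins is deterministic: on good realizations [Q]
    holds with certainty, and on others the trivial bound 0 is enough. *)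
Lemma run_program : exists (l t : nat) (mu : nat -> nat -> R),
  let N := (K * 4 ^ l * l.+1)%N in let mm := (Km * 2 ^ t)%N in
  [/\ [/\ 1 <= 2 ^+ l * eps, forall j, (j < l)%N -> 2 ^+ j * eps < 1,
          (2 ^ r) ^+ l <= 4 ^+ t :> R & forall j, (j < t)%N -> (4 ^ j < (2 ^ r) ^ l)%N],
      (0 < n)%N -> coordinates n input_pt mu &
   forall (Q : store R -> Prop) (good : seq (nat -> bool) -> bool),
     (forall acc s, size acc = N -> good acc -> ireg s 0 = N ->
        (forall j, (j < N)%N ->
           represents n input_pt mu mm (read_set d s j) (nth (fun=> false) acc j)
           /\ (imem s j.*2.+1 <= size (full_grid d mm.+1 (8%:R / mm%:R : R)))%N) -> Q s) ->
     forall T, (program_time d n l t N mm.+1 <= T)%N ->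
       nsamples input_prob n N [::] (fun acc => (good acc)%:R) <=
       run_prob Q T (program d r K Km) (input_store P eps)].
Proof.
have [l [t [h1 h2 h3 h4 rp]]] := @runs_params R d r K Km (input_store P eps) eps_gt0.
case: rp => tp [s1 [ev1 tple [f1 f4 f5 f26 [f2 f3 fr3 [fr1 fr4 fr10]]]]].
have fra1 := ev_frame ev1.
have f0 : ireg s1 0 = n by rewrite (frame_ireg fra1).
have m1 : rmem s1 = input_rmem P by rewrite (frame_rmem fra1).
set N := (K * 4 ^ l * l.+1)%N in f2 *; set mm := (Km * 2 ^ t)%N in f3 fr3 *.
have mm0 : (0 < mm)%N by rewrite muln_gt0 Km_gt0 expn_gt0.
have [tn [s2 [ev2 tnle [st2 lo2 co2]]]] := runs_norm f0 f1 f4 f5 fr1.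
have fra2 := ev_frame ev2.
pose mu := coordinate d n s2.
have lowE s i k : rmem s = rmem s2 -> (i < n)%N -> (k <= d)%N ->
    rmem s (row d 0 i k) = input_rmem P (row d 0 i k).
  move=> -> lti lk; rewrite lo2 ?m1 //.
  by have := row_end d lti; rewrite /row; lia.
have ptE s i : rmem s = rmem s2 -> (i < n)%N -> input_point d s i = input_pt i.
  by move=> sE lti; apply/rowP => k; rewrite !mxE lowE // ltnW.
exists l, t, mu; split => //.
  move=> /co2; rewrite /coordinates /mu.
  have -> : input_point d s1 = input_pt by apply/funext => i; rewrite /input_point m1.
  by [].
move=> Q good HQ T leT.
have e2 : ireg s2 2 = N by rewrite (frame_ireg fra2).
have e3 : ireg s2 3 = mm.+1 by rewrite (frame_ireg fra2).
have e26 : ireg s2 26 = 2%N by rewrite (frame_ireg fra2).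
have er3 : rreg s2 3 = 8%:R / mm%:R by rewrite (frame_rreg fra2).
have er4 : rreg s2 4 = 4%:R by rewrite (frame_rreg fra2).
have er10 : rreg s2 10 = 2%:R by rewrite (frame_rreg fra2).
have -> : T = (tp + (tn + ((N * (n * 8 + 6) +
   (T - tp - tn - (N * (n * 8 + 6)).+3)).+3)))%N.
  move: leT tple tnle; rewrite /program_time.
  by move: (N * (n * 8 + 6))%N (N * (_ + 8))%N (norm_time d n) => X Y Z; lia.
set T3 := (T - _ - _ - _)%N.
have T3le : (N * (faces_time d n mm.+1 + 8) + 7 <= T3)%N.
  move: leT tple tnle; rewrite /T3 /program_time.
  by move: (N * (n * 8 + 6))%N (N * (_ + 8))%N (norm_time d n) => X Y Z; lia.
rewrite /program (ev_sound ev1) (ev_sound ev2).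
(* The probabilities are reread from memory, where they are known to agree with the input for
   indices below n; no others are tossed. *)
have -> : nsamples input_prob n N [::] (fun acc => (good acc)%:R) =
          nsamples (fun i => rmem s2 (i * d.+1 + d)%N) n N [::] (fun acc => (good acc)%:R : R).
  have flipsE js B f : (forall i, i \in js -> (i < n)%N) ->
      flips input_prob js B f = flips (fun i => rmem s2 (i * d.+1 + d)%N) js B f.
    elim: js B => //= i js IH B H.
    have lti : (i < n)%N by apply: H; rewrite mem_head.
    rewrite !IH => [|j jjs|j jjs]; try by apply: H; rewrite inE jjs orbT.
    by have := lowE s2 i d erefl lti (leqnn d); rewrite /row add0n /input_prob => ->.
  elim: {1 2}N [::] => //= N' IH acc; rewrite flipsE; last by move=> i; rewrite mem_iota.
  by congr flips; apply/funext => A; rewrite IH.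
apply: (run_coins (s0 := s2)) => //; try by case: st2.
  move=> i lti; have := lowE s2 i d erefl lti (leqnn d).
  by rewrite /row add0n => ->; exact: input_prob01.
move=> acc s3 szacc [ie re me] flg.
case gacc: (good acc); last exact: run_prob_ge0.
have st3 : std d n s3.
  by case: st2 => *; split; rewrite ?ie ?re.
have T3E : T3 = ((N * (faces_time d n mm.+1 + 8) + 4)
    + (T3 - (N * (faces_time d n mm.+1 + 8) + 4) - 3)).+3 by lia.
set T4 := (T3 - _ - _)%N in T3E.
rewrite T3E !run_do; set s4 := exec _ _.
have st4 : std d n s4 by case: st3 => *; split; comp.
have mE4 : rmem s4 = rmem s2 by rewrite /s4; comp.
have imE4 : imem s4 = imem s3 by [].
have mu1 i k : (i < n)%N -> (k < d)%N -> `|coordinate d n s4 i k| <= 1.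
  move=> lti ltk; have [e [_ H _]] := co2 (leq_ltn_trans (leq0n i) lti).
  by rewrite /coordinate mE4; exact: (H _ (Ordinal ltk)).
have inv : sample_inv d n mm.+1 (8%:R / mm%:R) N (fun j => nth (fun=> false) acc j) s4 0 s4.
  split => //; rewrite /s4; comp; rewrite ?ie ?re //.
  - by rewrite e2 mul0n addn0.
  - by rewrite (std7 st2) (std5 st2).
have flagP j i : (j < N)%N -> (i < n)%N ->
    imem s4 (N + N + j * n + i)%N = nth (fun=> false) acc j i.
  by move=> jN lti; rewrite imE4; apply: flg; rewrite ?szacc.
have s4_2 : ireg s4 2 = N by rewrite /s4; comp; rewrite ie.
have [t5 [s5 [ev5 t5le [s5_0 cov]]]] :=
  runs_output flagP mu1 (@step_grid R mm mm0) inv s4_2.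
set T5 := (_ + T4)%N.
have -> : T5 = (t5 + (T5 - t5))%N by rewrite /T5; lia.
rewrite -[X in run_prob _ _ X _]cats0 (ev_sound ev5) /=.
have run_nil T' : run_prob Q T' [::] s5 = `[< Q s5 >]%:R by case: T'.
rewrite run_nil; suff Qs : Q s5 by rewrite (asboolT Qs).
apply: (HQ acc) => // j jN; have [len sub near] := cov j jN; split; last exact: len.
have dE i g : sqdist d (coordinate d n s4) g i = sqdist d mu g i.
  by apply: eq_bigr => k _; rewrite /mu /coordinate mE4.
split.
  move=> v /sub[i [lti Ai ->]]; exists i; split => //; exact: ptE.
move=> g i0 gG i0n Ai0; have [i [[lti Ai nn] Fi]] := near g i0 gG i0n Ai0.
exists i; split; last by rewrite -(ptE s4).
by split => // i' lti' Ai'; rewrite -!dE; exact: nn.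
Qed.

End Program.
(** * Sizes and running time *)

Section Sizes.
Variables (R : realType) (d m1 : nat) (h : R).
Hypothesis m1_gt0 : (0 < m1)%N.

Lemma size_grid j0 js : size (grid m1 h j0 js) = (\prod_(j <- js) cnt m1 j0 j)%N.
Proof.
elim: js => [|j js IH]; first by rewrite big_nil.
rewrite big_cons -IH /= size_flatten /shape -map_comp.
rewrite (eq_map (g := fun=> size (grid m1 h j0 js))); last first.
  by move=> a /=; rewrite size_map.
elim: (cnt m1 j0 j) 0%N => [|c IHc] a; first by rewrite mul0n.
by rewrite /= IHc mulSn.
Qed.

(** A round adds 8 and a loop adds 2; as all counts are positive, 10 per axis and node absorbs
    both. *)
Lemma nest_time_le j0 js tau :
  (nest_time m1 j0 js tau <= (\prod_(j <- js) cnt m1 j0 j) * (tau + 10 * size js))%N.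
Proof.
elim: js => [|j js IH] /=; first by rewrite big_nil; lia.
rewrite big_cons; have c0 : (0 < cnt m1 j0 j)%N by rewrite /cnt; case: ifP.
have p0 : (0 < \prod_(j <- js) cnt m1 j0 j)%N.
  by rewrite prodn_gt0 // => i; rewrite /cnt; case: ifP.
move: IH c0 p0; move: (\prod_(j <- js) _)%N (cnt _ _ _) (nest_time _ _ _ _) => p c T.
nia.
Qed.

Lemma prod_cnt j0 : (j0 < d)%N ->
  (\prod_(j <- iota 0 d) cnt m1 j0 j = 2 * m1 ^ d.-1)%N.
Proof.
move=> j0d; rewrite -[d in iota 0 d]subn0 -/(index_iota 0 d) big_mkord.
rewrite (bigD1 (Ordinal j0d)) //= /cnt eqxx; congr (_ * _)%N.
rewrite (eq_bigr (fun=> m1)) => [|j ne]; last first.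
  by rewrite ifF //; apply/negP => /eqP e; move/eqP: ne; apply; apply: val_inj.
by rewrite prod_nat_const cardC1 card_ord.
Qed.

Lemma size_full_grid : size (full_grid d m1 h) = (d * (2 * m1 ^ d.-1))%N.
Proof.
rewrite /full_grid size_flatten /shape -map_comp sumnE big_map.
rewrite big_seq (eq_bigr (fun=> 2 * m1 ^ d.-1)%N); last first.
  by move=> j; rewrite mem_iota => /andP[_ jd]; rewrite /= size_grid prod_cnt.
by rewrite -big_seq big_const_seq count_predT size_iota iter_addn_0 mulnC.
Qed.

Lemma faces_time_le n : (faces_time d n m1 <=
  d * (2 * m1 ^ d.-1) * (leaf_time d n + 10 * d))%N.
Proof.
rewrite /faces_time big_seq.
apply: (@leq_trans (\sum_(j0 <- iota 0 d) (2 * m1 ^ d.-1) * (leaf_time d n + 10 * d))).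
  rewrite [X in (_ <= X)%N]big_seq; apply: leq_sum => j.
  rewrite mem_iota => /andP[_ jd]; rewrite -(prod_cnt jd).
  by apply: leq_trans (nest_time_le _ _ _) _; rewrite size_iota.
by rewrite big_const_seq count_predT size_iota iter_addn_0 mulnC mulnA.
Qed.


End Sizes.

Lemma program_time_le d n r l t N m1 : (0 < m1)%N -> (t <= r * l + 1)%N ->
  (program_time d n l t N m1 <= maxn 1 n *
    ((8 + 3 * r) * l.+1 + (15 * d * d + 47 * d + 63) + 22 * N
     + (25 * d + 31) * (N * (d * (2 * m1 ^ d.-1)))))%N.
Proof.
move=> m10 tl; have := faces_time_le d m10 n; rewrite /program_time /norm_time /leaf_time.
move: (faces_time _ _ _) (d * (2 * _))%N => f g fle.
set n' := maxn 1 n; have n1 : (n <= n')%N by rewrite leq_maxr.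
have n2 : (0 < n')%N by rewrite leq_max.
have fle' : (f <= g * (n' * (25 * d + 31)))%N.
  apply: leq_trans fle _; rewrite leq_mul2l; apply/orP; right; nia.
have Nf : (N * f <= n' * ((25 * d + 31) * (N * g)))%N by nia.
have k1 : (N * (n * 8 + 6) <= n' * (14 * N))%N by nia.
have k2 : (l * 8 + t * 3 <= n' * ((8 + 3 * r) * l.+1))%N by nia.
have k3 : (n * (d * 9 + 23) + d * 6 + 14 <= n' * (15 * d + 37))%N by nia.
have k4 : (d * (n * (d * 9 + 23) + d * 6 + 14).+2 <= n' * (15 * d * d + 39 * d))%N by nia.
have k5 : (n * (d * 8 + 5) <= n' * (8 * d + 5))%N by nia.
have k6 : (N * 8 <= n' * (8 * N))%N by nia.
rewrite mulnDr; move: Nf k1 k2 k4 k5 k6; nia.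
Qed.

Lemma t_le r l t : (forall j, (j < t)%N -> (4 ^ j < (2 ^ r) ^ l)%N) -> (t <= r * l + 1)%N.
Proof.
case: t => // t /(_ t (ltnSn _)).
by rewrite -[4%N]/(2 ^ 2)%N -!expnM ltn_exp2l // mulnC; lia.
Qed.

(** * Parameters in terms of 1 / eps *)

Section Bounds.
Variables (R : realType) (eps : R).
Hypothesis eps_gt0 : 0 < eps.
Let x : R := Num.max 1 eps^-1.
(** The exponents in the theorem are multiples of 1/2, so natural powers of this square root express
    all bounds. *)
Let s : R := x `^ 2^-1.
Let Lx : R := 1 + ln x.

Lemma x_ge1 : 1 <= x.
Proof. by rewrite le_max lexx. Qed.

Lemma s_sqr : s ^+ 2 = x.
Proof.
have x0 : 0 <= x by apply: le_trans x_ge1.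
by rewrite -powR_mulrn ?powR_ge0 // -powRrM mulVf ?powRr1 // pnatr_eq0.
Qed.

Lemma s_ge1 : 1 <= s.
Proof.
by rewrite -(@ler_pXn2r _ 2) ?nnegrE ?powR_ge0 ?ler01 // expr1n s_sqr x_ge1.
Qed.

Lemma Lx_ge1 : 1 <= Lx.
Proof. by rewrite lerDl ln_ge0 // x_ge1. Qed.

Lemma powR_half (a : nat) : x `^ (a%:R / 2) = s ^+ a.
Proof. by rewrite mulrC powRrM powR_mulrn // powR_ge0. Qed.

Variables (r l t : nat).
Hypothesis l_min : forall j, (j < l)%N -> 2 ^+ j * eps < 1.
Hypothesis t_min : forall j, (j < t)%N -> (4 ^ j < (2 ^ r) ^ l)%N.

(** One doubling earlier the value was still below 1; l = 0 is covered by x >= 1. *)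
Lemma exp2l_le : 2 ^+ l <= 2 * x.
Proof.
have x1 := x_ge1; case: l l_min => [|l'] H; first by rewrite expr0; lra.
rewrite exprS ler_wpM2l //; have := H l' (ltnSn _).
by rewrite -ltr_pdivlMr // mul1r => /ltW h; rewrite le_max h orbT.
Qed.

(** The previous power 2^(l - 1) is at most x, and ln 2 >= 1 / 2. *)
Lemma l_le : l.+1%:R <= 2 * Lx.
Proof.
have := exp2l_le; have L1 := Lx_ge1; case: l => [|l'] h; first by lra.
rewrite exprS ler_pM2l // in h.
have h2 : 2^-1 <= ln 2 :> R.
  rewrite -ler_expR lnK ?posrE //.
  have := expR_ge1Dx (- 2^-1 : R); rewrite expRN => e1.
  have e0 := expR_gt0 (2^-1 : R).
  have : (1 - 2^-1) * sequences.expR (2^-1 : R) <= 1 by rewrite -ler_pdivlMr // mul1r.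
  lra.
have : ln (2 ^+ l') <= ln x :> R.
  by rewrite ler_ln ?posrE ?exprn_gt0 // (lt_le_trans _ x_ge1).
rewrite lnXn // -[_ *+ l']mulr_natr => h3.
have : 2^-1 * l'%:R <= ln 2 * l'%:R :> R by rewrite ler_wpM2r.
by rewrite -[l'.+2]addn2 natrD /Lx; lra.
Qed.

(** Compared after squaring: 4^(t - 1) < 2^(r l) <= (2 x)^r, and x = s^2. *)
Lemma exp2t_le : 2 ^+ t <= 2 ^+ r.+1 * s ^+ r.
Proof.
have s1 := s_ge1; have s0 : 0 <= s by apply: le_trans s1.
rewrite -(@ler_pXn2r _ 2) ?nnegrE ?mulr_ge0 ?exprn_ge0 // exprMn -!exprM.
rewrite [(t * 2)%N]mulnC [(r.+1 * 2)%N]mulnC [(r * 2)%N]mulnC !exprM s_sqr.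
have x1 := x_ge1; have x0 : 0 <= x by apply: le_trans x1.
have xr : 1 <= x ^+ r by rewrite exprn_ege1.
case: t t_min => [|t'] H.
  rewrite expr0 -[leLHS]mulr1 ler_pM // exprn_ege1 // -natrX ler1n //.
rewrite (exprS (2 ^+ 2) t') (exprS (2 ^+ 2) r) -mulrA ler_wpM2l ?exprn_ge0 //.
have : (4 ^ t')%:R <= ((2 ^ r) ^ l)%:R :> R by rewrite ler_nat ltnW // H.
rewrite (_ : (4 ^ t')%:R = (2 ^+ 2) ^+ t' :> R); last by rewrite -natrX natrX.
move=> /le_trans; apply; rewrite -expnM mulnC expnM !natrX.
apply: (@le_trans _ _ ((2 * x) ^+ r)); first by rewrite lerXn2r ?nnegrE ?exprn_ge0 ?mulr_ge0 // exp2l_le.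
by rewrite exprMn ler_wpM2r ?exprn_ge0 // lerXn2r ?nnegrE ?exprn_ge0 // expr2; lra.
Qed.

End Bounds.

(** * Choice of the constants *)

Section Constants.
Variables (R : realType) (d r kap : nat).
Hypotheses (d_gt0 : (0 < d)%N) (kap_gt0 : (0 < kap)%N).

Let accuracy l : R := (kap * 2 ^ l)%:R^-1.
Let levels l := ((2 * d + 1) * (kap * 2 ^ l) ^ r)%N.

Lemma accuracy_gt0 l : 0 < accuracy l.
Proof. by rewrite invr_gt0 ltr0n muln_gt0 kap_gt0 expn_gt0. Qed.

Lemma accuracy_itv l : 0 <= accuracy l <= 1.
Proof.
rewrite ltW ?accuracy_gt0 //= invf_le1 ?ltr0n ?ler1n ?muln_gt0 ?kap_gt0 ?expn_gt0 //.
Qed.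

Lemma levels_gt0 l : (0 < levels l)%N.
Proof. by rewrite muln_gt0 addn1 /= expn_gt0 muln_gt0 kap_gt0 expn_gt0. Qed.

Lemma levels_accuracy l : (2 * d + 1)%:R / (levels l)%:R <= accuracy l ^+ r.
Proof.
rewrite /levels /accuracy natrM invfM mulrA mulfV ?mul1r; last first.
  by rewrite pnatr_eq0 addn1.
by rewrite natrX exprVn.
Qed.

Let fineness := (32 * d * 2 ^ d * kap ^ r)%N.

Lemma fineness_gt0 : (0 < fineness)%N.
Proof. by rewrite !muln_gt0 d_gt0 !expn_gt0 kap_gt0. Qed.

(** With h = 8 / (fineness 2^t) the left side is 32 d 2^d / (fineness^2 4^t). One factor [fineness]
    pays for 32 d 2^d kap^r, and 4^t pays for 2^(r l). *)
Lemma fineness_accuracy l t : (2 ^ r) ^+ l <= 4 ^+ t :> R ->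
  d%:R * (8%:R / (fineness * 2 ^ t)%:R) ^+ 2 / 2%:R * 2 ^+ d <= accuracy l ^+ r.
Proof.
move=> lt; rewrite /accuracy exprVn.
have mp : 0 < (fineness * 2 ^ t)%:R :> R by rewrite ltr0n muln_gt0 fineness_gt0 expn_gt0.
have kp : 0 < (kap * 2 ^ l)%:R ^+ r :> R.
  by rewrite exprn_gt0 // ltr0n muln_gt0 kap_gt0 expn_gt0.
rewrite -[leRHS]mul1r ler_pdivlMr //.
have -> : d%:R * (8%:R / (fineness * 2 ^ t)%:R) ^+ 2 / 2%:R * 2 ^+ d * (kap * 2 ^ l)%:R ^+ r
  = (32%:R * d%:R * 2 ^+ d * (kap * 2 ^ l)%:R ^+ r) / (fineness * 2 ^ t)%:R ^+ 2 :> R.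
  move: (fineness * 2 ^ t)%:R mp ((kap * 2 ^ l)%:R ^+ r) => M mp D.
  by field; rewrite gt_eqF.
rewrite ler_pdivrMr ?exprn_gt0 // mul1r -!natrX -!natrM ler_nat.
have {}lt : ((2 ^ r) ^ l <= 4 ^ t)%N by rewrite -(ler_nat R) !natrX.
have e : ((2 ^ l) ^ r = (2 ^ r) ^ l)%N by rewrite -!expnM mulnC.
have e4 : ((2 ^ t) ^ 2 = 4 ^ t)%N by rewrite -[4%N]/(2 ^ 2)%N -!expnM mulnC.
rewrite expnMn e [((_ * 2 ^ t) ^ 2)%N]expnMn e4 mulnA leq_mul //.
by rewrite -[leqLHS]muln1 expnS expn1 leq_mul // fineness_gt0.
Qed.

(** The exponent is exactly K1 (l + 1), and exp(K1) >= K1. Of the l + 1 factors K1, one pays for the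
    constant 2 c0^(d+1) and for delta, and each of the others for a factor 2^(r (d+1)) in the number
    of events, which is at most (c0 2^(r l))^(d+1). *)
Lemma failure_bound (K1 l : nat) (delta : R) : 0 < delta ->
  let c0 := (2 * d.+1 * 2 ^ d * (2 * d + 1) * kap ^ r + 1)%N in
  (2 * c0 ^ d.+1)%:R / delta <= K1%:R -> (2 ^ (r * d.+1) <= K1)%N ->
  (2 * #|{: direction d (2 ^ d) (levels l) * 'I_(2 * (d * (2 ^ d * levels l))).+1}|)%:R
    * sequences.expR (- ((8 * kap ^ 2 * K1 * 4 ^ l * l.+1)%:R * accuracy l ^+ 2 / 8%:R))
  <= delta.
Proof.
move=> delta0 c0 K1a K1b.
have lev : (levels l = (2 * d + 1) * kap ^ r * (2 ^ r) ^ l)%N.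
  by rewrite /levels expnMn -!expnM [(l * r)%N]mulnC mulnA.
have q0 : (0 < (2 ^ r) ^ l)%N by rewrite -expnM expn_gt0.
have card_le : (#|{: direction d (2 ^ d) (levels l) * 'I_(2 * (d * (2 ^ d * levels l))).+1}|
    <= (c0 * (2 ^ r) ^ l) ^ d.+1)%N.
  have b1 : ((2 * 2 ^ d * levels l).+1 <= c0 * (2 ^ r) ^ l)%N.
    rewrite /c0 lev; move: (2 ^ d)%N (kap ^ r)%N ((2 ^ r) ^ l)%N q0 => a b q q0; nia.
  have b2 : ((2 * (d * (2 ^ d * levels l))).+1 <= c0 * (2 ^ r) ^ l)%N.
    rewrite /c0 lev; move: (2 ^ d)%N (kap ^ r)%N ((2 ^ r) ^ l)%N q0 => a b q q0; nia.
  by rewrite card_prod card_ffun !card_ord expnS mulnC leq_mul // leq_exp2r.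
have expo : (8 * kap ^ 2 * K1 * 4 ^ l * l.+1)%:R * accuracy l ^+ 2 / 8%:R = l.+1%:R * K1%:R :> R.
  have k0 : kap%:R != 0 :> R by rewrite pnatr_eq0 -lt0n.
  have l0 : 2 ^+ l != 0 :> R by rewrite expf_neq0 // pnatr_eq0.
  have e4 : (4 ^ l)%:R = (2 ^+ l) ^+ 2 :> R.
    by rewrite -exprM mulnC exprM -!natrX -expnM natrX -natrX.
  rewrite /accuracy !natrM e4 !natrX; field.
  by rewrite k0 l0.
rewrite expo expRN expRM_natl.
have K1e : K1%:R <= sequences.expR K1%:R :> R.
  by apply: le_trans (expR_ge1Dx _); rewrite lerDr.
have K1p : 0 < K1%:R :> R by rewrite ltr0n (leq_trans _ K1b) // expn_gt0.
have ep : 0 < sequences.expR K1%:R :> R by rewrite expR_gt0.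
rewrite ler_pdivrMr ?exprn_gt0 //.
apply: (@le_trans _ _ (delta * (K1%:R ^+ l.+1))); last first.
  by rewrite ler_pM2l // lerXn2r ?nnegrE ?ler0n // ltW.
rewrite exprS mulrA; rewrite ler_pdivrMr // in K1a.
apply: (@le_trans _ _ ((2 * c0 ^ d.+1)%:R * ((2 ^ (r * d.+1)) ^ l)%:R)).
  rewrite -natrM ler_nat -mulnA leq_mul2l /= (leq_trans card_le) // expnMn leq_mul //.
  by rewrite -!expnM leq_exp2l //; lia.
apply: ler_pM => //; first by rewrite mulrC.
by rewrite natrX lerXn2r ?nnegrE ?ler0n // ler_nat.
Qed.

End Constants.

(** * From represented realizations to a kernel *)

Section Kernel.
Variables (R : realType) (d n r : nat) (P : existential_model R d n).
Hypotheses (d_gt0 : (0 < d)%N) (r_gt0 : (0 < r)%N).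

Lemma represented_kernel (pt : nat -> point R d) (mu : nat -> nat -> R)
    (p : nat -> R) (t beta eps : R) (G mm N : nat) (N_gt0 : (0 < N)%N)
    (l : seq (nat -> bool)) (F : 'I_N -> {fset point R d}) :
  (forall i : 'I_n, pt i = em_point P i) -> ((0 < n)%N -> coordinates n pt mu) ->
  (forall i : 'I_n, p i = em_prob P i) ->
  0 <= t <= 1 -> (0 < G)%N -> (2 * d + 1)%:R / G%:R <= t ^+ r ->
  (0 < mm)%N -> d%:R * (8%:R / mm%:R) ^+ 2 / 2%:R * 2 ^+ d <= t ^+ r ->
  0 <= beta -> (forall i, beta <= em_prob P i) ->
  7%:R * t <= eps * beta ^+ 2 -> 0 <= eps ->
  size l = N -> concentrated p n (@hitting R d n mu G) t l ->
  (forall j, represents n pt mu mm (F j) (nth (fun=> false) l j)) ->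
  fpow_kernel eps r P (uniform_family N_gt0 F).
Proof.
move=> ptE co pE t01 G0 Gt mm0 mmt b0 bP t7 e0 szl conc rep u pol.
have ground v : v \in ground_set (uniform_family N_gt0 F) -> 0 <= dot u v.
  move=> /bigfcupP[j _ /= /(proj1 (rep j))[i [lti _ ->]]].
  by rewrite (ptE (Ordinal lti)); exact: pol.
have [n0|n0] := posnP n; last first.
  have [i1 [i2 [c /= [[i1n i2n] m0 yP ycE cW]]]] := width_data n0 ptE (co n0) pol.
  by have /andP[] := kernel_direction d_gt0 r_gt0 ptE (co n0) i1n i2n m0 yP ycE cW
    t01 G0 Gt pE mm0 mmt N_gt0 b0 bP t7 e0 szl conc rep.
(* Without points every set is empty and both expectations vanish. *)
have E0 : expectation (em_stochastic P) (fun A => Tr r A u) = 0.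
  apply: big1 => A _; rewrite /= (_ : em_real P A = fset0) ?Tr0 ?mulr0 //.
  apply/eqP; apply: contraT => /fset0Pn[v /imfsetP[i _ _]].
  by have := leq_trans (ltn_ord i) (eq_leq n0).
have F0 : expectation (uniform_family N_gt0 F) (fun A => Tr r A u) = 0.
  apply: big1 => j _; rewrite /= (_ : F j = fset0) ?Tr0 ?mulr0 //.
  apply/eqP; apply: contraT => /fset0Pn[v /(proj1 (rep j))[i [lti _ _]]].
  by rewrite n0 in lti.
by split => //; rewrite E0 F0 mulr0.
Qed.

End Kernel.

Lemma card_read_set (R : realType) d (s : store R) j :
  (#|` read_set d s j| <= imem s j.*2.+1)%N.
Proof.
rewrite /read_set card_fseq; apply: leq_trans (size_undup _) _.
by rewrite size_map size_iota.
Qed.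

Lemma card_ground_set (R : realType) d N (N_gt0 : (0 < N)%N)
    (F : 'I_N -> {fset point R d}) (g : nat) : (forall j, #|` F j| <= g)%N ->
  (#|` ground_set (uniform_family N_gt0 F)| <= N * g)%N.
Proof.
move=> Fg; rewrite /ground_set /= -[N in (N * g)%N]card_ord -sum_nat_const.
elim/big_rec2: _ => [|j y A _ IH]; first by rewrite cardfs0.
by apply: leq_trans (leq_add (Fg j) IH); rewrite cardfsU leq_subr.
Qed.

Theorem mainTheorem16 (R : realType) (d r : nat) (beta delta : R)
    (d_gt0 : (0 < d)%N) (r_gt0 : (0 < r)%N)
    (beta_gt0 : 0 < beta) (delta_gt0 : 0 < delta) :
  exists (prog : seq stmt) (C : R) (k : nat),
  forall (n : nat) (P : existential_model R d n) (eps : R),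
    0 < eps ->
    (forall i, beta <= em_prob P i) ->
    let e : R := r%:R * d%:R - r%:R in
    exists T : nat,
      [/\ T%:R <= (maxn 1 n)%:R * polylog_bound C k ((e + 4) / 2) eps,
          run_prob (fun=> True) T prog (input_store P eps) = 1 &
          1 - delta <= run_prob
            (fun s => exists (N : nat) (N_gt0 : (0 < N)%N)
                        (F : 'I_N -> {fset point R d}),
               [/\ outputs s F,
                   fpow_kernel eps r P (uniform_family N_gt0 F),
                   #|` ground_set (uniform_family N_gt0 F)|%:R
                     <= polylog_bound C k (e + 2) eps,
                   N%:R <= polylog_bound C k ((e + 4) / 2) eps &
                   forall j, #|` F j|%:R <= polylog_bound C 0 (e / 2) eps])
            T prog (input_store P eps)].
Proof.
(* Makes 7 t <= eps beta^2 for the accuracy t = 1 / (kap 2^l), as 2^l eps >= 1. *)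
pose kap := (Num.truncn (7%:R / beta ^+ 2)).+1.
pose c0 := (2 * d.+1 * 2 ^ d * (2 * d + 1) * kap ^ r + 1)%N.
(* One summand for each of the two requirements of [failure_bound]. *)
pose K1 := ((Num.truncn ((2 * c0 ^ d.+1)%:R / delta)).+1 + 2 ^ (r * d.+1))%N.
pose K := (8 * kap ^ 2 * K1)%N.
pose Km := (32 * d * 2 ^ d * kap ^ r)%N.
pose cg := (2 * d * (2 * Km * 2 ^ r.+1) ^ d.-1)%N.
pose w := (25 * d + 31)%N.
pose cT := (2 * (8 + 3 * r) + (15 * d * d + 47 * d + 63) + 22 * (8 * K) + w * (8 * K * cg))%N.
pose C := (cT + cg + 8 * K + 8 * K * cg)%N.
have [C1 C2 C3 C4] : [/\ (cT <= C)%N, (cg <= C)%N, (8 * K <= C)%N & (8 * K * cg <= C)%N].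
  have aux a b c1 c2 : [/\ (a <= a + b + c1 + c2)%N, (b <= a + b + c1 + c2)%N,
     (c1 <= a + b + c1 + c2)%N & (c2 <= a + b + c1 + c2)%N] by split; lia.
  exact: aux.
have kap0 : (0 < kap)%N by [].
have Km0 : (0 < Km)%N by exact: fineness_gt0.
(* The logarithm has exponent 1: N contains l + 1 once, and the number of nodes contains no
   logarithm. *)
exists (program d r K Km), C%:R, 1%N => n P eps eps0 bP e.
have [l [t [mu [[lq lmin tq tmin] co runs]]]] := run_program r K P eps0 Km0.
pose N := (K * 4 ^ l * l.+1)%N; pose mm := (Km * 2 ^ t)%N.
rewrite -/N -/mm in runs.
have N0 : (0 < N)%N.
  have K10 : (0 < K1)%N by rewrite /K1 addSn.
  by rewrite /N /K !muln_gt0 !expn_gt0 K10 kap0.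
have mm0 : (0 < mm)%N by rewrite muln_gt0 Km0 expn_gt0.
pose T := program_time d n l t N mm.+1.
pose g := (d * (2 * mm.+1 ^ d.-1))%N.
set x := Num.max 1 eps^-1; pose s := x `^ 2^-1; pose Lx := 1 + ln x.
pose e' := (r * d.-1)%N.
have eE : e = e'%:R.
  by rewrite /e /e' -natrM -natrB ?leq_pmulr // -subn1 mulnBr muln1.
have s1 : 1 <= s := s_ge1 eps; have L1 : 1 <= Lx := Lx_ge1 eps.
have sx : s ^+ 2 = x := s_sqr eps.
have s0 : 0 <= s by apply: le_trans s1.
have p4 : x `^ ((e + 4) / 2) = s ^+ e' * s ^+ 4.
  by rewrite eE -natrD powR_half exprD.
have p2 : x `^ (e + 2) = s ^+ e' * (s ^+ e' * s ^+ 4).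
  rewrite eE (_ : e'%:R + 2 = (e' + (e' + 4))%:R / 2 :> R); last by rewrite !natrD; field.
  by rewrite powR_half !exprD.
have p0 : x `^ (e / 2) = s ^+ e' by rewrite eE powR_half.
have se1 : 1 <= s ^+ e' by rewrite exprn_ege1.
have s41 : 1 <= s ^+ 4 by rewrite exprn_ege1.
have gle : g%:R <= cg%:R * s ^+ e'.
  have h1 : (2 : R) ^+ t <= 2 ^+ r.+1 * s ^+ r := exp2t_le eps0 lmin tmin.
  have h2 : (mm.+1 ^ d.-1 <= (2 * Km * 2 ^ t) ^ d.-1)%N.
    by case: (d.-1) => // d'; rewrite leq_exp2r //; move: mm0; rewrite /mm; lia.
  apply: (@le_trans _ _ (2 * d * (2 * Km * 2 ^ t) ^ d.-1)%:R).
    by rewrite ler_nat /g mulnCA mulnA leq_mul2l h2 orbT.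
  rewrite /cg natrM [X in _ <= X * _]natrM -mulrA ler_wpM2l ?ler0n //.
  rewrite /e' exprM natrX natrX -exprMn lerXn2r ?nnegrE ?mulr_ge0 ?ler0n ?exprn_ge0 //.
  by rewrite natrM natrX [X in _ <= X * _]natrM natrX -mulrA ler_wpM2l ?ler0n.
have Nle : N%:R <= (8 * K)%:R * (s ^+ 4 * Lx).
  have h1 : (2 : R) ^+ l <= 2 * x := exp2l_le eps0 lmin.
  have h2 : l.+1%:R <= 2 * Lx := l_le eps0 lmin.
  have e4 : (4 ^ l)%:R = (2 ^+ l) ^+ 2 :> R.
    by rewrite -exprM mulnC exprM -!natrX -expnM natrX -natrX.
  rewrite /N (natrM R (K * 4 ^ l)) (natrM R K) e4 -(_ : x ^+ 2 = s ^+ 4); last by rewrite -sx -exprM.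
  have h3 : (2 ^+ l) ^+ 2 <= (2 * x) ^+ 2 :> R.
    by rewrite lerXn2r ?nnegrE ?exprn_ge0 ?mulr_ge0 // (le_trans _ (x_ge1 eps)).
  apply: (@le_trans _ _ (K%:R * (2 * x) ^+ 2 * (2 * Lx))).
    apply: ler_pM; [by rewrite mulr_ge0 ?ler0n ?sqr_ge0|by rewrite ler0n| |exact: h2].
    by rewrite ler_wpM2l ?ler0n.
  by rewrite exprMn [X in _ <= X * _]natrM le_eqVlt; apply/orP; left; apply/eqP; ring.
have NG : (N * g)%:R <= (8 * K * cg)%:R * (s ^+ e' * s ^+ 4 * Lx).
  rewrite natrM; apply: le_trans (ler_pM _ _ Nle gle) _; rewrite ?ler0n //.
  by rewrite [(8 * K * cg)%:R]natrM le_eqVlt; apply/orP; left; apply/eqP; ring.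
have Z1 : 1 <= s ^+ e' * s ^+ 4 * Lx.
  have a1 : 1 <= s ^+ e' * s ^+ 4 by rewrite -[X in X <= _]mulr1 ler_pM.
  by rewrite -[X in X <= _]mulr1 ler_pM.
have LZ : Lx <= s ^+ e' * s ^+ 4 * Lx.
  rewrite -[X in X <= _]mul1r ler_wpM2r ?(le_trans _ L1) //.
  by rewrite -[X in X <= _]mulr1 ler_pM.
have S4Z : s ^+ 4 * Lx <= s ^+ e' * s ^+ 4 * Lx.
  rewrite ler_wpM2r ?(le_trans _ L1) // -[X in X <= _]mul1r ler_wpM2r //.
  by rewrite exprn_ge0.
set Z := s ^+ e' * s ^+ 4 * Lx in NG Z1 LZ S4Z.
have Z0 : 0 <= Z by apply: le_trans Z1.
have CZ a : (a <= C)%N -> a%:R * Z <= polylog_bound C%:R 1 ((e + 4) / 2) eps.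
  move=> aC; rewrite /polylog_bound -/x p4 expr1 -/Lx -mulrA -[_ * Lx]/Z.
  by rewrite ler_wpM2r // ler_nat.
have NleZ : N%:R <= (8 * K)%:R * Z.
  by apply: le_trans Nle _; rewrite ler_wpM2l ?ler0n.
have Tle : T%:R <= (maxn 1 n)%:R * (cT%:R * Z).
  have := program_time_le d n N (ltn0Sn mm) (t_le tmin).
  rewrite -/T -/g -/w -(ler_nat R) => /le_trans; apply; rewrite natrM ler_wpM2l ?ler0n //.
  have l1 : l.+1%:R <= 2 * Z.
    by apply: le_trans (l_le eps0 lmin) _; rewrite ler_wpM2l.
  rewrite /cT; clearbody w; move: (8 + 3 * r)%N (15 * d * d + 47 * d + 63)%N => a b.
  have c1 := ler_wpM2l (ler0n R a) l1.
  have c2 : b%:R <= b%:R * Z by rewrite ler_peMr ?ler0n.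
  have c3 := ler_wpM2l (ler0n R 22) NleZ.
  have c4 := ler_wpM2l (ler0n R w) NG.
  move: c1 c2 c3 c4; move: (8 * K)%N (8 * K * cg)%N (N * g)%N => K8 Kg Ng.
  rewrite (natrD R (a * l.+1 + b + 22 * N)) (natrD R (a * l.+1 + b)) (natrD R (a * l.+1)).
  rewrite (natrD R (2 * a + b + 22 * K8)) (natrD R (2 * a + b)) (natrD R (2 * a)).
  rewrite (natrM R a) (natrM R 22 N) (natrM R w Ng) (natrM R 2 a) (natrM R 22 K8) (natrM R w Kg).
  by move: (N%:R : R) (K8%:R : R) (Kg%:R : R) (Ng%:R : R) => ? ? ? ?; lra.
pose G := ((2 * d + 1) * (kap * 2 ^ l) ^ r)%N.
pose acc : R := (kap * 2 ^ l)%:R^-1.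
have acc01 : 0 <= acc <= 1 := accuracy_itv R kap0 l.
have fail := @failure_bound R d r kap d_gt0 kap0 K1 l delta delta_gt0.
exists T; split.
- apply: le_trans Tle _; rewrite ler_wpM2l ?ler0n // CZ //.
(* With the trivial postcondition and the trivial event the bound of [run_program] is 1, so the
   program halts within [T] with probability 1. *)
- apply/le_anti; rewrite run_prob_le1 /=.
  have := runs (fun=> True) (fun=> true) (fun _ _ _ _ _ _ => I) T (leqnn _).
  by rewrite nsamples_const.
apply: le_trans (runs _ (concentrated (input_prob P) n (@hitting R d n mu G) acc) _ T (leqnn _)).
  apply: le_trans (concentration (input_prob01 P) N acc01 _); last first.
    by move=> i A; rewrite /hitting; case: (hit _ _ _ _); rewrite ?ler01 ?lexx.
  rewrite lerD2l lerN2; apply: fail.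
    by rewrite /K1 natrD (le_trans (ltW (truncnS_gt _))) // lerDl ler0n.
  by rewrite /K1 leq_addl.
move=> l0 st szl conc s0N rep.
exists N, N0, (fun j => read_set d st j); split => //.
- apply: (represented_kernel d_gt0 r_gt0 (pt := input_pt P) (mu := mu) (p := input_prob P)
    (t := acc) (beta := beta) (G := G) (mm := mm) N0 (l := l0)) => //.
  + exact: input_ptE.
  + exact: input_probE.
  + exact: levels_gt0.
  + exact: levels_accuracy.
  + exact: fineness_accuracy.
  + exact: ltW.
  + have b2 : 0 < beta ^+ 2 by rewrite exprn_gt0.
    rewrite /acc natrM invfM natrX.
    have h1 : 7%:R <= kap%:R * beta ^+ 2.
      by rewrite -ler_pdivrMr // ltW // truncnS_gt.
    have h2 : (2 ^+ l)^-1 <= eps by rewrite -div1r ler_pdivrMr ?exprn_gt0 // mulrC.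
    apply: (@le_trans _ _ (beta ^+ 2 * (2 ^+ l)^-1)).
      rewrite mulrA ler_wpM2r ?invr_ge0 ?exprn_ge0 // ler_pdivrMr ?ltr0n // mulrC.
      by rewrite [leRHS]mulrC mulrC.
    by rewrite mulrC ler_wpM2r // ltW.
  + exact: ltW.
  + by move=> j; have [] := rep j (ltn_ord j).
- apply: (@le_trans _ _ (N * g)%:R).
    rewrite ler_nat; apply: card_ground_set => j; apply: leq_trans (card_read_set _ _ _) _.
    have [_] := rep j (ltn_ord j); rewrite size_full_grid; exact.
  (* The sets have at most N g points in all, of order eps^(-(rd - r + 4) / 2) up to the logarithm,
     which beats the stated size by a factor s^e'. *)
  apply: le_trans NG _; rewrite /polylog_bound -/x p2 expr1 -/Lx.
  apply: (@le_trans _ _ (C%:R * Z)); first by rewrite ler_wpM2r // ler_nat.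
  rewrite -mulrA ler_wpM2l ?ler0n // /Z ler_wpM2r ?(le_trans _ L1) //.
  rewrite -[X in X <= _]mul1r ler_wpM2r // mulr_ge0 ?exprn_ge0 //.
- exact: le_trans NleZ (CZ _ C3).
- move=> j; apply: (@le_trans _ _ g%:R).
    rewrite ler_nat; apply: leq_trans (card_read_set _ _ _) _.
    have [_] := rep j (ltn_ord j); rewrite size_full_grid; exact.
  apply: le_trans gle _; rewrite /polylog_bound -/x p0 expr0 mulr1.
  by rewrite ler_wpM2r ?exprn_ge0 // ler_nat.
Qed.
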